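(* Let $p_n=2m$ (with $m=m_n\in\mathbb N$) be such that $p_n^2/n\to 0$. Let $X\sim N(0,\frac1n I_{p_n})$ and, for $v\in\mathbb R^{p_n}$, $$\mathcal L(v)=\mathcal L(v,0)=nX^\top v-\tfrac n2\|v\|^2+\tfrac n3 f(v)\|v\|^3,$$ where $f=f_n$ is the function specified in the context (depending on a fixed constant $L>0$ and a fixed kernel $K$). The target parameter is $\theta=\Pi_2 v\in\mathbb R^m$, the first $m$ components of $v=(\theta,\eta)$. With $v^*=(\theta^*,\eta^* )=0$, let $\breve L(\theta)=\max_{\eta\in\mathbb R^{m}}\mathcal L(\theta,\eta)$, $\tilde\theta=\operatorname{argmax}_\theta\breve L(\theta)$, $\breve D=\sqrt n\,I_m$ and $\breve\xi=\sqrt n\,\Pi_2X$. Then: (1) The conditions $(\mathcal I)$, $(\mathcal L_0)$, $(\mathcal{ED}_0)$, $(\mathcal{ED}_1)$, $(\mathcal L\mathrm r)$ and $(\mathcal E\mathrm r)$ listed in the context are satisfied with $\mathcal D^2=\mathcal V^2=nI_{p_n}$ and central point $v^\circ=v^*=0$, with constants for which the semiparametric spread (defined in the context) satisfies $\breve\diamondsuit(r_0,x)=O(p_n/\sqrt n)$. (2) (Fisher theorem) If $p_n^2/n\to 0$, then $\|\breve D(\tilde\theta-\theta^* )-\breve\xi\|\to 0$ in probability. (3) (Wilks phenomenon) One has $$\big|\,2\{\breve L(\tilde\theta)-\breve L(\theta^* )\}-\|\breve\xi\|^2\,\big|\to 0\ \text{ in probability}$$ if and only if $p_n^3/n\to 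0$.
   Context: $\|\cdot\|$ is the Euclidean norm (operator norm for matrices). **The function $f$.** Let $K\ge 0$ be a smooth kernel on $\mathbb R$ with support in $[-1,1]$ and $\int K=1$, and put $K_h(x)=\frac1hK(x/h)$. Fix $L>0$, put $h=\frac1L\sqrt{p_n/n}$, and let $$f(v)=\varphi(\|\Pi_2v\|)\,1_{\{\|v\|\le 2\sqrt{p_n/n}\}},\qquad \varphi(t)=\int_{\mathbb R}1_{\{|s|\ge h\}}K_h(t-s)\,ds .$$ In particular $f(v)=0$ if $\Pi_2v=0$, and $f(v)=1$ on $\{\|\Pi_2v\|\ge\frac2L\sqrt{p_n/n}\}\cap\{\|v\|\le2\sqrt{p_n/n}\}$. **Setting and notation.** The full dimension is $p^*=p_n$ and the target dimension is $p=m$. The target point is $v^*=\operatorname{argmax}_v\mathbb E\mathcal L(v)$, which equals $0$ for $n$ large. Let $\mathcal D^2=-\nabla^2\mathbb E\mathcal L(v^* )$, $\mathcal V^2=\operatorname{Cov}(\nabla\mathcal L(v^* ))$, $\zeta(v)=\mathcal L(v)-\mathbb E\mathcal L(v)$ and $\mathcal L(v,v')=\mathcal L(v)-\mathcal L(v')$. Write in block form with respect to $v=(\theta,\eta)$ $$-\nabla^2\mathbb E\mathcal L(v)=\begin{pmatrix} D^2(v) & A(v) \\ {A(v)}^\top & H^2(v) \end{pmatrix},$$ and $D=D(v^* )$, $A=A(v^* )$, $H=H(v^* )$. In general $\breve D^2=D^2-AH^{-2}A^\top$ and $\breve\xi=\breve D^{-1}(\nabla_\theta\mathcal L(v^* )-AH^{-2}\nabla_\eta\mathcal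 L(v^* ))$, which here give $\sqrt n I_m$ and $\sqrt n\,\Pi_2X$. Local sets are $\Upsilon_\circ(r)=\{v:\|\mathcal D(v-v^* )\|\le r\}$. Let $\tilde v=\operatorname{argmax}_v\mathcal L(v)$ and $\tilde v_{\theta^*}=\operatorname{argmax}_{v:\Pi_2v=\theta^*}\mathcal L(v)$. For $x>0$, $r_0=r_0(x)$ is the infimum of all $r>0$ with $\mathbb P(\tilde v,\tilde v_{\theta^*}\in\Upsilon_\circ(r))\ge 1-e^{-x}$. **Conditions.** - $(\mathcal I)$: there is $\rho\in[0,1)$ with $\|D^{-1}AH^{-1}\|\le\rho$. - $(\mathcal L_0)$: for each $r\le r_0$ there is a constant $\delta(r)$ such that for all $v\in\Upsilon_\circ(r)$: $\|D^{-1}D^2(v)D^{-1}-I_p\|\le\delta(r)$, $\|D^{-1}(A(v)-A)H^{-1}\|\le\delta(r)$, and $\|D^{-1}AH^{-1}(I-H^{-1}H^2(v)H^{-1})\|\le\delta(r)$. - $(\mathcal{ED}_0)$: there are $\nu_0>0$, $g>0$ such that for all $|\mu|\le g$: $\sup_{\gamma\in\mathbb R^{p^*}}\log\mathbb E\exp\{\mu\langle\nabla\zeta(v^\circ),\gamma\rangle/\|\mathcal V\gamma\|\}\le\nu_0^2\mu^2/2$. - $(\mathcal{ED}_1)$: there are constants $\omega\le1/2$ and $\nu_1$ such that for all $|\mu|\le g$ and $0<r<r_0$: $\sup_{v,v'\in\Upsilon_\circ(r)}\sup_{\|\gamma\|=1}\log\mathbb E\exp\Big\{\mu\frac{\gamma^\top\mathcal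 D^{-1}\{\nabla\zeta(v)-\nabla\zeta(v')\}}{\omega\|\mathcal D(v-v')\|}\Big\}\le\nu_1^2\mu^2/2$. - $(\mathcal L\mathrm r)$: for every $r>r_0$ there is $b(r)>0$ with $-\mathbb E\mathcal L(v,v^\circ)/\|\mathcal D(v-v^\circ)\|^2\ge b(r)$ for all $v\in\Upsilon_\circ(r)$, $v\ne v^\circ$. - $(\mathcal E\mathrm r)$: for every $r\ge r_0$ there are constants $g(r)>0$ and $\nu_r$ with $\sup_{v\in\Upsilon_\circ(r)}\sup_{\mu\le g(r)}\sup_{\gamma\in\mathbb R^{p^*}}\log\mathbb E\exp\{\mu\langle\nabla\zeta(v),\gamma\rangle/\|\mathcal D\gamma\|\}\le\nu_r^2\mu^2/2$. (Suprema over $\gamma$ and over pairs $v,v'$ exclude zero denominators.) **Spread.** For $r,x>0$, $$\breve\diamondsuit(r,x)=\Big(\frac{8}{(1-\rho^2)^2}\delta(r)+6\nu_1\omega\,\mathfrak z(x,2p^*+2p)\Big)r,$$ where, for $Q>0$, $\mathfrak z(x,Q)=\sqrt{2(x+Q)}$ if $\sqrt{2(x+Q)}\le g$, and $\mathfrak z(x,Q)=g^{-1}(x+Q)+g/2$ otherwise. The statement $\breve\diamondsuit(r_0,x)=O(p_n/\sqrt n)$ is for fixed $x$ as $n\to\infty$.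
   Formalization: ''Only if'' in (3) assumes φ(√(m/n))>0 (automatic if supp K=[-1,1]), since f may vanish identically; (L_0) is claimed where the Hessian of E L exists, as f jumps on ‖v‖=2√(p_n/n); for p_n→∞ and n large that is the whole local set. *)

(* Defs.v *)
From HB Require Import structures.
From mathcomp Require Import all_boot all_order all_algebra.
From mathcomp Require Import all_classical all_reals all_analysis.

Set Implicit Arguments.
Unset Strict Implicit.
Unset Printing Implicit Defensive.

Import Order.TTheory GRing.Theory Num.Theory.
Import numFieldNormedType.Exports.

Local Open Scope classical_set_scope.
Local Open Scope ring_scope.

(* The library norm on matrices is the sup norm, hence the Euclidean norm and
   its operator norm are defined here.  The sup norm only enters through the
   topology used by derivatives, which is the same. *)

Definition dotp (R : realType) (p : nat) (u v : 'cV[R]_p) : R :=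
  (u^T *m v) 0 0.

Definition enorm (R : realType) (p : nat) (v : 'cV[R]_p) : R :=
  Num.sqrt (\sum_i v i 0 ^+ 2).

Definition opnorm (R : realType) (p q : nat) (A : 'M[R]_(p, q)) : R :=
  sup [set enorm (A *m v) | v in [set v : 'cV[R]_q | enorm v <= 1]].

Definition grad (R : realType) (p : nat) (F : 'cV[R]_p -> R) (v : 'cV[R]_p) :
    'cV[R]_p :=
  \col_i 'D_(delta_mx i 0) F v.

Definition hess (R : realType) (p : nat) (F : 'cV[R]_p -> R) (v : 'cV[R]_p) :
    'M[R]_p :=
  \matrix_(i, j) 'D_(delta_mx i 0) (fun w => grad F w j 0) v.

Definition twice_differentiable (R : realType) (p : nat) (F : 'cV[R]_p -> R)
    (v : 'cV[R]_p) : Prop :=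
  (\forall w \near v, differentiable F w) /\ differentiable (grad F) v.

Definition is_argmax (R : realType) (V : Type) (S : set V) (F : V -> R)
    (v : V) : Prop :=
  S v /\ forall w, S w -> F w <= F v.

Definition is_unique_argmax (R : realType) (V : Type) (F : V -> R) (v : V) :
    Prop :=
  forall w, w <> v -> F w < F v.

Definition random_vector (R : realType) (d : measure_display)
    (T : measurableType d) (p : nat) (X : T -> 'cV[R]_p) : Prop :=
  forall i, measurable_fun setT (fun w => X w i 0).

(* X ~ N(0, s^2 I_p): the law of X is the p-fold product of N(0, s^2), stated on
   measurable boxes.  The second parameter of normal_prob is the standard
   deviation. *)
Definition gaussian_vector (R : realType) (d : measure_display)
    (T : measurableType d) (P : probability T R) (p : nat)
    (s : R) (X : T -> 'cV[R]_p) : Prop :=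
  random_vector X /\
  forall B : 'I_p -> set R, (forall i, measurable (B i)) ->
    P [set w | forall i, B i (X w i 0)] = (\prod_i normal_prob 0 s (B i))%E.

Definition cvg_in_prob (R : realType) (d : nat -> measure_display)
    (T : forall n, measurableType (d n)) (P : forall n, probability (T n) R)
    (Y : forall n, T n -> R) (l : R) : Prop :=
  forall e : R, 0 < e ->
    (fun n => P n [set w | e < `|Y n w - l|]) @ \oo --> 0%E.

Definition log_mgf (R : realType) (d : measure_display)
    (T : measurableType d) (P : probability T R) (Y : T -> R) (mu : R) : \bar R :=
  lne ('M_P Y mu).

Section model.
Context (R : realType).
Implicit Types (K : R -> R) (L : R).

Definition smooth_kernel K : Prop :=
  [/\ forall x, 0 <= K x,
      forall k x, derivable (derive1n k K) x 1,
      forall x, 1 < `|x| -> K x = 0 &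
      (\int[lebesgue_measure]_x (K x)%:E = 1)%E].

Definition rescaled K (h x : R) : R := h^-1 * K (x / h).

Definition phi K (h t : R) : R :=
  \int[lebesgue_measure]_s
    (\1_[set s : R | h <= `|s|] s * rescaled K h (t - s)).

(* sqrt(p_n / n) with p_n = m + m *)
Definition scale (n m : nat) : R := Num.sqrt ((m + m)%:R / n%:R).

Definition cutoff K L (n m : nat) (v : 'cV[R]_(m + m)) : R :=
  phi K (L^-1 * scale n m) (enorm (usubmx v)) *
  \1_[set u : 'cV[R]_(m + m) | enorm u <= 2 * scale n m] v.

Definition loglik K L (n m : nat) (x v : 'cV[R]_(m + m)) : R :=
  n%:R * dotp x v - n%:R / 2 * enorm v ^+ 2
  + n%:R / 3 * cutoff K L n v * enorm v ^+ 3.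

(* For 0 < m, 0 < n and any kernel, the integral below is phi h (sqrt (m / n))
   with h = L^-1 * scale n m, so this says that the cutoff f does not vanish when
   |Pi_2 v|^2 = m / n = E |Pi_2 X|^2.  It holds as soon as 2 * sqrt 2 <= L, and
   for every L > 0 if the support of K is the whole of [-1, 1].  Without it f may
   be identically 0: take K supported in [-1/2, 1/2] and L < 1/4. *)
Definition active_cutoff K L : Prop :=
  0 < \int[lebesgue_measure]_(u in `[-1, L / Num.sqrt 2 - 1]) K u.

End model.

Section conditions.
Context (R : realType) (d : measure_display) (T : measurableType d).
Context (P : probability T R) (m : nat).

(* Random functions of v are written lik : T -> 'cV_(m + m) -> R. *)
Implicit Types (lik : T -> 'cV[R]_(m + m) -> R) (v : 'cV[R]_(m + m)).
Implicit Types (DD VV : 'M[R]_(m + m)) (D A H : 'M[R]_m).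

Definition Elik lik v : R := fine 'E_P[fun w => lik w v].

Definition zeta lik (w : T) v : R := lik w v - Elik lik v.

Definition info lik v : 'M[R]_(m + m) := - hess (Elik lik) v.

Definition cov_score lik v : 'M[R]_(m + m) :=
  \matrix_(i, j) fine (covariance P (fun w => grad (lik w) v i 0)
                                    (fun w => grad (lik w) v j 0)).

Definition profile (F : 'cV[R]_(m + m) -> R) (theta : 'cV[R]_m) : R :=
  sup (range (fun eta : 'cV[R]_m => F (col_mx theta eta))).

Definition local_set DD (v0 : 'cV[R]_(m + m)) (r : R) : set 'cV[R]_(m + m) :=
  [set v | enorm (DD *m (v - v0)) <= r].

(* tv and tv0 stand for the global and the constrained maximizer *)
Definition local_radius DD (v0 : 'cV[R]_(m + m)) (tv tv0 : T -> 'cV[R]_(m + m))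
    (x : R) : R :=
  inf [set r : R | 0 < r /\
    ((1 - expR (- x))%:E <=
      P [set w | local_set DD v0 r (tv w) /\ local_set DD v0 r (tv0 w)])%E].

Definition cond_I D A H (rho : R) : Prop :=
  (0 <= rho < 1) /\ opnorm (invmx D *m A *m invmx H) <= rho.

(* The condition is imposed at the points of S, meant to be points where the
   Hessian of Elik exists: the cutoff jumps on the sphere |v| = 2 sqrt (p_n / n),
   and there the total function hess takes meaningless values. *)
Definition cond_L0 lik DD (v0 : 'cV[R]_(m + m)) D A H (r0 : R)
    (S : set 'cV[R]_(m + m)) (delta : R -> R) : Prop :=
  forall r v, r <= r0 -> local_set DD v0 r v -> S v ->
  let D2v := ulsubmx (info lik v) in
  let Av := ursubmx (info lik v) in
  let H2v := drsubmx (info lik v) in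
  [/\ opnorm (invmx D *m D2v *m invmx D - 1%:M) <= delta r,
      opnorm (invmx D *m (Av - A) *m invmx H) <= delta r &
      opnorm (invmx D *m A *m invmx H *m
              (1%:M - invmx H *m H2v *m invmx H)) <= delta r].

Definition cond_ED0 lik VV (v0 : 'cV[R]_(m + m)) (nu0 g : R) : Prop :=
  [/\ 0 < nu0, 0 < g &
      forall (mu : R) (gamma : 'cV[R]_(m + m)),
        `|mu| <= g -> enorm (VV *m gamma) != 0 ->
        (log_mgf P (fun w => dotp (grad (zeta lik w) v0) gamma
                             / enorm (VV *m gamma))%R mu
         <= (nu0 ^+ 2 * mu ^+ 2 / 2)%:E)%E].

Definition cond_ED1 lik DD (v0 : 'cV[R]_(m + m)) (r0 : R) (nu1 omega g : R) :
    Prop :=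
  [/\ 0 < nu1, 0 < omega <= 1 / 2 &
      forall (mu r : R) v v' (gamma : 'cV[R]_(m + m)),
        `|mu| <= g -> 0 < r < r0 ->
        local_set DD v0 r v -> local_set DD v0 r v' ->
        enorm (DD *m (v - v')) != 0 -> enorm gamma = 1 ->
        (log_mgf P
           (fun w => dotp gamma
              (invmx DD *m (grad (zeta lik w) v - grad (zeta lik w) v'))
              / (omega * enorm (DD *m (v - v'))))%R mu
         <= (nu1 ^+ 2 * mu ^+ 2 / 2)%:E)%E].

Definition cond_Lr lik DD (v0 : 'cV[R]_(m + m)) (r0 : R) : Prop :=
  forall r, r0 < r -> exists2 b : R, 0 < b &
    forall v, local_set DD v0 r v -> v != v0 ->
      b <= - fine 'E_P[fun w => lik w v - lik w v0]
           / enorm (DD *m (v - v0)) ^+ 2.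

(* mu ranges over all reals <= gr, negative ones included *)
Definition cond_Er lik DD (v0 : 'cV[R]_(m + m)) (r0 : R) : Prop :=
  forall r, r0 <= r -> exists gr nur : R, 0 < gr /\
    forall (mu : R) v (gamma : 'cV[R]_(m + m)),
      local_set DD v0 r v -> mu <= gr -> enorm (DD *m gamma) != 0 ->
      (log_mgf P (fun w => dotp (grad (zeta lik w) v) gamma
                           / enorm (DD *m gamma))%R mu
       <= (nur ^+ 2 * mu ^+ 2 / 2)%:E)%E.

End conditions.

Section spread.
Context (R : realType).

Definition zfun (g x Q : R) : R :=
  if Num.sqrt (2 * (x + Q)) <= g then Num.sqrt (2 * (x + Q))
  else g^-1 * (x + Q) + g / 2.

(* full dimension p^* = pstar, target dimension p *)
Definition spread (pstar p : nat) (rho nu1 omega g : R) (delta : R -> R)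
    (r x : R) : R :=
  (8 / (1 - rho ^+ 2) ^+ 2 * delta r
   + 6 * nu1 * omega * zfun g x (2 * pstar%:R + 2 * p%:R)) * r.

End spread.

(* Main.v *)
Require Import Defs.
From HB Require Import structures.
From mathcomp Require Import all_boot all_order all_algebra.
From mathcomp Require Import all_classical all_reals all_analysis.
From mathcomp Require Import measurable_realfun ring lra.

Set Implicit Arguments.
Unset Strict Implicit.
Unset Printing Implicit Defensive.

Import Order.TTheory GRing.Theory Num.Theory.
Import numFieldNormedType.Exports.

Local Open Scope classical_set_scope.
Local Open Scope ring_scope.

(** Write [p = m + m] for the full dimension and [s = scale R n m], that is
    [s ^ 2 = p / n].  Up to a constant the log-likelihood is
      [- n / 2 * |v - X| ^ 2 + n / 3 * f v * |v| ^ 3],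
    a quadratic function maximal at the Gaussian vector [X] plus a cubic
    perturbation that lives on the ball of radius [2 s] and never exceeds a
    multiple of [n s ^ 3].  Three facts follow.

    - The stochastic part of the likelihood is [n * dotp X v], linear in [v].  So
      the gradient of [zeta] is the constant Gaussian vector [n X], its
      exponential moments are explicit ([integral_expR_dotp]), and its increments
      vanish: in ED1 every [omega] is allowed, and [omega = 1 / n] is chosen.
      The expected likelihood has Hessian [- n I] up to a relative error of order
      [s] ([hess_mean_le]): two derivatives of [f v * |v| ^ 3] cost at most
      [1 / s ^ 2].  Where the cutoff degenerates, at [usubmx v = 0], the kernel
      vanishes at the ends of its support together with its derivative, which
      makes the perturbation flat there.  Chernoff bounds
      for [|X| ^ 2] put both maximizers at distance [O(s)] from [0], so the
      local radius is [O(sqrt p)] ([local_radius_le]) and the spread is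
      [O(s * sqrt p) = O(p / sqrt n)].

    - Inside the ball of radius [2 s] the perturbation has Lipschitz constant of
      order [s ^ 2], and hence moves the maximizer by [O(s ^ 2)]; outside the ball
      it does not act at all.  The Fisher error is therefore at most a constant
      times [sqrt n * s ^ 2 = p / sqrt n], except when [X] lies in a thin shell
      just outside the ball ([profile_argmax_dist]).  That shell has small
      probability, either by concentration of [|X| ^ 2] around [s ^ 2] (large [p])
      or because one Gaussian coordinate does not charge short intervals
      (bounded [p]); see [fisher_error_prob_le].

    - The Wilks error is nonnegative and at most a multiple of
      [n s ^ 3 = sqrt (p ^ 3 / n)] for every sample ([wilks_error_le]).  Comparing
      the maximum with the value of the likelihood at [X] shows that it is at
      least [2 n / 3 * f X * |X| ^ 3], which has the same order as soon as the
      cutoff is active at [X] ([wilks_error_ge]); by concentration this happens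
      with high probability when [p] is large. *)

(** * Euclidean geometry of column vectors *)

Section euclid.
Context {R : realType}.

Lemma dotpE p (u v : 'cV[R]_p) : dotp u v = \sum_i u i 0 * v i 0.
Proof. by rewrite /dotp mxE; apply: eq_bigr => i _; rewrite mxE. Qed.

Lemma enorm_ge0 p (v : 'cV[R]_p) : 0 <= enorm v.
Proof. exact: sqrtr_ge0. Qed.

Lemma enorm_sqE p (v : 'cV[R]_p) : enorm v ^+ 2 = \sum_i v i 0 ^+ 2.
Proof. by rewrite sqr_sqrtr// sumr_ge0// => i _; exact: sqr_ge0. Qed.

Lemma enorm_sq p (v : 'cV[R]_p) : enorm v ^+ 2 = dotp v v.
Proof. by rewrite enorm_sqE dotpE; apply: eq_bigr => i _; rewrite expr2. Qed.

Lemma dotpC p (u v : 'cV[R]_p) : dotp u v = dotp v u.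
Proof. by rewrite !dotpE; apply: eq_bigr => i _; rewrite mulrC. Qed.

Lemma dotpDr p (u v w : 'cV[R]_p) : dotp u (v + w) = dotp u v + dotp u w.
Proof. by rewrite /dotp mulmxDr mxE. Qed.

Lemma dotpZr p (a : R) (u v : 'cV[R]_p) : dotp u (a *: v) = a * dotp u v.
Proof. by rewrite /dotp -scalemxAr mxE. Qed.

Lemma dotpDl p (u v w : 'cV[R]_p) : dotp (u + v) w = dotp u w + dotp v w.
Proof. by rewrite dotpC dotpDr !(dotpC w). Qed.

Lemma dotpZl p (a : R) (u v : 'cV[R]_p) : dotp (a *: u) v = a * dotp u v.
Proof. by rewrite dotpC dotpZr dotpC. Qed.

Lemma dotp0 p (u : 'cV[R]_p) : dotp u 0 = 0.
Proof. by rewrite -[0](scale0r 0) dotpZr mul0r. Qed.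

Lemma dotpNr p (u v : 'cV[R]_p) : dotp u (- v) = - dotp u v.
Proof. by rewrite -scaleN1r dotpZr mulN1r. Qed.

Lemma enormD_sq p (u v : 'cV[R]_p) :
  enorm (u + v) ^+ 2 = enorm u ^+ 2 + 2 * dotp u v + enorm v ^+ 2.
Proof. by rewrite !enorm_sq dotpDl !dotpDr (dotpC v u); ring. Qed.

Lemma enormB_sq p (u v : 'cV[R]_p) :
  enorm (u - v) ^+ 2 = enorm u ^+ 2 - 2 * dotp u v + enorm v ^+ 2.
Proof.
have e : enorm (- v) ^+ 2 = enorm v ^+ 2.
  by rewrite !enorm_sq dotpNr dotpC dotpNr opprK.
by rewrite enormD_sq dotpNr e mulrN.
Qed.

Lemma enormZ p (a : R) (v : 'cV[R]_p) : enorm (a *: v) = `|a| * enorm v.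
Proof.
apply/eqP; rewrite -(@eqrXn2 _ 2) ?mulr_ge0 ?enorm_ge0//; apply/eqP.
by rewrite exprMn real_normK ?num_real// !enorm_sq dotpZr dotpZl mulrA expr2.
Qed.

Lemma enormN p (v : 'cV[R]_p) : enorm (- v) = enorm v.
Proof. by rewrite -scaleN1r enormZ normrN1 mul1r. Qed.

Lemma enorm0 p : enorm (0 : 'cV[R]_p) = 0.
Proof. by rewrite -(scale0r 0) enormZ normr0 mul0r. Qed.

Lemma coord_le_enorm p (v : 'cV[R]_p) i : `|v i 0| <= enorm v.
Proof.
rewrite -(@ler_pXn2r _ 2) ?nnegrE ?enorm_ge0//.
rewrite real_normK ?num_real// enorm_sqE (bigD1 i)//= lerDl.
by apply: sumr_ge0 => j _; exact: sqr_ge0.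
Qed.

Lemma enorm_eq0 p (v : 'cV[R]_p) : enorm v = 0 -> v = 0.
Proof.
move=> v0; apply/matrixP => i j; rewrite ord1 mxE; apply/eqP.
by rewrite -normr_eq0 eq_le normr_ge0 andbT -v0 coord_le_enorm.
Qed.

Lemma enorm_gt0 p (v : 'cV[R]_p) : v != 0 -> 0 < enorm v.
Proof.
move=> /eqP v0; rewrite lt_neqAle enorm_ge0 andbT eq_sym; apply/eqP => h.
by apply: v0; exact: enorm_eq0.
Qed.

Lemma cauchy_schwarz p (u v : 'cV[R]_p) : `|dotp u v| <= enorm u * enorm v.
Proof.
have [->|v0] := eqVneq v 0; first by rewrite dotp0 normr0 enorm0 mulr0.
have vgt0 := enorm_gt0 v0.
rewrite -(@ler_pXn2r _ 2) ?nnegrE ?mulr_ge0 ?enorm_ge0//.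
rewrite real_normK ?num_real// exprMn.
have := sqr_ge0 (enorm (enorm v ^+ 2 *: u - dotp u v *: v)).
rewrite enormB_sq !enormZ dotpZl dotpZr !exprMn !real_normK ?num_real//.
have -> : (enorm v ^+ 2) ^+ 2 * enorm u ^+ 2 -
    2 * (enorm v ^+ 2 * (dotp u v * dotp u v)) + dotp u v ^+ 2 * enorm v ^+ 2
  = enorm v ^+ 2 * (enorm u ^+ 2 * enorm v ^+ 2 - dotp u v ^+ 2) by ring.
by rewrite pmulr_rge0 ?exprn_gt0// subr_ge0.
Qed.

Lemma dotp_le p (u v : 'cV[R]_p) : dotp u v <= enorm u * enorm v.
Proof. exact: le_trans (ler_norm _) (cauchy_schwarz u v). Qed.

Lemma ler_enormD p (u v : 'cV[R]_p) : enorm (u + v) <= enorm u + enorm v.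
Proof.
rewrite -(@ler_pXn2r _ 2) ?nnegrE ?addr_ge0 ?enorm_ge0// enormD_sq.
by have := dotp_le u v; lra.
Qed.

Lemma enormBC p (u v : 'cV[R]_p) : enorm (u - v) = enorm (v - u).
Proof. by rewrite -enormN opprB. Qed.

Lemma ler_dist_enorm p (u v : 'cV[R]_p) : `|enorm u - enorm v| <= enorm (u - v).
Proof.
have h (a b : 'cV[R]_p) : enorm a - enorm b <= enorm (a - b).
  by rewrite lerBlDr -{1}(subrK b a) ler_enormD.
by rewrite ler_norml h andbT lerNl opprB enormBC h.
Qed.

Lemma enorm_block_sq p q (v : 'cV[R]_(p + q)) :
  enorm v ^+ 2 = enorm (usubmx v) ^+ 2 + enorm (dsubmx v) ^+ 2.
Proof.
rewrite !enorm_sqE big_split_ord/=.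
by congr (_ + _); apply: eq_bigr => i _; rewrite mxE.
Qed.

Lemma enorm_usubmx_le p q (v : 'cV[R]_(p + q)) : enorm (usubmx v) <= enorm v.
Proof.
rewrite -(@ler_pXn2r _ 2) ?nnegrE ?enorm_ge0// enorm_block_sq lerDl.
exact: sqr_ge0.
Qed.

Lemma enorm_dsubmx_le p q (v : 'cV[R]_(p + q)) : enorm (dsubmx v) <= enorm v.
Proof.
rewrite -(@ler_pXn2r _ 2) ?nnegrE ?enorm_ge0// (enorm_block_sq v) lerDr.
exact: sqr_ge0.
Qed.

Lemma enorm_col_mx0 p q (u : 'cV[R]_p) :
  enorm (col_mx u (0 : 'cV[R]_q)) = enorm u.
Proof.
apply/eqP; rewrite -(@eqrXn2 _ 2) ?enorm_ge0// enorm_block_sq.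
by rewrite col_mxKu col_mxKd enorm0 expr0n addr0.
Qed.

Lemma enorm_0col_mx p q (u : 'cV[R]_q) :
  enorm (col_mx (0 : 'cV[R]_p) u) = enorm u.
Proof.
apply/eqP; rewrite -(@eqrXn2 _ 2) ?enorm_ge0// enorm_block_sq.
by rewrite col_mxKu col_mxKd enorm0 expr0n add0r.
Qed.

Lemma opnorm_le p q (A : 'M[R]_(p, q)) (c : R) : 0 <= c ->
  (forall u, enorm (A *m u) <= c * enorm u) -> opnorm A <= c.
Proof.
move=> c0 Ac; apply: ge_sup.
  by exists (enorm (A *m 0)); exists 0 => //=; rewrite enorm0 ler01.
move=> _ [u /= u1 <-]; apply: le_trans (Ac u) _.
by rewrite -[leRHS]mulr1 ler_wpM2l.
Qed.

Lemma opnorm0_le p q (c : R) : 0 <= c -> opnorm (0 : 'M[R]_(p, q)) <= c.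
Proof.
by move=> c0; apply: opnorm_le => // u; rewrite mul0mx enorm0 mulr_ge0 ?enorm_ge0.
Qed.

End euclid.

(** * The smoothing kernel and the cutoff profile *)

Section lipschitz.
Context {R : realType}.

Lemma bounded_derive_lip (f df : R -> R) (c : R) :
  (forall x : R, is_derive x 1 f (df x)) -> (forall x, `|df x| <= c) ->
  forall x y, `|f x - f y| <= c * `|x - y|.
Proof.
move=> fdf dfc.
suff h x y : y <= x -> `|f x - f y| <= c * `|x - y|.
  move=> x y; have [/h//|/ltW/h] := leP y x.
  by rewrite distrC (distrC x).
move=> yx; have [|c' _ ->] := @MVT_segment R f df y x yx (fun z _ => fdf z).
  apply: derivable_within_continuous => z _; have [] := fdf z; by [].
by rewrite normrM ler_wpM2r.
Qed.

(** Vanishing at [a] propagates from a derivative bounded by a power of the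
    distance to [a]; this turns flatness of a kernel at the end of its support
    into polynomial bounds. *)
Lemma derive_pow_bound (f df : R -> R) (a c : R) k :
  (forall x : R, is_derive x 1 f (df x)) -> f a = 0 -> 0 <= c ->
  (forall x, a <= x -> `|df x| <= c * (x - a) ^+ k) ->
  forall x, a <= x -> `|f x| <= c * (x - a) ^+ k.+1.
Proof.
move=> fdf fa c0 dfc x ax.
have [|y yax e] := @MVT_segment R f df a x ax (fun z _ => fdf z).
  by apply: derivable_within_continuous => z _; have [] := fdf z.
rewrite -[f x]subr0 -fa e normrM (ger0_norm (_ : 0 <= x - a)) ?subr_ge0//.
rewrite exprSr mulrA ler_wpM2r ?subr_ge0//.
move: yax; rewrite in_itv/= => /andP[ay yx].
apply: le_trans (dfc _ ay) _; rewrite ler_wpM2l// lerXn2r ?nnegrE ?subr_ge0//.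
by rewrite lerD2r.
Qed.

End lipschitz.

Section kernel.
Context {R : realType}.
Notation mu := lebesgue_measure.
Variable K : R -> R.
Hypothesis hK : smooth_kernel K.

Let K_ge0 x : 0 <= K x. Proof. by case: hK. Qed.

Let derK k (x : R) : is_derive x 1 (derive1n k K) (derive1n k.+1 K x).
Proof.
case: hK => _ /(_ k x) h _ _.
by rewrite derive1nS derive1E; exact: derivableP.
Qed.

Let cont_derK k : continuous (derive1n k K).
Proof.
move=> x; apply/differentiable_continuous/derivable1_diffP.
by case: hK => _ /(_ k x).
Qed.

Let derK_out k x : 1 < `|x| -> derive1n k K x = 0.
Proof.
elim: k x => [|k IH] x x1; first by case: hK => _ _ h _; exact: h.
rewrite derive1nS derive1E.
rewrite (@near_eq_derive _ _ _ _ (cst 0)) ?derive_cst ?oner_eq0//.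
have : \forall z \near x, 1 < `|z|.
  have /cvgr_gt/(_ 1 x1)// : `|z| @[z --> x] --> `|x|.
  by apply: cvg_norm; exact: cvg_id.
by apply: filterS => z /IH.
Qed.

Let derK_bounded k : exists M, forall x, `|derive1n k K x| <= M.
Proof.
have [||c _ hc] := @EVT_max R (fun x => `|derive1n k K x|) (-1) 1.
- by rewrite lerNl opprK lexx || lra.
- apply: continuous_subspaceT => x.
  by apply: cvg_norm; exact: cont_derK.
exists `|derive1n k K c| => x; have [x1|x1] := leP `|x| 1.
  by apply: hc; rewrite in_itv/= -ler_norml.
by rewrite derK_out// normr0.
Qed.

Let derK_edge k x : `|x| = 1 -> derive1n k K x = 0.
Proof.
move=> x1; apply/eqP; rewrite -normr_le0; apply/ler_addgt0Pl => e e0.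
have [M hM] := derK_bounded k.+1.
have M0 : 0 <= M := le_trans (normr_ge0 _) (hM 0).
pose d := e / (M + 1).
have d0 : 0 < d by rewrite divr_gt0// ltr_wpDl.
have out : derive1n k K (x * (1 + d)) = 0.
  apply: derK_out; rewrite normrM x1 mul1r gtr0_norm ?addr_gt0//.
  by rewrite ltrDl.
rewrite addr0 -[derive1n k K x]subr0 -out.
apply: le_trans (bounded_derive_lip (derK k) hM _ _) _.
rewrite (_ : x - _ = - (x * d)); last by ring.
rewrite normrN normrM x1 mul1r gtr0_norm// /d mulrCA ger_pMr//.
by rewrite ler_pdivrMr ?mul1r ?lerDl// ltr_wpDl.
Qed.

Lemma kernel_out x : 1 <= `|x| -> K x = 0.
Proof.
by rewrite le_eqVlt => /predU1P[/esym/(@derK_edge 0)|/(@derK_out 0)].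
Qed.

Lemma kernel_continuous : continuous K. Proof. exact: (@cont_derK 0). Qed.

Lemma is_derive_kernel (x : R) : is_derive x 1 K (derive1 K x).
Proof. exact: (derK 0). Qed.

(** The quadratic bound at the left end of the support comes from the vanishing
    of the kernel and of its derivative there. *)
Lemma kernel_bounds : exists M, [/\ 1 <= M, forall x, `|K x| <= M,
  forall x, `|derive1 K x| <= M & forall x, -1 <= x -> K x <= M * (x + 1) ^+ 2].
Proof.
have [M0 h0] := derK_bounded 0; have [M1 h1] := derK_bounded 1.
have [M2 h2] := derK_bounded 2.
pose M := 1 + `|M0| + `|M1| + `|M2|.
have le_M (a b : R) : `|a| <= b -> b <= `|b|.
  by move=> ab; rewrite ger0_norm// (le_trans _ ab).
have hM1 : 1 <= M by rewrite /M -!addrA lerDl !addr_ge0.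
exists M; split => //.
- move=> x; apply: le_trans (h0 x) (le_trans (ler_norm _) _).
  by rewrite /M; have := normr_ge0 M1; have := normr_ge0 M2; lra.
- move=> x; apply: le_trans (h1 x) (le_trans (ler_norm _) _).
  by rewrite /M; have := normr_ge0 M0; have := normr_ge0 M2; lra.
have M00 : 0 <= M by lra.
have e1 : `|-1 : R| = 1 by rewrite normrN1.
move=> x x1; apply: le_trans (ler_norm _) _; rewrite -[x + 1]/(x + 1).
have b1 y : -1 <= y -> `|derive1n 1 K y| <= M * (y - -1) ^+ 1.
  apply: (derive_pow_bound (derK 1) (derK_edge 1 e1) M00) => z _.
  rewrite expr0 mulr1; apply: le_trans (h2 z) (le_trans (ler_norm _) _).
  by rewrite /M; have := normr_ge0 M0; have := normr_ge0 M1; lra.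
by have := derive_pow_bound (derK 0) (derK_edge 0 e1) M00 b1 x1; rewrite opprK.
Qed.

Lemma integrable_kernel : mu.-integrable setT (EFin \o K).
Proof.
apply/integrableP; split.
  by apply/measurable_EFinP; apply: continuous_measurable_fun; exact: kernel_continuous.
under eq_integral do rewrite /= ger0_norm//.
by case: hK => _ _ _ ->; rewrite ltry.
Qed.

Definition kernel_cdf (u : R) : R := \int[mu]_(x in `]-oo, u]) K x.

Lemma is_derive_kernel_cdf (u : R) : is_derive u 1 kernel_cdf (K u).
Proof.
have [||||dF F'] := @continuous_FTC1 R K -oo%O u (u + 1).
- by rewrite ltrDl.
- by apply: integrableS integrable_kernel.
- by rewrite ltNyr.
- exact: kernel_continuous.
apply: DeriveDef; first exact: dF.
by rewrite -derive1E; exact: F'.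
Qed.

Lemma kernel_cdf_continuous : continuous kernel_cdf.
Proof.
move=> x; apply/differentiable_continuous/derivable1_diffP.
by have [] := is_derive_kernel_cdf x.
Qed.

Lemma kernel_cdf_ge0 u : 0 <= kernel_cdf u.
Proof. exact: Rintegral_ge0. Qed.

Lemma kernel_cdf_le1 u : kernel_cdf u <= 1.
Proof.
have -> : 1 = \int[mu]_x K x by rewrite /Rintegral; case: hK => _ _ _ ->.
rewrite /kernel_cdf /Rintegral fine_le//.
- apply: integrable_fin_num => //.
  exact: integrableS integrable_kernel.
- by apply: integrable_fin_num => //; exact: integrable_kernel.
apply: ge0_subset_integral => //.
- by apply/measurable_EFinP; apply: continuous_measurable_fun; exact: kernel_continuous.
- by move=> x _; rewrite lee_fin.
Qed.

Lemma kernel_cdf0 u : u <= -1 -> kernel_cdf u = 0.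
Proof.
move=> u1; rewrite /kernel_cdf (@eq_Rintegral _ _ _ _ _ (cst 0)).
  by rewrite Rintegral_cst//= mul0r.
move=> x; rewrite inE/= in_itv/= => xu; apply: kernel_out.
have x1 : x <= -1 := le_trans xu u1.
by rewrite ler0_norm; lra.
Qed.

Lemma kernel_cdf_itv u : \int[mu]_(x in `[-1, u]) K x = kernel_cdf u.
Proof.
rewrite /kernel_cdf Rintegral_mkcond [RHS]Rintegral_mkcond.
apply: eq_Rintegral => x _; rewrite !patchE.
have [x1|x1] := leP (-1) x.
  by rewrite !mem_setE !in_itv/= x1.
rewrite !mem_setE !in_itv/= leNgt x1/=; case: ifP => // _.
by rewrite kernel_out// ler0_norm; lra.
Qed.

Lemma kernel_cdf_nondecreasing : {homo kernel_cdf : u v / u <= v}.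
Proof.
move=> u v uv; rewrite /kernel_cdf /Rintegral fine_le//.
- by apply: integrable_fin_num => //; exact: integrableS integrable_kernel.
- by apply: integrable_fin_num => //; exact: integrableS integrable_kernel.
apply: ge0_subset_integral => //.
- apply: measurable_funTS; apply/measurable_EFinP.
  by apply: continuous_measurable_fun; exact: kernel_continuous.
- by move=> x _; rewrite lee_fin.
- by apply: subset_itvl; rewrite bnd_simp.
Qed.

(** Substituting [u = (t - s) / h] shows that the smoothed indicator is the
    distribution function of the kernel, read at [t / h - 1]: for [t >= 0] only
    the half line [s >= h] meets the support of the rescaled kernel. *)
Lemma phiE h t : 0 < h -> 0 <= t -> phi K h t = kernel_cdf (t / h - 1).
Proof.
move=> h0 t0; rewrite /phi.
transitivity (\int[mu]_(s in `[h, t + h]) (h^-1 * K ((t - s) / h))).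
  rewrite [RHS]Rintegral_mkcond; apply: eq_Rintegral => s _.
  rewrite patchE mem_setE in_itv/= indicE /rescaled.
  have [hs|sh] /= := leP h s.
    rewrite mem_set/=; last by rewrite ger0_norm// (le_trans _ hs)// ltW.
    rewrite mul1r; have [//|st] := leP s (t + h).
    rewrite kernel_out ?mulr0// ler0_norm; last first.
      rewrite pmulr_lle0 ?invr_gt0//; lra.
    by rewrite -mulNr ler_pdivlMr//; lra.
  have [/set_mem/= hs|_] := boolP (s \in _); last by rewrite mul0r.
  have {}hs : s <= - h.
    have [s0|s0] := leP 0 s; first by move: hs; rewrite ger0_norm// leNgt sh.
    by move: hs; rewrite ltr0_norm// lerNr.
  rewrite kernel_out ?mulr0// ger0_norm; last by rewrite divr_ge0//; lra.
  by rewrite ler_pdivlMr//; lra.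
have [->|tn0] := eqVneq t 0.
  by rewrite add0r set_itv1 Rintegral_set1 mul0r sub0r kernel_cdf0.
have {tn0}t0 : 0 < t by rewrite lt_neqAle eq_sym tn0.
pose F (s : R) : R := - kernel_cdf ((t - s) / h).
have dF (s : R) : is_derive s 1 F (h^-1 * K ((t - s) / h)).
  have d1 : is_derive s 1 (fun s : R => (t - s) / h) (- h^-1).
    apply: is_derive_eq; rewrite scaler0 !add0r mulrN1 scalerN; congr (- _); exact: mulr1.
  have d2 := is_derive_kernel_cdf ((t - s) / h).
  have d3 : is_derive s 1 (kernel_cdf \o (fun s => (t - s) / h)) (K ((t - s) / h) * - h^-1).
    exact: is_derive1_comp.
  have d4 := @is_deriveN _ _ _ _ _ _ _ d3.
  by apply: is_derive_eq; rewrite mulrN opprK mulrC.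
have cK : continuous (fun s : R => h^-1 * K ((t - s) / h)).
  move=> s; apply: cvgM; first exact: cvg_cst.
  apply: (cvg_comp (fun s => (t - s) / h) K); last exact: kernel_continuous.
  apply: cvgM; last exact: cvg_cst.
  by apply: cvgB; [exact: cvg_cst|exact: cvg_id].
have cF : continuous F.
  move=> s; apply/differentiable_continuous/derivable1_diffP.
  by have [] := dF s.
rewrite /Rintegral (@continuous_FTC2 R _ F).
- rewrite /= /F (_ : (t - (t + h)) / h = - 1); last by field; rewrite gt_eqF.
  rewrite (_ : (t - h) / h = t / h - 1); last by field; rewrite gt_eqF.
  by rewrite (kernel_cdf0 (lexx _)) oppr0 add0r opprK.
- by rewrite ltrDr.
- exact: continuous_subspaceT.
- split; first by move=> x _; have [] := dF x.
  + by apply: cvg_at_right_filter; exact: cF.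
  + by apply: cvg_at_left_filter; exact: cF.
- by move=> x _; rewrite derive1E; have [_] := dF x.
Qed.

Lemma kernel_cdf_lip M : (forall x, `|K x| <= M) ->
  forall u v, `|kernel_cdf u - kernel_cdf v| <= M * `|u - v|.
Proof. exact: bounded_derive_lip is_derive_kernel_cdf. Qed.

Lemma kernel_cdf_cube M : 1 <= M ->
  (forall x, -1 <= x -> K x <= M * (x + 1) ^+ 2) ->
  forall u, -1 <= u -> kernel_cdf u <= M * (u + 1) ^+ 3.
Proof.
move=> M1 KM u u1.
have M0 : 0 <= M by lra.
have b x : -1 <= x -> `|K x| <= M * (x - -1) ^+ 2.
  by move=> x1; rewrite opprK ger0_norm// KM.
have := derive_pow_bound is_derive_kernel_cdf (kernel_cdf0 (lexx _)) M0 b u1.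
by rewrite opprK; apply: le_trans; exact: ler_norm.
Qed.

End kernel.

(** * Maximizers of the log-likelihood for a fixed value of the score *)

Section maximizers.
Context {R : realType}.
Variables (K : R -> R) (L : R) (n m : nat).
Hypotheses (hK : smooth_kernel K) (L_gt0 : 0 < L).
Hypotheses (n_gt0 : (0 < n)%N) (m_gt0 : (0 < m)%N).

Local Notation s := (scale R n m).
Local Notation N := (n%:R : R).
Local Notation F := (@cutoff R K L n m).
Implicit Types (x v : 'cV[R]_(m + m)).

Let N_gt0 : 0 < N. Proof. by rewrite ltr0n. Qed.

Lemma scale_gt0 : 0 < s.
Proof. by rewrite sqrtr_gt0 divr_gt0// ltr0n addn_gt0 m_gt0. Qed.

Lemma scale_sq : s ^+ 2 = (m + m)%:R / N.
Proof. by rewrite sqr_sqrtr// divr_ge0. Qed.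

Let s_gt0 := scale_gt0.
Let s_ge0 : 0 <= s := ltW scale_gt0.

Let h_gt0 : 0 < L^-1 * s. Proof. by rewrite mulr_gt0 ?invr_gt0. Qed.

Lemma cutoff_in v : enorm v <= 2 * s ->
  F v = kernel_cdf K (enorm (usubmx v) / (L^-1 * s) - 1).
Proof.
by move=> vs; rewrite /cutoff indicE mem_set//= mulr1 phiE// enorm_ge0.
Qed.

Lemma cutoff_out v : 2 * s < enorm v -> F v = 0.
Proof.
move=> vs; rewrite /cutoff indicE memNset ?mulr0//=.
by apply/negP; rewrite -ltNge.
Qed.

Lemma cutoff_ge0 v : 0 <= F v.
Proof.
by have [/cutoff_in ->|/cutoff_out ->//] := leP (enorm v) (2 * s); exact: kernel_cdf_ge0.
Qed.

Lemma cutoff_le1 v : F v <= 1.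
Proof.
have [/cutoff_in ->|/cutoff_out ->//] := leP (enorm v) (2 * s).
exact: kernel_cdf_le1.
Qed.

Lemma cutoff_nuisance v : usubmx v = 0 -> F v = 0.
Proof.
move=> v0; have [/cutoff_in ->|/cutoff_out ->//] := leP (enorm v) (2 * s).
by rewrite v0 enorm0 mul0r sub0r kernel_cdf0.
Qed.

Lemma cubic_ge0 v : 0 <= F v * enorm v ^+ 3.
Proof. by rewrite mulr_ge0 ?cutoff_ge0 ?exprn_ge0 ?enorm_ge0. Qed.

Lemma cubic_le v : F v * enorm v ^+ 3 <= 8 * s ^+ 3.
Proof.
have [vs|/cutoff_out ->] := leP (enorm v) (2 * s); last first.
  by rewrite mul0r mulr_ge0 ?exprn_ge0.
rewrite (_ : 8 * s ^+ 3 = 1 * (2 * s) ^+ 3); last by rewrite mul1r exprMn; congr (_ * _); ring.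
by rewrite ler_pM ?cutoff_ge0 ?cutoff_le1 ?exprn_ge0 ?enorm_ge0// lerXn2r ?nnegrE ?enorm_ge0// mulr_ge0.
Qed.

(** The slope of the cutoff is of order [1 / s], so on the ball of radius [2 s]
    the cubic perturbation has Lipschitz constant of order [s ^ 2]. *)
Lemma cubic_lip M x v : 1 <= M -> (forall y, `|K y| <= M) ->
  enorm x <= 2 * s -> enorm v <= 2 * s ->
  `|F v * enorm v ^+ 3 - F x * enorm x ^+ 3| <=
    (8 * M * L + 12) * s ^+ 2 * enorm (v - x).
Proof.
move=> M1 KM xs vs.
have s2 : 0 <= 2 * s by rewrite mulr_ge0.
rewrite (_ : F v * _ - _ = (F v - F x) * enorm v ^+ 3 +
   F x * (enorm v ^+ 3 - enorm x ^+ 3)); last by ring.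
rewrite (_ : _ * enorm (v - x) =
  (M * (L / s) * enorm (v - x)) * (2 * s) ^+ 3 + 1 * (12 * s ^+ 2 * enorm (v - x))); last first.
  by field; rewrite gt_eqF.
apply: le_trans (ler_normD _ _) _; apply: lerD; rewrite normrM ler_pM//.
- rewrite !cutoff_in//; apply: le_trans (kernel_cdf_lip hK KM _ _) _.
  rewrite -[leRHS]mulrA ler_wpM2l ?(le_trans _ M1)//.
  rewrite (_ : _ - _ = L / s * (enorm (usubmx v) - enorm (usubmx x))); last first.
    by field; rewrite !gt_eqF.
  rewrite normrM (ger0_norm (_ : 0 <= L / s)); last by rewrite divr_ge0// ltW.
  rewrite ler_wpM2l//; first by rewrite divr_ge0// ltW.
  apply: le_trans (ler_dist_enorm _ _) _.
  by rewrite (_ : usubmx v - usubmx x = usubmx (v - x)) ?enorm_usubmx_le// linearB.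
- by rewrite ger0_norm ?exprn_ge0 ?enorm_ge0// lerXn2r ?nnegrE ?enorm_ge0.
- by rewrite ger0_norm ?cutoff_ge0 ?cutoff_le1.
- rewrite subrXX normrM mulrC.
  apply: ler_pM => //; last exact: ler_dist_enorm.
  rewrite big_ord_recl big_ord_recl big_ord1 /=/bump/= !expr0 mul1r mulr1 !expr1 -?expr2.
  have a0 := enorm_ge0 v; have b0 := enorm_ge0 x.
  rewrite ger0_norm; last by rewrite !addr_ge0 ?mulr_ge0 ?exprn_ge0.
  by nra.
Qed.

Lemma loglik_sq x v : loglik K L n x v =
  N / 2 * enorm x ^+ 2 - N / 2 * enorm (v - x) ^+ 2 + N / 3 * (F v * enorm v ^+ 3).
Proof. by rewrite /loglik enormB_sq (dotpC v x); field. Qed.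

Lemma loglik_le x v :
  loglik K L n x v <= N / 2 * enorm x ^+ 2 + N / 3 * (8 * s ^+ 3).
Proof.
rewrite loglik_sq lerD//; last by rewrite ler_wpM2l ?divr_ge0// cubic_le.
by rewrite gerDl oppr_le0 mulr_ge0 ?divr_ge0 ?sqr_ge0.
Qed.

Lemma loglik_nuisance x v : usubmx v = 0 -> loglik K L n x v =
  N / 2 * enorm (dsubmx x) ^+ 2 - N / 2 * enorm (dsubmx v - dsubmx x) ^+ 2.
Proof.
move=> v0; rewrite loglik_sq cutoff_nuisance// mul0r mulr0 addr0.
by rewrite (enorm_block_sq (v - x)) (enorm_block_sq x) !linearB/= v0 sub0r enormN; ring.
Qed.

(** The maximizer trades a quadratic loss against a perturbation between [0] and
    [8 s ^ 3]. *)
Lemma argmax_dist x v : is_argmax setT (loglik K L n x) v ->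
  enorm (v - x) ^+ 2 <= 16 / 3 * s ^+ 3.
Proof.
move=> [_ /(_ x I)]; rewrite !loglik_sq subrr enorm0 expr0n/= mulr0 subr0.
have := cubic_ge0 x; have := cubic_le v => h1 h2.
rewrite -addrA lerD2l => h.
rewrite -(ler_pM2l (_ : 0 < N / 2)) ?divr_gt0//.
have h3 : N / 3 * (F v * enorm v ^+ 3) <= N / 3 * (8 * s ^+ 3) by rewrite ler_wpM2l ?divr_ge0.
have h4 : 0 <= N / 3 * (F x * enorm x ^+ 3) by rewrite mulr_ge0 ?divr_ge0.
rewrite (_ : N / 2 * (16 / 3 * _) = N / 3 * (8 * s ^+ 3)); last by field.
by lra.
Qed.

Lemma constrained_argmax_norm x v :
  is_argmax [set v | usubmx v = 0] (loglik K L n x) v -> enorm v <= enorm x.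
Proof.
move=> [/= v0 /(_ (col_mx 0 (dsubmx x)))] /=; rewrite col_mxKu => /(_ erefl).
rewrite !loglik_nuisance ?col_mxKu// col_mxKd subrr enorm0 expr0n/= mulr0 subr0.
rewrite lerBrDl gerDr pmulr_rle0 ?divr_gt0// => h.
have {}h : enorm (dsubmx v - dsubmx x) = 0.
  by apply/eqP; rewrite -sqrf_eq0 eq_le h sqr_ge0.
rewrite -(@ler_pXn2r _ 2) ?nnegrE ?enorm_ge0// enorm_block_sq v0 enorm0 expr0n/= add0r.
rewrite (subr0_eq (enorm_eq0 h)) ler_pXn2r ?nnegrE ?enorm_ge0//.
exact: enorm_dsubmx_le.
Qed.

Lemma loglik_bounded x (theta : 'cV[R]_m) :
  has_sup (range (fun eta : 'cV[R]_m => loglik K L n x (col_mx theta eta))).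
Proof.
split; first by exists (loglik K L n x (col_mx theta 0)); exists 0.
exists (N / 2 * enorm x ^+ 2 + N / 3 * (8 * s ^+ 3)) => _ [eta _ <-].
exact: loglik_le.
Qed.

Lemma loglik_le_profile x v : loglik K L n x v <= profile (loglik K L n x) (usubmx v).
Proof.
rewrite -{1}(vsubmxK v); apply: sup_upper_bound; first exact: loglik_bounded.
by exists (dsubmx v).
Qed.

Lemma profile_le x theta c : (forall v, loglik K L n x v <= c) ->
  profile (loglik K L n x) theta <= c.
Proof.
move=> xc; apply: ge_sup; first by case: (loglik_bounded x theta).
by move=> _ [eta _ <-].
Qed.

Lemma profile0 x :
  profile (loglik K L n x) 0 = N / 2 * enorm (dsubmx x) ^+ 2.
Proof.
apply/eqP; rewrite eq_le; apply/andP; split.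
  apply: ge_sup; first by case: (loglik_bounded x 0).
  move=> _ [eta _ <-]; rewrite loglik_nuisance ?col_mxKu// gerDl oppr_le0.
  by rewrite mulr_ge0 ?divr_ge0 ?sqr_ge0.
have := loglik_le_profile x (col_mx 0 (dsubmx x)).
by rewrite col_mxKu loglik_nuisance ?col_mxKu// col_mxKd subrr enorm0 expr0n/= mulr0 subr0.
Qed.

Section profile_argmax.
Variables (x : 'cV[R]_(m + m)) (theta : 'cV[R]_m).
Hypothesis theta_max : is_argmax setT (profile (loglik K L n x)) theta.

Lemma loglik_le_max v : loglik K L n x v <= profile (loglik K L n x) theta.
Proof. exact: le_trans (loglik_le_profile x v) (theta_max.2 _ I). Qed.

Lemma profile_max v : is_argmax setT (loglik K L n x) v ->
  profile (loglik K L n x) theta = loglik K L n x v.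
Proof.
move=> [_ vmax]; apply/eqP; rewrite eq_le loglik_le_max andbT.
by apply: profile_le => w; exact: vmax.
Qed.

(** The cutoff vanishes on [usubmx v = 0], so the profile at [0] is that of the
    quadratic part; the maximum is compared with the value at [x], where the
    quadratic part is maximal. *)
Lemma wilks_ge : 2 * N / 3 * (F x * enorm x ^+ 3) <=
  2 * (profile (loglik K L n x) theta - profile (loglik K L n x) 0)
    - N * enorm (usubmx x) ^+ 2.
Proof.
have := loglik_le_max x; rewrite profile0 loglik_sq subrr enorm0 expr0n/=.
rewrite mulr0 subr0 (enorm_block_sq x).
have -> : 2 * N / 3 * (F x * enorm x ^+ 3) = 2 * (N / 3 * (F x * enorm x ^+ 3)) by field.
by lra.
Qed.

Lemma wilks_le :
  2 * (profile (loglik K L n x) theta - profile (loglik K L n x) 0)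
    - N * enorm (usubmx x) ^+ 2 <= 16 / 3 * (N * s ^+ 3).
Proof.
have := profile_le theta (loglik_le x); rewrite profile0 (enorm_block_sq x).
have -> : 16 / 3 * (N * s ^+ 3) = 2 * (N / 3 * (8 * s ^+ 3)) by field.
by lra.
Qed.

(** The supremum defining the profile at [theta] need not be attained, so a point
    whose likelihood is within [n s ^ 4] of the maximum is compared with [x].  When both lie in the ball of radius [2 s] the Lipschitz bound
    gives a distance of order [s ^ 2]; when [x] is outside the ball, the
    perturbation can only attract the maximizer into the ball if [x] is within
    a multiple of [s ^ (3 / 2)] of the sphere. *)
Lemma profile_argmax_dist M : 1 <= M -> (forall y, `|K y| <= M) -> s <= 1 ->
  enorm x <= 2 * s \/ 2 * s + 4 * (s * Num.sqrt s) < enorm x ->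
  enorm (theta - usubmx x) <= (8 * M * L + 14) * s ^+ 2.
Proof.
move=> M1 KM s1 xs.
have e_gt0 : 0 < N * s ^+ 4 by rewrite mulr_gt0 ?exprn_gt0.
have [_ [eta _ <-]] := sup_adherent e_gt0 (loglik_bounded x theta).
rewrite -/(profile (loglik K L n x) theta); set v := col_mx theta eta => hv.
have -> : theta - usubmx x = usubmx (v - x) by rewrite linearB/= col_mxKu.
apply: le_trans (enorm_usubmx_le _) _; set dv := enorm (v - x).
have dv0 : 0 <= dv := enorm_ge0 _.
have {hv}hv : dv ^+ 2 / 2 < (F v * enorm v ^+ 3 - F x * enorm x ^+ 3) / 3 + s ^+ 4.
  rewrite -(ltr_pM2l N_gt0); have := le_lt_trans (lerB (loglik_le_max x) (lexx _)) hv.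
  rewrite !loglik_sq subrr enorm0 expr0n/= mulr0 subr0 -/dv.
  set a := F v * _; set b := F x * _.
  rewrite mulrDr (_ : N * (dv ^+ 2 / 2) = N / 2 * dv ^+ 2); last by field.
  rewrite (_ : N * ((a - b) / 3) = N / 3 * a - N / 3 * b); last by field.
  by lra.
set c := 8 * M * L + 14.
have M0 : 0 <= M := le_trans ler01 M1.
have L0 : 0 <= L := ltW L_gt0.
have c14 : 14 <= c by rewrite /c lerDr !mulr_ge0.
rewrite leNgt; apply/negP => hd.
have s20 : 0 < s ^+ 2 by rewrite exprn_gt0.
have s4 : s ^+ 4 = s ^+ 2 * s ^+ 2 by rewrite -exprD.
have s3 : s ^+ 3 = s ^+ 2 * s by rewrite exprSr.
have s43 : s ^+ 4 <= s ^+ 3 by rewrite s4 s3 ler_pM2l// expr2 ger_pMr.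
have [vs|vs] := leP (enorm v) (2 * s); last first.
  (* [v] outside the ball gets no help from the perturbation *)
  move: hv; rewrite cutoff_out// mul0r; have := cubic_ge0 x => b0 hv.
  have : (c * s ^+ 2) ^+ 2 <= dv ^+ 2 by rewrite lerXn2r ?nnegrE ?mulr_ge0 ?(ltW hd)//; lra.
  by rewrite exprMn -exprM; have : 14 ^+ 2 <= c ^+ 2 by [rewrite lerXn2r ?nnegrE//; lra]; nra.
case: xs => [xs|xs].
  have := cubic_lip M1 KM xs vs; rewrite -/dv => /(le_trans (ler_norm _)) hl.
  rewrite (_ : 8 * M * L + 12 = c - 2) in hl; last by rewrite /c; ring.
  have h1 : c * s ^+ 2 * dv <= dv ^+ 2 by rewrite expr2 ler_wpM2r// ltW.
  have h2 : s ^+ 4 <= s ^+ 2 * dv.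
    by rewrite s4 ler_pM2l// (le_trans _ (ltW hd))// ler_peMl ?ltW//; lra.
  have h3 : 14 * (s ^+ 2 * dv) <= c * s ^+ 2 * dv.
    by rewrite -[leRHS]mulrA ler_wpM2r// mulr_ge0// ltW.
  rewrite (_ : (c - 2) * s ^+ 2 * dv = c * s ^+ 2 * dv - 2 * (s ^+ 2 * dv)) in hl; last by ring.
  have h4 : 0 < s ^+ 2 * dv by apply: lt_le_trans h2; rewrite exprn_gt0.
  by lra.
have := cubic_le v; have := cubic_ge0 x => b0 a8.
have hd2 : 4 * (s * Num.sqrt s) <= dv.
  have := le_trans (ler_norm _) (ler_dist_enorm x v); rewrite enormBC -/dv; lra.
have : (4 * (s * Num.sqrt s)) ^+ 2 <= dv ^+ 2.
  by rewrite lerXn2r ?nnegrE ?mulr_ge0// sqrtr_ge0.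
rewrite !exprMn (sqr_sqrtr s_ge0) -s3; have : 0 < s ^+ 3 by rewrite exprn_gt0.
by lra.
Qed.

End profile_argmax.

End maximizers.

(** * Differentials of functions of column vectors *)

Lemma littleo_is_diff (R : realType) (V W : normedModType R) (q : V -> W) v :
  q v = 0 -> q \o shift v =o_ (0 : V) id -> is_diff v q 0.
Proof.
move=> qv qo; pose z : {linear V -> W} := \0.
have cz : continuous z by exact: (@cst_continuous _ _ (0 : W)).
have eo : q \o shift v = cst (q v) + z +o_ 0 id.
  by apply: eqaddoE; rewrite [LHS]qo funeqE => y; rewrite !fctE qv !add0r.
have dq : 'd q v = z :> (V -> W) by exact: diff_unique.
apply: DiffDef; last by rewrite dq.
by apply/diff_locallyP; rewrite dq.
Qed.

Section differentials.
Context {R : realType} {p : nat}.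
Implicit Types (v w : 'cV[R]_p).

Lemma enorm_sq_le_norm v : enorm v ^+ 2 <= p%:R * `|v| ^+ 2.
Proof.
rewrite enorm_sqE; apply: le_trans (_ : \sum_(i < p) `|v| ^+ 2 <= _); last first.
  by rewrite mulr_natl sumr_const card_ord.
apply: ler_sum => i _; rewrite -(real_normK (num_real (v i 0))) lerXn2r ?nnegrE//.
rewrite [leRHS]mx_normrE.
exact: (le_bigmax 0 (fun ij : 'I_p * 'I_1 => `|v ij.1 ij.2|) (i, 0)).
Qed.

(** Quadratic smallness gives a zero differential; this is how the points where
    the Euclidean norm itself is not differentiable are handled. *)
Lemma is_diff_quadratic (W : normedModType R) (q : 'cV[R]_p -> W) (c : R) v :
  (\forall w \near v, `|q w| <= c * enorm (w - v) ^+ 2) -> is_diff v q 0.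
Proof.
move=> hq.
have qv : q v = 0.
  apply/eqP; rewrite -normr_le0; have := nbhs_singleton hq.
  by rewrite subrr enorm0 expr0n mulr0.
have qo : q \o shift v =o_ (0 : 'cV[R]_p) id.
  apply/eqoP => e e0.
  have h1 : \forall h \near (0 : 'cV[R]_p), `|q (h + v)| <= c * enorm h ^+ 2.
    move: hq; rewrite (near_shift 0) subr0; apply: filterS => h /=.
    by rewrite addrK.
  have c1 : 0 < `|c| * p%:R + 1 by rewrite ltr_wpDl// mulr_ge0.
  near=> h.
  have h2 : `|q (h + v)| <= c * enorm h ^+ 2 by near: h.
  apply: le_trans h2 _; apply: le_trans (_ : (`|c| * p%:R + 1) * `|h| ^+ 2 <= _).
    rewrite mulrDl mul1r ler_wpDr ?sqr_ge0// -mulrA.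
    apply: le_trans (_ : `|c| * enorm h ^+ 2 <= _).
      by rewrite ler_wpM2r ?sqr_ge0// ler_norm.
    by rewrite ler_wpM2l// enorm_sq_le_norm.
  rewrite expr2 mulrA ler_wpM2r// -ler_pdivlMl// mulrC.
  near: h; apply: cvgr0_norm_le; last by rewrite divr_gt0.
  exact: cvg_id.
exact: littleo_is_diff.
Unshelve. all: by end_near. Qed.

Lemma near_is_diff (W : normedModType R) (f g df : 'cV[R]_p -> W) v :
  (\forall w \near v, f w = g w) -> is_diff v f df -> is_diff v g df.
Proof.
move=> fg dfv; have dq : is_diff v (g - f) 0.
  apply: (@is_diff_quadratic _ _ 0); apply: filterS fg => w fg.
  by rewrite !fctE fg subrr normr0 mul0r.
rewrite (_ : g = f + (g - f)); last by rewrite addrC subrK.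
apply: (@is_diff_eq _ _ _ _ _ _ _ (is_diffD dfv dq)); exact: addr0.
Qed.

Lemma is_diff_linear (W : normedModType R) (f : {linear 'cV[R]_p -> W}) v :
  is_diff v f f.
Proof.
have df w : differentiable f w.
  rewrite (_ : (f : _ -> _) = \sum_(i < p) (fun v : 'cV[R]_p => v i 0 *: f (delta_mx i 0))).
    by apply: differentiable_sum => i; apply: differentiableZl; exact: differentiable_coord.
  apply/funext => u; rewrite fct_sumE {1}(matrix_sum_delta u) linear_sum/=.
  by apply: eq_bigr => i _; rewrite big_ord1 linearZ.
have cf : continuous f by move=> w; exact: differentiable_continuous.
by apply: DiffDef; [exact: df|exact: diff_lin].
Qed.

Lemma is_diff_dotp (a v : 'cV[R]_p) : is_diff v (dotp a) (dotp a).
Proof.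
have lin : linear (dotp a) by move=> c u w; rewrite dotpDr dotpZr.
pose lM := GRing.isLinear.Build _ _ _ _ _ lin.
pose l : {linear _ -> R} := HB.pack (dotp a) lM.
exact: (is_diff_linear l v).
Qed.

Lemma is_diff_comp1 (f : R -> R) (a : R) (g dg : 'cV[R]_p -> R) v :
  is_derive (g v) 1 f a -> is_diff v g dg ->
  is_diff v (f \o g) (fun u => a * dg u).
Proof.
move=> [/derivable1_diffP df ea] dgv.
have dfv : is_diff (g v) f (fun h => h * a).
  by apply: DiffDef => //; rewrite diff1E// -ea derive1E.
apply: is_diff_eq; apply/funext => u /=; exact: mulrC.
Qed.

Lemma is_diff_enorm_sq v : is_diff v (fun w => enorm w ^+ 2) (fun u => 2 * dotp v u).
Proof.
have h : is_diff v (fun w => enorm (w - v) ^+ 2 : R) 0.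
  apply: (@is_diff_quadratic _ _ 1); apply: filterE => w.
  by rewrite mul1r ger0_norm ?sqr_ge0.
have e : (fun w => enorm w ^+ 2) =
   (fun w => enorm (w - v) ^+ 2) + (2 *: dotp v) + cst (- enorm v ^+ 2).
  apply/funext => w; rewrite !fctE enormB_sq (dotpC w v) /GRing.scale/=; ring.
have d := is_diff_dotp v v.
have d' := is_diffD (is_diffD h (is_diffZ 2 d)) (is_diff_cst (- enorm v ^+ 2) v).
rewrite e; apply: (is_diff_eq d'); apply/funext => u; rewrite !fctE.
by rewrite add0r addr0.
Qed.

Lemma is_diff_enorm v : v != 0 ->
  is_diff v (@enorm R p) (fun u => dotp v u / enorm v).
Proof.
move=> v0; have v1 := enorm_gt0 v0.
have e : @enorm R p = Num.sqrt \o (fun w => enorm w ^+ 2).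
  by apply/funext => w /=; rewrite sqrtr_sqr ger0_norm// enorm_ge0.
rewrite [X in is_diff _ X _]e.
have d1 : is_derive (enorm v ^+ 2) 1 Num.sqrt (2 * Num.sqrt (enorm v ^+ 2))^-1.
  by apply: is_derive1_sqrt; rewrite exprn_gt0.
have d2 := is_diff_comp1 d1 (is_diff_enorm_sq v).
apply: (is_diff_eq d2); apply/funext => u.
by rewrite sqrtr_sqr ger0_norm ?enorm_ge0//; field; rewrite gt_eqF.
Qed.

Lemma enorm_continuous : continuous (@enorm R p).
Proof.
move=> v; have -> : @enorm R p = Num.sqrt \o (fun w => enorm w ^+ 2).
  by apply/funext => w /=; rewrite sqrtr_sqr ger0_norm// enorm_ge0.
apply: continuous_comp; last exact: sqrt_continuous.
have d := is_diff_enorm_sq v.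
exact: (differentiable_continuous (ex_diff (is_diff_def := d))).
Qed.

End differentials.

Section vector_valued.
Context {R : realType} {p q : nat}.
Implicit Types (v w u : 'cV[R]_p) (g dg : 'cV[R]_p -> 'cV[R]_q).

Lemma is_diff_coord g dg v (j : 'I_q) : is_diff v g dg ->
  is_diff v (fun w => g w j 0) (fun u => dg u j 0).
Proof.
move=> d.
have lin : linear (fun w : 'cV[R]_q => w j 0) by move=> c a b; rewrite !mxE.
pose lM := GRing.isLinear.Build _ _ _ _ _ lin.
pose l : {linear 'cV[R]_q -> R} := HB.pack (fun w : 'cV[R]_q => w j 0) lM.
have dl := is_diff_linear l (g v).
exact: (is_diff_comp d dl).
Qed.

Lemma is_diff_col g dg v :
  (forall j : 'I_q, is_diff v (fun w => g w j 0) (fun u => dg u j 0)) -> is_diff v g dg.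
Proof.
move=> d; have dg' : differentiable g v.
  rewrite (_ : g = \sum_(j < q) (fun w => g w j 0 *: delta_mx j 0)).
    apply: differentiable_sum => j; apply: differentiableZl.
    by have := d j => dj; exact: ex_diff.
  apply/funext => w; rewrite fct_sumE {1}(matrix_sum_delta (g w)).
  by apply: eq_bigr => j _; rewrite big_ord1.
apply: DiffDef => //; apply/funext => u; apply/matrixP => j k; rewrite ord1.
have dj := is_diff_coord j (differentiableP dg').
have /(congr1 (@^~ u)) /= <- := @diff_val _ _ _ _ _ _ _ dj.
by have /(congr1 (@^~ u)) /= <- := @diff_val _ _ _ _ _ _ _ (d j).
Qed.

End vector_valued.

(** * Gradient and Hessian of the cubic perturbation *)

Section gradients.
Context {R : realType} {p : nat}.
Implicit Types (F G : 'cV[R]_p -> R) (v u a : 'cV[R]_p).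

Lemma dotp_delta a i : dotp a (delta_mx i 0) = a i 0.
Proof.
rewrite dotpE (bigD1 i)//= mxE !eqxx mulr1 big1 ?addr0// => j ji.
by rewrite mxE (negbTE ji) mulr0.
Qed.

Lemma grad_is_diff F v a : is_diff v F (dotp a) -> grad F v = a.
Proof.
move=> d; apply/matrixP => i j; rewrite ord1 mxE deriveE.
  by rewrite (congr1 (@^~ (delta_mx i 0)) (@diff_val _ _ _ _ _ _ _ d)) dotp_delta.
exact: ex_diff.
Qed.

(** The Hessian is stored with the differentiation index first, so that its
    transpose is the matrix of the differential of the gradient. *)
Lemma hess_trmx_mul F v dG u : is_diff v (grad F) dG ->
  (hess F v)^T *m u = dG u.
Proof.
move=> d; have eG := @diff_val _ _ _ _ _ _ _ d.
apply/matrixP => j k; rewrite ord1 mxE -eG.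
rewrite [in RHS](matrix_sum_delta u) linear_sum/= summxE.
apply: eq_bigr => i _; rewrite big_ord1 linearZ/= !mxE mulrC; congr (_ * _).
have dj := is_diff_coord j d.
rewrite deriveE; last exact: ex_diff.
by rewrite (congr1 (@^~ (delta_mx i 0)) (@diff_val _ _ _ _ _ _ _ dj)) eG.
Qed.

Lemma enorm_trmx_le (A : 'M[R]_p) c :
  (forall u, enorm (A^T *m u) <= c * enorm u) -> forall u, enorm (A *m u) <= c * enorm u.
Proof.
move=> Ac u; have [->|Au0] := eqVneq (A *m u) 0.
  rewrite enorm0; apply: le_trans (enorm_ge0 _) (Ac u).
rewrite -(ler_pM2l (enorm_gt0 Au0)) -expr2 enorm_sq.
have -> : dotp (A *m u) (A *m u) = dotp u (A^T *m (A *m u)).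
  by rewrite /dotp trmx_mul -!mulmxA.
apply: le_trans (dotp_le _ _) _.
rewrite (mulrC (enorm u)) [leRHS]mulrA ler_wpM2r ?enorm_ge0//.
by rewrite [leRHS]mulrC; exact: Ac.
Qed.

Lemma norm_le_enorm v : `|v| <= enorm v.
Proof.
rewrite [leLHS]mx_normrE; apply: bigmax_le; first exact: enorm_ge0.
move=> [i j] _ /=; rewrite (ord1 j). exact: coord_le_enorm.
Qed.

End gradients.

Section perturbation.
Context {R : realType} {m : nat}.
Variables (K : R -> R) (h M : R).
Hypotheses (hK : smooth_kernel K) (h_gt0 : 0 < h) (M_ge1 : 1 <= M).
Hypotheses (K_le : forall x, `|K x| <= M) (dK_le : forall x, `|derive1 K x| <= M).
Hypothesis K_flat : forall x, -1 <= x -> K x <= M * (x + 1) ^+ 2.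
Implicit Types v w u : 'cV[R]_(m + m).

Local Notation tnorm := (fun v : 'cV[R]_(m + m) => enorm (usubmx v)).

Definition ramp (t : R) : R := kernel_cdf K (t / h - 1).
Definition ramp_slope (t : R) : R := K (t / h - 1) / (h * t).

(** The perturbation without the indicator of the ball, and its gradient. *)
Definition perturb v : R := ramp (tnorm v) * enorm v ^+ 3.

Definition perturb_grad v : 'cV[R]_(m + m) :=
  (3 * ramp (tnorm v) * enorm v) *: v +
  (enorm v ^+ 3 * ramp_slope (tnorm v)) *: col_mx (usubmx v) 0.

Let M_ge0 : 0 <= M := le_trans ler01 M_ge1.

Let K_ge0 x : 0 <= K x. Proof. by case: hK. Qed.

Lemma ramp_ge0 t : 0 <= ramp t. Proof. exact: kernel_cdf_ge0. Qed.

Lemma ramp_le1 t : ramp t <= 1. Proof. exact: kernel_cdf_le1. Qed.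

Lemma ramp_flat t : 0 <= t -> ramp t <= M / h ^+ 3 * t ^+ 3.
Proof.
move=> t0; have t1 : -1 <= t / h - 1 by rewrite lerBrDr addNr divr_ge0// ltW.
apply: le_trans (kernel_cdf_cube hK M_ge1 K_flat t1) _.
by rewrite subrK expr_div_n mulrA mulrAC.
Qed.

Lemma kernel_shift_flat t : 0 <= t -> K (t / h - 1) <= M / h ^+ 2 * t ^+ 2.
Proof.
move=> t0; have t1 : -1 <= t / h - 1 by rewrite lerBrDr addNr divr_ge0// ltW.
by apply: le_trans (K_flat t1) _; rewrite subrK expr_div_n mulrA mulrAC.
Qed.

Let is_derive_affine (t : R) : is_derive t 1 (fun t : R => t / h - 1) h^-1.
Proof.
apply: is_derive_eq; rewrite scaler0 add0r oppr0 addr0; exact: mulr1.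
Qed.

Lemma is_derive_ramp (t : R) : is_derive t 1 ramp (K (t / h - 1) / h).
Proof.
exact: (@is_derive1_comp R (kernel_cdf K) (fun t => t / h - 1) t _ _
  (is_derive_kernel_cdf hK (t / h - 1)) (is_derive_affine t)).
Qed.

Lemma is_derive_ramp_slope (t : R) : t != 0 -> is_derive t 1 ramp_slope
  (derive1 K (t / h - 1) / (h ^+ 2 * t) - K (t / h - 1) / (h * t ^+ 2)).
Proof.
move=> t0.
have d1 := @is_derive1_comp R K (fun t => t / h - 1) t _ _
  (is_derive_kernel hK (t / h - 1)) (is_derive_affine t).
have d2 : is_derive t 1 (fun t : R => (h * t)^-1) (- (h * t ^+ 2)^-1).
  have ht0 : h * t != 0 by rewrite mulf_neq0// gt_eqF.
  have d3 : is_derive t 1 (fun t : R => h * t) h.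
    by apply: is_derive_eq; rewrite [LHS]mulr1.
  have d4 := is_deriveV ht0 d3.
  by apply: (is_derive_eq d4); rewrite /GRing.scale/=; field; rewrite t0 gt_eqF.
have d := is_deriveM d1 d2.
apply: (is_derive_eq d); rewrite /GRing.scale/=.
by field; rewrite t0 gt_eqF.
Qed.

Lemma dotp_col_mx0 (a : 'cV[R]_m) u : dotp (col_mx a 0) u = dotp a (usubmx u).
Proof.
rewrite !dotpE big_split_ord/= [X in _ + X]big1 ?addr0.
  by apply: eq_bigr => i _; rewrite col_mxEu mxE.
by move=> i _; rewrite col_mxEd mxE mul0r.
Qed.

Let tnorm_le_dist v w : usubmx v = 0 -> tnorm w <= enorm (w - v).
Proof.
by move=> v0; have := enorm_usubmx_le (w - v); rewrite linearB/= v0 subr0.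
Qed.

Let near_enorm v : \forall w \near v, enorm w <= enorm v + 1.
Proof.
have /cvgr_lt/(_ (enorm v + 1)) : enorm w @[w --> v] --> enorm v.
  exact: enorm_continuous.
by rewrite ltrDl ltr01 => /(_ isT); apply: filterS => w /ltW.
Qed.

Let is_diff_tnorm v : usubmx v != 0 ->
  is_diff v tnorm (fun u => dotp (usubmx v) (usubmx u) / tnorm v).
Proof.
move=> v0; have d1 := is_diff_linear (usubmx : {linear 'cV[R]_(m + m) -> 'cV[R]_m}) v.
exact: (is_diff_comp d1 (is_diff_enorm v0)).
Qed.

Let usubmx_neq0 v : usubmx v != 0 -> v != 0.
Proof. by apply: contra_neq => ->; rewrite linear0. Qed.

(** Where [usubmx v = 0] the Euclidean norm of the target component is not
    differentiable, but the ramp vanishes to third order there. *)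
Lemma perturb_is_diff v : is_diff v perturb (dotp (perturb_grad v)).
Proof.
have [v0|v0] := eqVneq (usubmx v) 0.
  have -> : perturb_grad v = 0.
    by rewrite /perturb_grad v0 enorm0 /ramp mul0r sub0r kernel_cdf0// mulr0 mul0r scale0r
               col_mx0 scaler0 addr0.
  apply: (@is_diff_eq _ _ _ _ 0); last by apply/funext => u; rewrite dotpC dotp0.
  apply: (@is_diff_quadratic _ _ _ _ (M / h ^+ 3 * (enorm v + 1) ^+ 4)).
  apply: filterS (near_enorm v) => w wv.
  have t0 : 0 <= tnorm w := enorm_ge0 _; have w0 := enorm_ge0 w.
  rewrite ger0_norm; last by rewrite mulr_ge0 ?ramp_ge0 ?exprn_ge0.
  apply: le_trans (_ : (M / h ^+ 3 * ((enorm v + 1) * enorm (w - v) ^+ 2)) * (enorm v + 1) ^+ 3 <= _); last first.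
    by rewrite le_eqVlt; apply/orP; left; apply/eqP; ring.
  apply: ler_pM; rewrite ?ramp_ge0 ?exprn_ge0//.
    have c0 : 0 <= M / h ^+ 3 by rewrite divr_ge0// exprn_ge0// ltW.
    apply: le_trans (ramp_flat t0) _; rewrite ler_wpM2l//.
    rewrite (exprS _ 2) ler_pM ?exprn_ge0//.
      by rewrite (le_trans (enorm_usubmx_le w)).
    by rewrite lerXn2r ?nnegrE ?enorm_ge0// tnorm_le_dist.
  by rewrite lerXn2r ?nnegrE// (le_trans w0).
have vn0 := usubmx_neq0 v0.
have d1 := is_diff_comp1 (g := tnorm) (is_derive_ramp (tnorm v)) (is_diff_tnorm v0).
have d2 := is_diffX 2 (is_diff_enorm vn0).
apply: (is_diff_eq (is_diffM d1 d2)); apply/funext => u; rewrite !fctE /=.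
rewrite /perturb_grad dotpDl !dotpZl dotp_col_mx0 /ramp_slope /GRing.scale/=.
have t0 := enorm_gt0 v0; have n0 := enorm_gt0 vn0.
by field; rewrite !gt_eqF.
Qed.

Definition perturb_hess v u : 'cV[R]_(m + m) :=
  let t := tnorm v in let r := enorm v in
  let dt := dotp (usubmx v) (usubmx u) / t in let dr := dotp v u / r in
  let k := K (t / h - 1) in
  (3 * (ramp t * dr + r * (k / h * dt))) *: v + (3 * ramp t * r) *: u +
  (r ^+ 3 * ((derive1 K (t / h - 1) / (h ^+ 2 * t) - k / (h * t ^+ 2)) * dt)
     + ramp_slope t * (3 * r ^+ 2 * dr)) *: col_mx (usubmx v) 0 +
  (r ^+ 3 * ramp_slope t) *: col_mx (usubmx u) 0.

Let perturb_grad_is_diff_neq0 v : usubmx v != 0 ->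
  is_diff v perturb_grad (perturb_hess v).
Proof.
move=> v0; have vn0 := usubmx_neq0 v0.
have t0 := enorm_gt0 v0; have n0 := enorm_gt0 vn0.
have dn := is_diff_enorm vn0; have dt := is_diff_tnorm v0.
have d1 := is_diff_comp1 (g := tnorm) (is_derive_ramp (tnorm v)) dt.
have tn0 : tnorm v != 0 by rewrite gt_eqF.
have d2 := is_diff_comp1 (g := tnorm) (is_derive_ramp_slope tn0) dt.
have da := is_diffM (is_diffZ 3 d1) dn.
have db := is_diffM (is_diffX 2 dn) d2.
have lin : linear (fun w : 'cV[R]_(m + m) => col_mx (usubmx w) 0 : 'cV[R]_(m + m)).
  by move=> c a b; rewrite linearP/= scale_col_mx add_col_mx scaler0 addr0.
pose lM := GRing.isLinear.Build _ _ _ _ _ lin.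
pose iota : {linear 'cV[R]_(m + m) -> 'cV[R]_(m + m)} := HB.pack (fun w : 'cV[R]_(m + m) => col_mx (usubmx w) 0 : 'cV[R]_(m + m)) lM.
have di := is_diff_linear iota v.
apply: is_diff_col => j.
have dj := is_diff_coord j (is_diff_id v); have dij := is_diff_coord j di.
have d := is_diffD (is_diffM da dj) (is_diffM db dij).
rewrite (_ : (fun w => perturb_grad w j 0) = (3 *: (ramp \o tnorm) * @enorm R (m + m)) * (fun w => w j 0) +
  (@enorm R (m + m) ^+ 3 * (ramp_slope \o tnorm)) * (fun w => iota w j 0)); last first.
  apply/funext => w; rewrite /perturb_grad [LHS]mxE [X in X + _ = _]mxE [X in _ + X = _]mxE.
  by rewrite !fctE /= /GRing.scale/=.
apply: (is_diff_eq d); apply/funext => u; rewrite /perturb_hess /=.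
rewrite [RHS]mxE [X in _ = X + _]mxE [X in _ = X + _ + _]mxE.
rewrite [X in _ = X + _ + _ + _]mxE [X in _ = _ + X + _ + _]mxE [X in _ = _ + X + _]mxE [X in _ = _ + X]mxE.
rewrite !fctE /= /GRing.scale/=.
by ring.
Qed.

Let ramp_slope_flat t : 0 <= t -> ramp_slope t <= M / h ^+ 3 * t.
Proof.
rewrite le_eqVlt => /predU1P[<-|t0].
  by rewrite /ramp_slope !mulr0 invr0 mulr0.
rewrite /ramp_slope ler_pdivrMr ?mulr_gt0//.
apply: le_trans (kernel_shift_flat (ltW t0)) _.
by rewrite le_eqVlt; apply/orP; left; apply/eqP; field; rewrite gt_eqF.
Qed.

Let ramp_slope_ge0 t : 0 <= t -> 0 <= ramp_slope t.
Proof. by move=> t0; rewrite divr_ge0// mulr_ge0// ltW. Qed.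

Let enorm_col_mxu v : enorm (col_mx (usubmx v) 0 : 'cV[R]_(m + m)) = tnorm v.
Proof. exact: enorm_col_mx0. Qed.

Lemma perturb_grad_is_diff v : is_diff v perturb_grad (perturb_hess v).
Proof.
have [v0|] := eqVneq (usubmx v) 0; last exact: perturb_grad_is_diff_neq0.
have K1 : K (-1) = 0 by apply: kernel_out; rewrite // normrN1.
have -> : perturb_hess v = 0.
  apply/funext => u; rewrite /perturb_hess v0 enorm0 /ramp /ramp_slope !mul0r sub0r.
  by rewrite kernel_cdf0// K1 !mul0r !mulr0 !mul0r !(addr0, add0r, mulr0, scale0r, col_mx0, scaler0).
have hh : 0 <= M / h ^+ 3 by rewrite divr_ge0// exprn_ge0// ltW.
apply: (@is_diff_quadratic _ _ _ _ (4 * (M / h ^+ 3) * (enorm v + 1) ^+ 3)).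
apply: filterS (near_enorm v) => w wv.
have t0 : 0 <= tnorm w := enorm_ge0 _; have w0 := enorm_ge0 w.
have tw : tnorm w <= enorm w := enorm_usubmx_le w.
have td : tnorm w <= enorm (w - v) := tnorm_le_dist w v0.
have b0 := ramp_slope_ge0 t0; have r0 := ramp_ge0 (tnorm w).
apply: le_trans (norm_le_enorm _) _; apply: le_trans (ler_enormD _ _) _.
have e1 : 0 <= 3 * ramp (tnorm w) * enorm w by rewrite !mulr_ge0.
have e2 : 0 <= enorm w ^+ 3 * ramp_slope (tnorm w).
  by apply: mulr_ge0 => //; exact: exprn_ge0.
rewrite !enormZ enorm_col_mxu (ger0_norm e1) (ger0_norm e2).
set r := enorm w in w0 wv tw *; set t := tnorm w in t0 tw td b0 r0 *.
set c := M / h ^+ 3 in hh *; set dd := enorm (w - v) in td *.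
have h1 : ramp t <= c * t ^+ 3 := ramp_flat t0.
have h2 : ramp_slope t <= c * t := ramp_slope_flat t0.
have h3 : ramp t <= c * (r * t ^+ 2).
  by apply: le_trans h1 _; rewrite ler_wpM2l// (exprS _ 2) ler_wpM2r ?exprn_ge0.
have h4 : t ^+ 2 <= dd ^+ 2 by rewrite lerXn2r ?nnegrE// ?(le_trans t0).
have h5 : r ^+ 3 <= (enorm v + 1) ^+ 3.
  by rewrite lerXn2r ?nnegrE// (le_trans w0).
apply: le_trans (_ : 4 * c * (r ^+ 3 * t ^+ 2) <= _); last first.
  have c4 : 0 <= 4 * c by rewrite mulr_ge0.
  by rewrite -[leRHS]mulrA ler_wpM2l// ler_pM ?exprn_ge0.
have h6 : ramp t * r ^+ 2 <= c * (r * t ^+ 2) * r ^+ 2 by rewrite ler_wpM2r ?exprn_ge0.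
have h7 : r ^+ 3 * (ramp_slope t * t) <= r ^+ 3 * (c * t * t).
  by rewrite ler_wpM2l ?exprn_ge0// ler_wpM2r.
rewrite (_ : 3 * ramp t * r * r + r ^+ 3 * ramp_slope t * t =
  3 * (ramp t * r ^+ 2) + r ^+ 3 * (ramp_slope t * t)); last by ring.
rewrite (_ : 4 * c * _ = 3 * (c * (r * t ^+ 2) * r ^+ 2) + r ^+ 3 * (c * t * t)); last by ring.
by rewrite lerD// ler_wpM2l.
Qed.

(** Each derivative of the ramp costs a factor [1 / h], which is compensated by a
    factor [enorm v] from the cubic term: only the ratio [a] enters. *)
Lemma perturb_hess_le v u a : a = enorm v / h ->
  enorm (perturb_hess v u) <=
    enorm v * (6 + 6 * M * a + M * a ^+ 2 + 2 * M * a ^+ 3) * enorm u.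
Proof.
move=> ea; rewrite /perturb_hess.
set t := tnorm v; set r := enorm v.
set dt := _ / t; set dr := _ / r; set k := K _; set k' := derive1 K _.
have t0 : 0 <= t := enorm_ge0 _; have r0 : 0 <= r := enorm_ge0 _.
have u0 : 0 <= enorm u := enorm_ge0 _.
have tr : t <= r := enorm_usubmx_le v.
have h0 : 0 <= h := ltW h_gt0.
have a0 : 0 <= a by rewrite ea divr_ge0.
have ah : a * h = r by rewrite ea mulfVK// gt_eqF.
have ratio (q : nat) (x y : 'cV[R]_q) : `|dotp x y / enorm x| <= enorm y.
  have [->|x0] := eqVneq x 0; first by rewrite enorm0 invr0 mulr0 normr0 enorm_ge0.
  rewrite normrM normfV (ger0_norm (enorm_ge0 x)) ler_pdivrMr ?enorm_gt0// mulrC.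
  exact: cauchy_schwarz.
have hdt : `|dt| <= enorm u := le_trans (ratio _ _ _) (enorm_usubmx_le u).
have hdr : `|dr| <= enorm u := ratio _ _ _.
have k0 : 0 <= k := K_ge0 _.
have kM : k <= M by apply: le_trans (ler_norm _) (K_le _).
have rM : 0 <= ramp t <= 1 by rewrite ramp_ge0 ramp_le1.
have sl0 := ramp_slope_ge0 t0.
have sl1 : ramp_slope t * h ^+ 2 <= M * a.
  have := ramp_slope_flat t0; rewrite -(ler_pM2r (_ : 0 < h ^+ 2)) ?exprn_gt0//.
  move=> /le_trans; apply.
  rewrite (_ : M / h ^+ 3 * t * h ^+ 2 = M * (t / h)); last by field; rewrite gt_eqF.
  by rewrite ler_wpM2l// ea ler_wpM2r ?invr_ge0.
have slt : ramp_slope t * t * h <= M.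
  have [t00|tn0] := eqVneq t 0; first by rewrite t00 mulr0 mul0r.
  apply: le_trans kM; rewrite le_eqVlt; apply/orP; left; apply/eqP.
  rewrite /ramp_slope -/k; field; by rewrite tn0 gt_eqF.
have slE : ramp_slope t = k / (h * t) by [].
have k'M : `|k'| <= M := dK_le _.
clearbody dt dr k k'; set U := enorm u in u0 hdt hdr *.
have ra : r / h = a by rewrite ea.
have P1 : `|3 * (ramp t * dr + r * (k / h * dt))| * r <= r * (3 + 3 * M * a) * U.
  rewrite normrM (ger0_norm (_ : 0 <= 3))// mulrC.
  rewrite (_ : r * (3 + _) * U = r * (3 * (1 * U + a * (M * U)))); last by ring.
  rewrite ler_wpM2l// ler_wpM2l//; apply: le_trans (ler_normD _ _) _.
  case/andP: rM => rM0 rM1; rewrite !normrM normfV (ger0_norm rM0) (ger0_norm r0).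
  rewrite (ger0_norm k0) (ger0_norm h0) lerD//; first by rewrite ler_pM.
  rewrite (_ : r * (k / h * `|dt|) = a * (k * `|dt|)); last by rewrite -ra; ring.
  by rewrite ler_wpM2l// ler_pM.
have P2 : `|3 * ramp t * r| * U <= r * 3 * U.
  case/andP: rM => rM0 rM1; rewrite ger0_norm ?mulr_ge0// ler_wpM2r// mulrC ler_wpM2l//.
  by rewrite ger_pMr.
have r3 : r ^+ 3 = r * (a ^+ 2 * h ^+ 2) by rewrite -exprMn ah; ring.
have P4 : `|r ^+ 3 * ramp_slope t| * enorm (col_mx (usubmx u) 0 : 'cV[R]_(m + m)) <= r * (M * a ^+ 3) * U.
  have e : 0 <= r ^+ 3 * ramp_slope t by apply: mulr_ge0 => //; exact: exprn_ge0.
  rewrite enorm_col_mxu (ger0_norm e); apply: ler_pM => //; first exact: enorm_ge0.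
    rewrite -[_ <= _]/(r ^+ 3 * ramp_slope t <= r * (M * a ^+ 3)).
    rewrite r3 (_ : _ * ramp_slope t = r * (a ^+ 2 * (ramp_slope t * h ^+ 2))); last by ring.
    rewrite (_ : M * a ^+ 3 = a ^+ 2 * (M * a)); last by ring.
    by rewrite ler_wpM2l// ler_wpM2l// exprn_ge0.
  exact: enorm_usubmx_le.
have P3 : `|r ^+ 3 * ((k' / (h ^+ 2 * t) - k / (h * t ^+ 2)) * dt) + ramp_slope t * (3 * r ^+ 2 * dr)| * t
    <= r * (3 * M * a + M * a ^+ 2 + M * a ^+ 3) * U.
  have [->|tn0] := eqVneq t 0.
    by rewrite mulr0 !mulr_ge0// !addr_ge0// !mulr_ge0// exprn_ge0.
  have hn0 : h != 0 by rewrite gt_eqF.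
  rewrite -[X in `|_| * X <= _](ger0_norm t0) -normrM.
  rewrite [X in `|X|](_ : _ = r * (a ^+ 2 * ((k' - ramp_slope t * h ^+ 2) * dt)) +
      r * (3 * (a * ((ramp_slope t * t * h) * dr)))); last first.
    by rewrite -ah slE; field; rewrite tn0.
  rewrite (_ : r * (_ + _ + _) * U = r * (a ^+ 2 * ((M + M * a) * U)) + r * (3 * (a * (M * U)))); last by ring.
  apply: le_trans (ler_normD _ _) _; rewrite lerD//.
    rewrite normrM (ger0_norm r0) ler_wpM2l// normrM (ger0_norm (exprn_ge0 _ a0)).
    rewrite ler_wpM2l ?exprn_ge0// normrM ler_pM//.
    apply: le_trans (ler_normB _ _) _; rewrite lerD//.
    by rewrite ger0_norm// mulr_ge0// exprn_ge0.
  rewrite normrM (ger0_norm r0) ler_wpM2l// normrM (ger0_norm (_ : 0 <= 3))//.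
  rewrite ler_wpM2l// normrM (ger0_norm a0) ler_wpM2l// normrM ler_pM//.
  by rewrite ger0_norm// (mulr_ge0 _ h0)// mulr_ge0.
apply: le_trans (ler_enormD _ _) _.
apply: le_trans (lerD (le_trans (ler_enormD _ _) (lerD (ler_enormD _ _) (lexx _))) (lexx _)) _.
rewrite !enormZ enorm_col_mxu.
apply: le_trans (lerD (lerD (lerD P1 P2) P3) P4) _.
by rewrite le_eqVlt; apply/orP; left; apply/eqP; ring.
Qed.

End perturbation.

(** * The expected log-likelihood *)

(** A one-sided form of differentiability, for points at the boundary of a region
    where the function is known. *)
Lemma derive_ray0 (R : realType) (V : normedModType R) (q : V -> R) (v u : V) :
  differentiable q v -> (forall t : R, 0 < t -> q (t *: u + v) = 0) ->
  'D_u q v = 0.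
Proof.
move=> dq q0.
have ray : q (t *: u + v) @[t --> 0^'+] --> (0 : R).
  apply: cvg_near_cst; near=> t; apply: q0; near: t; exact: nbhs_right_gt.
have line : (fun t : R => t *: u + v) t @[t --> (0 : R)] --> v.
  rewrite -[X in _ --> X]add0r -[X in _ --> X + _](scale0r u).
  by apply: cvgD; [apply: cvgZr_tmp; exact: cvg_id|exact: cvg_cst].
have qv : q v = 0.
  have c : q (t *: u + v) @[t --> 0^'+] --> q v.
    apply: cvg_at_right_filter; apply: (cvg_comp _ _ line).
    exact: differentiable_continuous.
  by apply: (cvg_unique _ c ray).
have /cvg_ex[l hl] := diff_derivable (v := u) dq.
have -> : 'D_u q v = l by apply: cvg_lim.
have hl' : h^-1 *: ((q \o shift v) (h *: u) - q v) @[h --> 0^'+] --> l.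
  exact: cvg_dnbhs_at_right hl.
have hz : h^-1 *: ((q \o shift v) (h *: u) - q v) @[h --> 0^'+] --> (0 : R).
  apply: cvg_near_cst; near=> t.
  by rewrite qv subr0 /= q0 ?scaler0//; near: t; exact: nbhs_right_gt.
by apply: (cvg_unique _ hl' hz).
Unshelve. all: by end_near. Qed.

Section mean_loglik.
Context {R : realType}.
Variables (K : R -> R) (L M : R) (n m : nat).
Hypotheses (hK : smooth_kernel K) (L_gt0 : 0 < L) (M_ge1 : 1 <= M).
Hypotheses (n_gt0 : (0 < n)%N) (m_gt0 : (0 < m)%N).
Hypotheses (K_le : forall x, `|K x| <= M) (dK_le : forall x, `|derive1 K x| <= M).
Hypothesis K_flat : forall x, -1 <= x -> K x <= M * (x + 1) ^+ 2.
Implicit Types v w u : 'cV[R]_(m + m).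

Local Notation s := (scale R n m).
Local Notation N := (n%:R : R).
Local Notation h := (L^-1 * s).

Definition mean_loglik v : R :=
  - (N / 2) * enorm v ^+ 2 + N / 3 * (cutoff K L n v * enorm v ^+ 3).

Let s_gt0 : 0 < s := scale_gt0 n_gt0 m_gt0.
Let h_gt0 : 0 < h. Proof. by rewrite mulr_gt0 ?invr_gt0. Qed.
Let N_ge0 : 0 <= N. Proof. by []. Qed.

Let near_in v : enorm v < 2 * s -> \forall w \near v, enorm w < 2 * s.
Proof. by move=> vs; apply: (cvgr_lt _ (@enorm_continuous R _ v)). Qed.

Let near_out v : 2 * s < enorm v -> \forall w \near v, 2 * s < enorm w.
Proof. by move=> vs; apply: (cvgr_gt _ (@enorm_continuous R _ v)). Qed.

Let quad v : R := - (N / 2) * enorm v ^+ 2.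

Let is_diff_quad v : is_diff v quad (dotp (- N *: v)).
Proof.
have d := is_diffZ (- (N / 2)) (is_diff_enorm_sq v).
apply: (is_diff_eq d); apply/funext => u; rewrite !fctE dotpZl /GRing.scale/=.
by field.
Qed.

Let mean_in v : enorm v < 2 * s ->
  mean_loglik v = quad v + N / 3 * perturb K h v.
Proof. by move=> /ltW vs; rewrite /mean_loglik cutoff_in. Qed.

Let mean_out v : 2 * s < enorm v -> mean_loglik v = quad v.
Proof. by move=> vs; rewrite /mean_loglik cutoff_out// mul0r mulr0 addr0. Qed.

Let is_diff_in v : enorm v < 2 * s ->
  is_diff v mean_loglik (dotp (- N *: v + (N / 3) *: perturb_grad K h v)).
Proof.
move=> vs; have d := is_diffD (is_diff_quad v)
  (is_diffZ (N / 3) (perturb_is_diff hK h_gt0 M_ge1 K_flat v)).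
apply: near_is_diff (is_diff_eq d _).
  by apply: filterS (near_in vs) => w ws; rewrite mean_in.
apply/funext => u; rewrite !fctE [RHS]dotpDl [X in _ = _ + X]dotpZl; reflexivity.
Qed.

Let is_diff_out v : 2 * s < enorm v -> is_diff v mean_loglik (dotp (- N *: v)).
Proof.
move=> vs; apply: near_is_diff (is_diff_quad v).
by apply: filterS (near_out vs) => w ws; rewrite mean_out.
Qed.

Let is_diff_grad_in v : enorm v < 2 * s -> is_diff v (grad mean_loglik)
  (fun u => - N *: u + (N / 3) *: perturb_hess K h v u).
Proof.
move=> vs; have d := is_diffD (is_diff_scaler (- N) v)
  (is_diffZ (N / 3) (perturb_grad_is_diff hK h_gt0 M_ge1 K_flat v)).
apply: near_is_diff (is_diff_eq d _) => //.
by apply: filterS (near_in vs) => w ws; rewrite (grad_is_diff (is_diff_in ws)).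
Qed.

Let is_diff_grad_out v : 2 * s < enorm v ->
  is_diff v (grad mean_loglik) (fun u => - N *: u).
Proof.
move=> vs; apply: near_is_diff (is_diff_scaler (- N) v).
by apply: filterS (near_out vs) => w ws; rewrite (grad_is_diff (is_diff_out ws)).
Qed.

Lemma mean_twice_differentiable v : enorm v < 2 * s ->
  twice_differentiable mean_loglik v.
Proof.
move=> vs; split.
  by apply: filterS (near_in vs) => w ws; have d := is_diff_in ws; exact: ex_diff.
have d := is_diff_grad_in vs; exact: ex_diff.
Qed.

(** On the sphere, where the indicator jumps, a second differential can only
    exist if it agrees with the one of the quadratic part: the gradient is
    exactly linear outside the ball, and the outward directions span. *)
Let hess_boundary v : enorm v = 2 * s -> twice_differentiable mean_loglik v ->
  'd (grad mean_loglik) v = (fun u => - N *: u) :> ('cV[R]_(m + m) -> 'cV[R]_(m + m)).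
Proof.
move=> vs [_ dG]; have dG' := differentiableP dG.
pose q w := grad mean_loglik w - (- N *: w).
have dq : is_diff v q (fun u => 'd (grad mean_loglik) v u - (- N *: u)).
  exact: (is_diffB dG' (is_diff_scaler (- N) v)).
have outward u : 0 < dotp v u -> 'd (grad mean_loglik) v u = - N *: u.
  move=> vu; apply/eqP; rewrite -subr_eq0; apply/eqP.
  apply/matrixP => j k; rewrite ord1 [RHS]mxE.
  have dj := is_diff_coord j dq.
  rewrite -[LHS]/((fun u => ('d (grad mean_loglik) v u - (- N *: u)) j 0) u).
  rewrite -(@diff_val _ _ _ _ _ _ _ dj) -deriveE; last exact: ex_diff.
  apply: derive_ray0; first exact: ex_diff.
  move=> t t0; have out : 2 * s < enorm (t *: u + v).
    rewrite -vs -(@ltr_pXn2r _ 2) ?nnegrE ?enorm_ge0// enormD_sq dotpZl dotpC.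
    rewrite -[ltLHS]add0r ltrD2r ltr_wpDl ?sqr_ge0//.
    by rewrite mulr_gt0// mulr_gt0.
  by rewrite /q (grad_is_diff (is_diff_out out)) subrr mxE.
have v0 : 0 < dotp v v by rewrite -enorm_sq exprn_gt0// vs mulr_gt0.
apply/funext => u.
pose c := (`|dotp v u| + 1) / dotp v v.
have c0 : 0 < c by rewrite divr_gt0// ltr_wpDl.
have h1 : 0 < dotp v (c *: v) by rewrite dotpZr mulr_gt0.
have h2 : 0 < dotp v (u + c *: v).
  rewrite dotpDr dotpZr mulfVK ?gt_eqF//.
  by have := lerNnormlW (lexx `|dotp v u|); lra.
have := outward _ h2; rewrite linearD (outward _ h1) scalerDr.
exact: addIr.
Qed.

(** Constant of proportionality in the bound of the relative variation of the
    Hessian by [scale]. *)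
Definition curvature : R := 2 / 3 * (6 + 12 * M * L + 4 * M * L ^+ 2 + 16 * M * L ^+ 3).

Lemma curvature_ge0 : 0 <= curvature.
Proof.
have M0 : 0 <= M := le_trans ler01 M_ge1; have L0 := ltW L_gt0.
by rewrite mulr_ge0// !addr_ge0// !mulr_ge0// exprn_ge0.
Qed.

(** Outside the ball, and at those points of the sphere where the Hessian exists,
    the perturbation does not contribute; inside, [enorm v / h] is at most
    [2 L]. *)
Lemma hess_mean_le v u : twice_differentiable mean_loglik v ->
  enorm ((- hess mean_loglik v - N%:M) *m u) <= N * (curvature * s) * enorm u.
Proof.
move=> tv; move: u; apply: enorm_trmx_le => u.
have dG := differentiableP tv.2.
rewrite linearB/= linearN/= tr_scalar_mx mulmxBl mulNmx mul_scalar_mx.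
rewrite (hess_trmx_mul u dG).
have c0 : 0 <= N * (curvature * s) * enorm u.
  apply: mulr_ge0 (enorm_ge0 _); apply: mulr_ge0 => //.
  by apply: mulr_ge0; [exact: curvature_ge0|exact: ltW].
have triv : 'd (grad mean_loglik) v u = - N *: u ->
    enorm (- 'd (grad mean_loglik) v u - N *: u) <= N * (curvature * s) * enorm u.
  by move=> ->; rewrite scaleNr opprK subrr enorm0.
have [vs|vs|vs] := ltgtP (enorm v) (2 * s).
- have d := is_diff_grad_in vs.
  rewrite (congr1 (@^~ u) (@diff_val _ _ _ _ _ _ _ d)).
  rewrite scaleNr opprD opprK addrAC subrr add0r enormN enormZ.
  rewrite ger0_norm ?divr_ge0//.
  have N3 : 0 < N / 3 by rewrite divr_gt0// ltr0n.
  have := perturb_hess_le hK h_gt0 M_ge1 K_le dK_le K_flat u (erefl (enorm v / h)).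
  rewrite -(ler_pM2l N3) => /le_trans; apply.
  set a := enorm v / h; set r := enorm v in vs *.
  have r0 : 0 <= r := enorm_ge0 _.
  have M0 : 0 <= M := le_trans ler01 M_ge1.
  have a0 : 0 <= a by apply: divr_ge0 => //; exact: ltW.
  have aL : a <= 2 * L.
    rewrite /a ler_pdivrMr// (_ : 2 * L * h = 2 * s) ?ltW//.
    by field; rewrite gt_eqF.
  have e2 : a ^+ 2 <= (2 * L) ^+ 2 by rewrite lerXn2r ?nnegrE// (le_trans a0).
  have e3 : a ^+ 3 <= (2 * L) ^+ 3 by rewrite lerXn2r ?nnegrE// (le_trans a0).
  rewrite [leLHS]mulrA ler_wpM2r ?enorm_ge0// [leRHS]mulrC [leLHS]mulrC.
  rewrite (_ : curvature * s * N = (2 * s * (6 + 6 * M * (2 * L) + M * (2 * L) ^+ 2 + 2 * M * (2 * L) ^+ 3)) * (N / 3)); last first.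
    by rewrite /curvature; field.
  rewrite (ler_wpM2r (ltW N3))//; apply: ler_pM => //; last 2 first.
  - exact: ltW.
  - have M6 : 0 <= 6 * M by rewrite mulr_ge0.
    have M2 : 0 <= 2 * M by rewrite mulr_ge0.
    by rewrite !lerD// ler_wpM2l.
  have p1 : 0 <= M * a by rewrite mulr_ge0.
  have p2 : 0 <= M * a ^+ 2 by rewrite mulr_ge0// exprn_ge0.
  have p3 : 0 <= M * a ^+ 3 by rewrite mulr_ge0// exprn_ge0.
  by lra.
- apply: triv; have d := is_diff_grad_out vs.
  by rewrite (congr1 (@^~ u) (@diff_val _ _ _ _ _ _ _ d)).
- by apply: triv; rewrite (hess_boundary vs tv).
Qed.

Lemma hess_mean0 : hess mean_loglik 0 = - N%:M.
Proof.
have zin : enorm (0 : 'cV[R]_(m + m)) < 2 * s by rewrite enorm0 mulr_gt0.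
have hz (u : 'cV[R]_(m + m)) : (hess mean_loglik 0)^T *m u = - N *: u.
  rewrite (hess_trmx_mul u (is_diff_grad_in zin)).
  rewrite (_ : perturb_hess K h 0 u = 0) ?scaler0 ?addr0//.
  apply: enorm_eq0; apply/eqP; rewrite eq_le enorm_ge0 andbT.
  have := perturb_hess_le hK h_gt0 M_ge1 K_le dK_le K_flat (v := 0) u erefl.
  by rewrite enorm0 !mul0r.
apply: trmx_inj; rewrite linearN/= tr_scalar_mx.
apply/matrixP => i j.
have := congr1 (fun w : 'cV[R]_(m + m) => w i 0) (hz (delta_mx j 0)).
rewrite -colE [LHS]mxE => ->.
by rewrite !mxE eqxx andbT mulr_natr mulNrn.
Qed.

Lemma cubic_le_sq v : cutoff K L n v * enorm v ^+ 3 <= 2 * s * enorm v ^+ 2.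
Proof.
have v0 := enorm_ge0 v.
have [vs|vs] := leP (enorm v) (2 * s); last first.
  by rewrite cutoff_out// mul0r !mulr_ge0 ?sqr_ge0// ltW.
rewrite (exprS _ 2) mulrA ler_wpM2r ?sqr_ge0//; apply: le_trans vs.
by rewrite ler_piMl// cutoff_le1.
Qed.

Lemma mean_le v : mean_loglik v <= - N * (1 / 2 - 2 / 3 * s) * enorm v ^+ 2.
Proof.
have N3 : 0 <= N / 3 by rewrite divr_ge0.
have := ler_wpM2l N3 (cubic_le_sq v); rewrite /mean_loglik => hc.
apply: le_trans (lerD (lexx _) hc) _.
by rewrite le_eqVlt; apply/orP; left; apply/eqP; field.
Qed.

Lemma mean0 : mean_loglik 0 = 0.
Proof. by rewrite /mean_loglik enorm0 !expr0n/= !mulr0 addr0. Qed.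

Lemma loglik_mean (x v : 'cV[R]_(m + m)) : loglik K L n x v = N * dotp x v + mean_loglik v.
Proof. by rewrite /loglik /mean_loglik; field. Qed.

Lemma grad_linear (x v : 'cV[R]_(m + m)) : grad (fun w : 'cV[R]_(m + m) => N * dotp x w) v = N *: x.
Proof.
apply: grad_is_diff; have d := is_diffZ N (is_diff_dotp x v).
by apply: (is_diff_eq d); apply/funext => u; rewrite dotpZl.
Qed.

Lemma grad_loglik0 (x : 'cV[R]_(m + m)) : grad (loglik K L n x) 0 = N *: x.
Proof.
have zin : enorm (0 : 'cV[R]_(m + m)) < 2 * s by rewrite enorm0 mulr_gt0.
have e : loglik K L n x = N *: dotp x + mean_loglik.
  by apply/funext => v; rewrite loglik_mean.
apply: grad_is_diff; rewrite e.
have d := is_diffD (is_diffZ N (is_diff_dotp x 0)) (is_diff_in zin).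
apply: (is_diff_eq d); apply/funext => u; rewrite !fctE dotpZl.
rewrite /perturb_grad enorm0 !(linear0, mulr0, scale0r, scaler0, col_mx0, addr0).
by rewrite (dotpC 0) dotp0 addr0.
Qed.

End mean_loglik.

(** * Gaussian integrals on the line *)

Section normal_integrals.
Context {R : realType}.
Local Notation mu := (@lebesgue_measure R).

Lemma ge0_integral_normal_prob (a s : R) (f : R -> \bar R) :
  measurable_fun setT f -> (forall x, (0 <= f x)%E) ->
  (\int[normal_prob a s]_x f x = \int[mu]_x (f x * (normal_pdf a s x)%:E))%E.
Proof.
move=> mf f0; have dom := normal_prob_dominates a s.
have mp : measurable_fun setT (fun x => (normal_pdf a s x)%:E).
  by apply/measurable_EFinP; exact: measurable_normal_pdf.
rewrite -(Radon_Nikodym_SigmaFinite.change_of_variables dom)//.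
have fi := Radon_Nikodym_SigmaFinite.f_integrable dom.
apply: ae_eq_integral => //.
- by apply: emeasurable_funM => //; exact: (measurable_int mu).
- exact: emeasurable_funM.
- apply: ae_eqe_mul2l; apply: integral_ae_eq => //.
  by move=> E _ mE; rewrite -(Radon_Nikodym_SigmaFinite.f_integral dom).
Qed.

Lemma normal_prob_itv_le (a s x y : R) : s != 0 -> x <= y ->
  (normal_prob a s `[x, y] <= (normal_peak s * (y - x))%:E)%E.
Proof.
move=> s0 xy; rewrite /normal_prob.
apply: le_trans (_ : (\int[mu]_(_ in `[x, y]) (normal_peak s)%:E <= _)%E).
  apply: ge0_le_integral => //.
  - by move=> z _; rewrite lee_fin normal_pdf_ge0.
  - apply: measurable_funTS; apply/measurable_EFinP; exact: measurable_normal_pdf.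
  - by move=> z _; rewrite lee_fin normal_pdf_ub.
rewrite integral_cst//= lebesgue_measure_itv/= lte_fin.
case: ifPn => [_|]; first by rewrite -EFinB -EFinM.
by rewrite mule0 lee_fin mulr_ge0 ?normal_peak_ge0 ?subr_ge0.
Qed.

Lemma normal_prob_mgf (s c : R) : s != 0 ->
  (\int[normal_prob 0 s]_x (expR (c * x))%:E = (expR (c ^+ 2 * s ^+ 2 / 2))%:E)%E.
Proof.
move=> s0; rewrite ge0_integral_normal_prob//; last first.
  by apply/measurable_EFinP; apply: measurableT_comp => //; exact: measurable_funM.
transitivity (\int[mu]_x ((expR (c ^+ 2 * s ^+ 2 / 2))%:E * (normal_pdf (c * s ^+ 2) s x)%:E))%E.
  apply: eq_integral => x _; rewrite -!EFinM; congr EFin.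
  rewrite !normal_pdfE// /normal_fun mulrCA [RHS]mulrCA -!expRD; congr (_ * expR _).
  by field.
rewrite ge0_integralZl//.
- by rewrite integral_normal_pdf mule1.
- by apply/measurable_EFinP; exact: measurable_normal_pdf.
- by move=> x _; rewrite lee_fin normal_pdf_ge0.
Qed.

(** Completing the quadratic exponent turns the integrand into a normal density
    of another variance, whose total mass is known. *)
Lemma normal_prob_sq_mgf (s c : R) : 0 < s -> 2 * c * s ^+ 2 < 1 ->
  (\int[normal_prob 0 s]_x (expR (c * x ^+ 2))%:E =
   ((Num.sqrt (1 - 2 * c * s ^+ 2))^-1)%:E)%E.
Proof.
move=> s0 cs; rewrite ge0_integral_normal_prob//; last first.
  apply/measurable_EFinP; apply: measurableT_comp => //.
  by apply: measurable_funM => //; exact: measurable_funX.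
set q := Num.sqrt _; have d0 : 0 < 1 - 2 * c * s ^+ 2 by rewrite subr_gt0.
have q0 : 0 < q by rewrite sqrtr_gt0.
have q2 : q ^+ 2 = 1 - 2 * c * s ^+ 2 by rewrite sqr_sqrtr// ltW.
have sq0 : 0 < s / q by rewrite divr_gt0.
transitivity (\int[mu]_x ((q^-1)%:E * (normal_pdf 0 (s / q) x)%:E))%E.
  apply: eq_integral => x _; rewrite -!EFinM; congr EFin.
  rewrite !normal_pdfE ?gt_eqF// /normal_fun.
  have -> : normal_peak (s / q) = q * normal_peak s.
    rewrite /normal_peak expr_div_n -!mulrnAr (mulrAC (s ^+ 2)) sqrtrM; last first.
      by rewrite mulr_ge0 ?sqr_ge0// mulrn_wge0// pi_ge0.
    by rewrite invfM sqrtrV ?sqr_ge0// invrK sqrtr_sqr (gtr0_norm q0) mulrC.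
  rewrite mulrCA !mulrA mulVf ?gt_eqF// mul1r -mulrA -expRD; congr (_ * expR _).
  rewrite subr0 expr_div_n q2; field.
  by rewrite (gt_eqF s0) (gt_eqF d0).
rewrite ge0_integralZl//.
- by rewrite integral_normal_pdf mule1.
- by apply/measurable_EFinP; exact: measurable_normal_pdf.
- by move=> x _; rewrite lee_fin normal_pdf_ge0.
- by rewrite lee_fin invr_ge0 ltW.
Qed.

End normal_integrals.

(** * Independence of the coordinates *)

Section independence.
Context {R : realType} {d : measure_display} {T : measurableType d}.
Context (P : probability T R) {p : nat} (X : T -> 'cV[R]_p).
Context (mu : probability R R).
Hypothesis mX : forall i, measurable_fun setT (fun w => X w i 0).
Hypothesis box : forall B : 'I_p -> set R, (forall i, measurable (B i)) ->
  P [set w | forall i, B i (X w i 0)] = (\prod_i mu (B i))%E.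

(** The sigma-algebra generated by these boxes is the one of the coordinates other
    than [k]. *)
Definition other_boxes (k : 'I_p) : set (set T) :=
  [set E | exists B : 'I_p -> set R, [/\ forall i, measurable (B i), B k = setT &
     E = [set w | forall i, B i (X w i 0)]]].

Let mbox (B : 'I_p -> set R) : (forall i, measurable (B i)) ->
  measurable [set w | forall i, B i (X w i 0)].
Proof.
move=> mB; rewrite (_ : [set w | _] = \bigcap_(i in setT) [set w | B i (X w i 0)]).
  apply: fin_bigcap_measurable => // i _.
  by have := mX i measurableT (mB i); rewrite setTI.
by apply/seteqP; split=> w /= h i; [move=> _; exact: h|exact: (h i I)].
Qed.

Let other_setT k : other_boxes k setT.
Proof. by exists (fun=> setT); split=> //; apply/seteqP; split. Qed.

Let other_setI k : setI_closed (other_boxes k).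
Proof.
move=> _ _ [B [mB Bk ->]] [C [mC Ck ->]].
exists (fun i => B i `&` C i); split.
- by move=> i; exact: measurableI.
- by rewrite Bk Ck setTI.
- apply/seteqP; split=> [w [hB hC] i|w h]; first by split.
  by split=> i; have [] := h i.
Qed.

Lemma indep_other_boxes (k : 'I_p) (A : set R) (E : set T) : measurable A ->
  <<s other_boxes k >> E ->
  P ([set w | A (X w k 0)] `&` E) = (mu A * P E)%E.
Proof.
move=> mA sE.
have mAX : measurable [set w | A (X w k 0)].
  by have := mX k measurableT mA; rewrite setTI.
have Afin : mu A \is a fin_num.
  by apply: fin_num_measure.
have c0 : 0 <= fine (mu A) by rewrite fine_ge0.
have msE (B : set T) : mscale (NngNum c0) P B = (mu A * P B)%E.
  rewrite -[in RHS](fineK Afin); exact: erefl.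
have e : forall E, <<s other_boxes k >> E ->
    mrestr P mAX E = mscale (NngNum c0) P E.
  apply: (@g_sigma_algebra_measure_unique _ _ _ (other_boxes k) _ (fun=> setT)) => //.
  - by move=> _ [B [mB _ ->]]; exact: mbox.
  - by rewrite bigcup_const//; exists 0%N.
  - move=> _ [B [mB Bk ->]].
    apply: eq_trans (esym (msE _)).
    transitivity (P ([set w | forall i, B i (X w i 0)] `&` [set w | A (X w k 0)])) => //.
    pose C i := if i == k then A else B i.
    have mC i : measurable (C i) by rewrite /C; case: ifP.
    rewrite (_ : _ `&` _ = [set w | forall i, C i (X w i 0)]); last first.
      apply/seteqP; split=> w /=.
        by move=> [hB hA] i; rewrite /C; case: eqP => [->|].
      move=> h; split=> [i|]; last by have := h k; rewrite /C eqxx.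
      by have := h i; rewrite /C; case: eqP => // ->; rewrite Bk.
    rewrite !box// (bigD1 k)//= [in RHS](bigD1 k)//= /C eqxx Bk probability_setT mul1e.
    by congr (_ * _)%E; apply: eq_bigr => i /negbTE ->.
  - move=> _; rewrite -[X in (X < _)%E]/(P (setT `&` _)) setTI; apply: le_lt_trans (ltry 1).
    exact: probability_le1.
by rewrite -msE setIC; exact: (e _ sE).
Qed.

Definition other_measurable (k : 'I_p) (Z : T -> R) :=
  measurable_fun (setT : set (g_sigma_algebraType (other_boxes k))) Z.

Lemma other_measurable_coord (k j : 'I_p) (f : R -> R) : j != k ->
  measurable_fun setT f -> other_measurable k (fun w => f (X w j 0)).
Proof.
move=> jk mf; apply: measurableT_comp => //.
move=> _ B mB; rewrite setTI; apply: sub_sigma_algebra.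
exists (fun i => if i == j then B else setT); split.
- by move=> i; case: ifP.
- by rewrite eq_sym (negbTE jk).
- apply/seteqP; split=> w /=; first by move=> h i; case: eqP => [->|].
  by move=> /(_ j); rewrite eqxx.
Qed.

Lemma other_measurableW k Z : other_measurable k Z -> measurable_fun setT Z.
Proof.
move=> mZ _ B mB; have := mZ measurableT B mB; rewrite !setTI.
apply: (smallest_sub (@sigma_algebra_measurable _ T)).
by move=> _ [C [mC _ ->]]; exact: mbox.
Qed.

(** The joint law of a coordinate and of a function of the others is a product
    measure, so that integrals can be computed by integrating the coordinate
    first. *)
Lemma integral_indep (k : 'I_p) (Z : T -> R) (f : R * R -> \bar R) :
  other_measurable k Z -> measurable_fun setT f -> (forall z, (0 <= f z)%E) ->
  (\int[P]_w f (X w k 0%R, Z w) = \int[P]_w \int[mu]_x f (x, Z w))%E.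
Proof.
move=> oZ mf f0; have mZ := other_measurableW oZ.
pose Zr : {mfun T >-> R} := HB.pack Z (isMeasurableFun.Build _ _ _ _ _ mZ).
pose Y w := (X w k 0, Z w).
have mY : measurable_fun setT Y by exact: measurable_fun_pair.
pose Yr : {mfun T >-> (R * R)%type} := HB.pack Y (isMeasurableFun.Build _ _ _ _ _ mY).
pose nu := distribution P Zr.
have rect A B : measurable A -> measurable B ->
    distribution P Yr (A `*` B) = (mu A * nu B)%E.
  move=> mA mB; have sE : <<s other_boxes k >> (Z @^-1` B).
    by have := oZ measurableT B mB; rewrite setTI.
  exact: (indep_other_boxes mA sE).
have prodE := product_measure_unique rect.
transitivity (\int[distribution P Yr]_z f z)%E.
  by rewrite ge0_integral_distribution.
rewrite (@eq_measure_integral _ _ _ _ (mu \x nu)%E); last first.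
  by move=> A mA _; first [exact: prodE | exact: esym (prodE A mA)].
rewrite fubini_tonelli1// fubini_tonelli//.
rewrite ge0_integral_distribution//.
- exact: measurable_fun_fubini_tonelli_G.
- by move=> y; apply: integral_ge0.
Qed.

End independence.

(** * Gaussian vectors *)

Definition real_id (R : realType) : {mfun measurableTypeR R >-> R} :=
  HB.pack (idfun : measurableTypeR R -> R) (@isMeasurableFun.Build _ _
    (measurableTypeR R) R (idfun : measurableTypeR R -> R) (@measurable_id _ _ setT)).

(** The normal law, transported to the canonical Borel structure of the reals. *)
Definition normal_law {R : realType} (s : R) : probability R R :=
  distribution (normal_prob 0 s) (real_id R).

Lemma ge0_integral_normal_law {R : realType} (s : R) (f : R -> \bar R) :
  measurable_fun setT f -> (forall x, 0 <= f x)%E ->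
  (\int[normal_law s]_x f x = \int[normal_prob 0 s]_x f x)%E.
Proof. by move=> mf f0; rewrite ge0_integral_distribution. Qed.

Lemma normal_law_mgf {R : realType} (s c : R) : s != 0 ->
  (\int[normal_law s]_x (expR (c * x))%:E = (expR (c ^+ 2 * s ^+ 2 / 2))%:E)%E.
Proof.
move=> s0; rewrite ge0_integral_normal_law ?normal_prob_mgf//.
by apply/measurable_EFinP; apply: measurableT_comp => //; exact: measurable_funM.
Qed.

Lemma normal_law_sq_mgf {R : realType} (s c : R) : 0 < s -> 2 * c * s ^+ 2 < 1 ->
  (\int[normal_law s]_x (expR (c * x ^+ 2))%:E =
   ((Num.sqrt (1 - 2 * c * s ^+ 2))^-1)%:E)%E.
Proof.
move=> s0 cs; rewrite ge0_integral_normal_law ?normal_prob_sq_mgf//.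
apply/measurable_EFinP; apply: measurableT_comp => //.
by apply: measurable_funM => //; exact: measurable_funX.
Qed.

Lemma integral_probability_cst {R : realType} d (T : measurableType d)
  (P : probability T R) (c : \bar R) : (\int[P]_x c = c)%E.
Proof.
rewrite (integral_cst P measurableT) [X in (_ * X)%E](@probability_setT _ _ _ P).
exact: mule1.
Qed.

Section gaussian.
Context {R : realType} {d : measure_display} {T : measurableType d}.
Context (P : probability T R) {p : nat} (X : T -> 'cV[R]_p) (s : R).
Hypotheses (s_gt0 : 0 < s) (gX : gaussian_vector P s X).
Local Notation mu := (normal_law s).

Let mX i : measurable_fun setT (fun w => X w i 0). Proof. exact: gX.1. Qed.

Let box : forall B : 'I_p -> set R, (forall i, measurable (B i)) ->
  P [set w | forall i, B i (X w i 0)] = (\prod_i mu (B i))%E.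
Proof. exact: gX.2. Qed.

Lemma integral_coord (i : 'I_p) (f : R -> \bar R) :
  measurable_fun setT f -> (forall x, 0 <= f x)%E ->
  (\int[P]_w f (X w i 0%R) = \int[mu]_x f x)%E.
Proof.
move=> mf f0.
have oZ : other_measurable X i (cst 0) by exact: measurable_cst.
rewrite (integral_indep mX box (f := fun z => f z.1) oZ)//; last first.
  by apply: measurableT_comp => //; exact: measurable_fst.
by rewrite /= integral_probability_cst.
Qed.

Lemma integral_expR_sum (F : 'I_p -> R -> R) :
  (forall i, measurable_fun setT (F i)) ->
  (\int[P]_w (expR (\sum_i F i (X w i ord0)%R))%:E =
   \prod_i \int[mu]_x (expR (F i x))%:E)%E.
Proof.
move=> mF.
have mE i : measurable_fun setT (fun x => (expR (F i x))%:E).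
  by apply/measurable_EFinP; apply: measurableT_comp.
have E0 i : (0 <= \int[mu]_x (expR (F i x))%:E)%E by apply: integral_ge0.
suff h k : (k <= p)%N -> (\int[P]_w (expR (\sum_(i < p | (i < k)%N) F i (X w i ord0)%R))%:E =
   \prod_(i < p | (i < k)%N) \int[mu]_x (expR (F i x))%:E)%E.
  have := h p (leqnn p).
  rewrite [in X in _ = X -> _](eq_bigl xpredT) => [<-|i]; last by rewrite ltn_ord.
  by apply: eq_integral => w _; congr ((expR _)%:E); apply: eq_bigl => i; rewrite ltn_ord.
elim: k => [_|k IH kp].
  rewrite [in RHS]big_pred0_eq; under eq_integral do rewrite big_pred0_eq expR0.
  by rewrite integral_probability_cst.
pose o := Ordinal kp.
have split_ord (i : 'I_p) : (i < k.+1)%N && (i != o) = (i < k)%N.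
  by rewrite ltnS [RHS]ltn_neqAle andbC.
pose Z w := \sum_(i < p | (i < k)%N) F i (X w i ord0).
have oZ : other_measurable X o Z.
  rewrite /Z /other_measurable.
  under eq_fun do rewrite big_mkcond.
  apply: measurable_sum => i.
  case ik : (i < k)%N; last exact: measurable_cst.
  apply: other_measurable_coord => //.
  by apply/eqP => e; move: ik; rewrite e ltnn.
have mZ : measurable_fun setT Z := other_measurableW mX oZ.
transitivity (\int[P]_w (fun z => (expR (F o z.1 + z.2))%:E) (X w o ord0, Z w))%E.
  apply: eq_integral => w _; congr ((expR _)%:E).
  rewrite (bigD1 o)//=; congr (_ + _); apply: eq_bigl => i; exact: split_ord.
rewrite (integral_indep mX box (f := fun z => (expR (F o z.1 + z.2))%:E) oZ)//; last first.
  apply/measurable_EFinP; apply: measurableT_comp => //; apply: measurable_funD => //.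
  by apply: measurableT_comp => //; exact: measurable_fst.
rewrite (bigD1 o)//= (eq_bigl _ _ split_ord) -IH; last exact: ltnW.
rewrite -ge0_integralZl//; last first.
  by apply/measurable_EFinP; apply: measurableT_comp.
apply: eq_integral => w _ /=.
under eq_integral do rewrite addrC expRD EFinM.
by rewrite ge0_integralZl// muleC.
Qed.

Lemma integral_expR_dotp (c : 'cV[R]_p) :
  (\int[P]_w (expR (dotp c (X w)))%:E = (expR (s ^+ 2 * enorm c ^+ 2 / 2))%:E)%E.
Proof.
under eq_integral do rewrite dotpE.
rewrite (@integral_expR_sum (fun i x => c i 0 * x)); last first.
  by move=> i; exact: measurable_funM.
under eq_bigr do rewrite normal_law_mgf ?gt_eqF//.
rewrite enorm_sqE mulr_sumr mulr_suml expR_sum -prodEFin.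
by apply: eq_bigr => i _; rewrite [s ^+ 2 * _]mulrC.
Qed.

Lemma integral_expR_sq (Q : pred 'I_p) (c : R) : 2 * c * s ^+ 2 < 1 ->
  (\int[P]_w (expR (c * \sum_(i | Q i) X w i ord0 ^+ 2))%:E =
   ((Num.sqrt (1 - 2 * c * s ^+ 2))^-1 ^+ #|Q|)%:E)%E.
Proof.
move=> cs.
transitivity (\int[P]_w (expR (\sum_i (if Q i then c * X w i ord0 ^+ 2 else 0)))%:E)%E.
  by apply: eq_integral => w _; rewrite mulr_sumr big_mkcond.
rewrite (@integral_expR_sum (fun i x => if Q i then c * x ^+ 2 else 0)); last first.
  move=> i; case: (Q i); last exact: measurable_cst.
  by apply: measurable_funM => //; exact: measurable_funX.
rewrite (bigID Q)/= [X in (_ * X)%E]big1 ?mule1; last first.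
  move=> i /negbTE ->; under eq_integral do rewrite expR0.
  by rewrite integral_probability_cst.
rewrite (eq_bigr (fun=> (Num.sqrt (1 - 2 * c * s ^+ 2))^-1%:E)); last first.
  by move=> i ->; rewrite normal_law_sq_mgf.
by rewrite prodEFin prodr_const.
Qed.

End gaussian.

(** * Moments, tails and anti-concentration of Gaussian vectors *)

Lemma normal_law_sym {R : realType} (s : R) (f : R -> \bar R) : s != 0 ->
  measurable_fun setT f -> (forall x, 0 <= f x)%E ->
  (\int[normal_law s]_x f (- x)%R = \int[normal_law s]_x f x)%E.
Proof.
move=> s0 mf f0.
have mfN : measurable_fun setT (fun x : R => f (- x)).
  by apply: measurableT_comp => //; exact: oppr_measurable.
rewrite !ge0_integral_normal_law// !ge0_integral_normal_prob//.
have mp : measurable_fun setT (fun x => (normal_pdf 0 s x)%:E).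
  by apply/measurable_EFinP; exact: measurable_normal_pdf.
pose g x := (f x * (normal_pdf 0 s x)%:E)%E.
have mg : measurable_fun setT g by exact: emeasurable_funM.
have g0 x : (0 <= g x)%E by rewrite mule_ge0// lee_fin normal_pdf_ge0.
transitivity (\int[lebesgue_measure]_x (g \o -%R) x)%E.
  apply: eq_integral => x _; rewrite /g /=; congr (_ * (_ )%:E)%E.
  by rewrite !normal_pdfE// /normal_fun !subr0 sqrrN.
have mo : measurable_fun setT (-%R : measurableTypeR R -> measurableTypeR R).
  exact: (@oppr_measurable R setT).
have := @ge0_integral_pushforward _ _ _ _ R (-%R : measurableTypeR R -> measurableTypeR R)
  mo lebesgue_measure setT g measurableT mg (fun x _ => g0 x).
rewrite preimage_setT => <-.
by apply: eq_measure_integral => A mA _; exact: lebesgue_measureN.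
Qed.

(** Passage to the limit [r -> 1]. *)
Lemma squeeze_sq {R : realFieldType} (a b : R) : 0 <= b ->
  (forall r, 0 < r < 1 -> a * r ^+ 2 <= b) -> a <= b.
Proof.
move=> b0 h; rewrite leNgt; apply/negP => ba.
have a0 : 0 < a := le_lt_trans b0 ba.
pose e := (a - b) / (4 * a).
have e0 : 0 < e by rewrite divr_gt0 ?subr_gt0 ?mulr_gt0.
have ea : e * (4 * a) = a - b by rewrite divfK// mulf_neq0// gt_eqF.
have e1 : e < 1 by rewrite ltr_pdivrMr ?mulr_gt0//; lra.
have := h (1 - e); rewrite subr_gt0 e1 gtrBl e0 => /(_ isT).
have : 0 <= a * e ^+ 2 by rewrite mulr_ge0 ?sqr_ge0 ?ltW.
rewrite (_ : a * (1 - e) ^+ 2 = a - (e * (4 * a)) / 2 + a * e ^+ 2); last by field.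
by rewrite ea; lra.
Qed.

Section integral_tools.
Context {R : realType} {d : measure_display} {T : measurableType d}.
Context (P : probability T R).

(** Used with [f] an odd function of a symmetric variable. *)
Lemma integral_balanced (f : T -> R) : P.-integrable setT (EFin \o f) ->
  (\int[P]_w (Num.max (f w) 0)%:E = \int[P]_w (Num.max (- f w) 0)%:E)%E ->
  (\int[P]_w (f w)%:E = 0)%E.
Proof.
move=> fi e; rewrite integralE.
have e1 : (\int[P]_x (EFin \o f)^\+ x = \int[P]_w (Num.max (f w) 0)%:E)%E.
  by apply: eq_integral => w _; rewrite funeposE -EFin_max.
have e2 : (\int[P]_x (EFin \o f)^\- x = \int[P]_w (Num.max (- f w) 0)%:E)%E.
  by apply: eq_integral => w _; rewrite funenegE -EFin_max.
rewrite e1 e2 e -e2 subee//; exact: integrable_neg_fin_num.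
Qed.

(** Exponential Markov inequality. *)
Lemma prob_le_integral_expR (E : set T) (g : T -> R) :
  measurable E -> measurable_fun setT g -> (forall w, E w -> 0 <= g w) ->
  (P E <= \int[P]_w (expR (g w))%:E)%E.
Proof.
move=> mE mg Eg; have <- : (\int[P]_w (\1_E w)%:E = P E)%E by rewrite integral_indic// setIT.
apply: ge0_le_integral => //.
- by apply/measurable_EFinP; exact: measurable_indic.
- by apply/measurable_EFinP; apply: measurableT_comp.
move=> w _; rewrite lee_fin indicE; case: (boolP (w \in E)) => [/set_mem Ew|_].
  by rewrite -expR0 ler_expR Eg.
exact: expR_ge0.
Qed.

End integral_tools.

Section gaussian_bounds.
Context {R : realType} {d : measure_display} {T : measurableType d}.
Context (P : probability T R) {p : nat} (X : T -> 'cV[R]_p) (s : R).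
Hypotheses (s_gt0 : 0 < s) (gX : gaussian_vector P s X).

Let mX i : measurable_fun setT (fun w => X w i 0). Proof. exact: gX.1. Qed.
Let box : forall B : 'I_p -> set R, (forall i, measurable (B i)) ->
  P [set w | forall i, B i (X w i 0)] = (\prod_i normal_law s (B i))%E.
Proof. exact: gX.2. Qed.

Lemma measurable_sum_sq (Q : pred 'I_p) :
  measurable_fun setT (fun w => \sum_(i | Q i) X w i 0 ^+ 2).
Proof.
under eq_fun do rewrite big_mkcond.
apply: measurable_sum => i; case: (Q i); last exact: measurable_cst.
exact: measurable_funX.
Qed.

(** ** Moments *)

(** The second moment is squeezed between the exponential moments of small
    positive and small negative order of the squared coordinate. *)
Lemma integral_coord_sq (i : 'I_p) :
  (\int[P]_w (X w i ord0 ^+ 2)%:E = (s ^+ 2)%:E)%E.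
Proof.
have s2 : 0 < s ^+ 2 by rewrite exprn_gt0.
have mx2 : measurable_fun setT (fun x : R => (x ^+ 2)%:E).
  by apply/measurable_EFinP; exact: measurable_funX.
rewrite (integral_coord gX i mx2); last by move=> x; rewrite lee_fin sqr_ge0.
set I := (\int[_]_x _)%E.
have mexp c : measurable_fun setT (fun x : R => (expR (c * x ^+ 2))%:E).
  apply/measurable_EFinP; apply: measurableT_comp => //.
  by apply: measurable_funM => //; exact: measurable_funX.
have I0 : (0 <= I)%E by apply: integral_ge0 => x _; rewrite lee_fin sqr_ge0.
have sn0 : s != 0 by rewrite gt_eqF.
have cI c : 0 <= c -> (\int[normal_law s]_x (c * x ^+ 2)%:E = c%:E * I)%E.
  move=> c0; under eq_integral do rewrite EFinM.
  by rewrite ge0_integralZl// => x _; rewrite lee_fin sqr_ge0.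
have mcx c : measurable_fun setT (fun x : R => (c * x ^+ 2)%:E).
  apply/measurable_EFinP; apply: measurable_funM => //; exact: measurable_funX.
have up q : 0 < q < 1 -> (((1 - q ^+ 2) / (2 * s ^+ 2))%:E * I + 1 <= q^-1%:E)%E.
  case/andP=> q0 q1; set c := _ / _.
  have q2 : q ^+ 2 < 1 by rewrite expr_lt1// ltW.
  have c0 : 0 <= c by rewrite divr_ge0 ?mulr_ge0 ?subr_ge0 ?ltW.
  have cs : 1 - 2 * c * s ^+ 2 = q ^+ 2 by rewrite /c; field.
  have cs1 : 2 * c * s ^+ 2 < 1 by rewrite -subr_gt0 cs exprn_gt0.
  have := normal_law_sq_mgf s_gt0 cs1; rewrite cs sqrtr_sqr gtr0_norm// => <-.
  rewrite -cI// -(@integral_probability_cst R _ _ (normal_law s) 1).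
  rewrite -ge0_integralD//; last first.
    by move=> x _; rewrite lee_fin mulr_ge0 ?sqr_ge0.
  apply: ge0_le_integral => //.
  - by move=> x _; rewrite adde_ge0// lee_fin mulr_ge0 ?sqr_ge0.
  - exact: emeasurable_funD.
  - by move=> x _; rewrite -EFinD lee_fin addrC expR_ge1Dx.
have low q : 1 < q -> (1 <= ((q ^+ 2 - 1) / (2 * s ^+ 2))%:E * I + q^-1%:E)%E.
  move=> q1; set c := _ / _; have q0 : 0 < q by rewrite (lt_trans ltr01).
  have q2 : 1 < q ^+ 2 by rewrite exprn_egt1.
  have c0 : 0 <= c by rewrite divr_ge0 ?mulr_ge0 ?subr_ge0 ?ltW.
  have cs : 1 - 2 * (- c) * s ^+ 2 = q ^+ 2 by rewrite /c; field.
  have cs1 : 2 * (- c) * s ^+ 2 < 1 by rewrite -subr_gt0 cs exprn_gt0.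
  have := normal_law_sq_mgf s_gt0 cs1; rewrite cs sqrtr_sqr gtr0_norm// => <-.
  rewrite -cI// -{1}(@integral_probability_cst R _ _ (normal_law s) 1).
  rewrite -ge0_integralD//; last first.
    by move=> x _; rewrite lee_fin mulr_ge0 ?sqr_ge0.
  apply: ge0_le_integral => //.
  - exact: emeasurable_funD.
  - move=> x _; rewrite -EFinD lee_fin.
    have := expR_ge1Dx (- c * x ^+ 2); lra.
have Ifin : I \is a fin_num.
  have h12 : 0 < (1 / 2 : R) < 1 by lra.
  rewrite ge0_fin_numE// ltey; apply/eqP => Iy; have := up _ h12.
  rewrite Iy gt0_muley ?addye// lte_fin divr_gt0 ?mulr_gt0//; lra.
rewrite -(fineK Ifin) in up low *; set J := fine I in up low *.
have J0 : 0 <= J by rewrite fine_ge0.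
congr EFin; apply/eqP; rewrite eq_le; apply/andP; split.
  apply: squeeze_sq; [exact: ltW|move=> q /andP[q0 q1]].
  have := up q; rewrite q0 q1 => /(_ isT); rewrite -EFinM -EFinD lee_fin.
  rewrite -(ler_pM2r (_ : 0 < q * (2 * s ^+ 2))) ?mulr_gt0//.
  rewrite [leLHS](_ : _ = (1 - q) * (J * (q * (1 + q))) + 2 * s ^+ 2 * q); last by field.
  rewrite [leRHS](_ : _ = (1 - q) * (2 * s ^+ 2) + 2 * s ^+ 2 * q); last by field; rewrite gt_eqF.
  rewrite lerD2r ler_pM2l ?subr_gt0// => h.
  have : J * (2 * q ^+ 2) <= J * (q * (1 + q)) by rewrite ler_wpM2l//; nra.
  by lra.
apply: squeeze_sq => // q /andP[q0 q1].
have qi : 1 < q^-1 by rewrite invf_gt1.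
have := low _ qi; rewrite -EFinM -EFinD lee_fin invrK.
rewrite -(ler_pM2r (_ : 0 < q ^+ 2 * (2 * s ^+ 2))) ?mulr_gt0 ?exprn_gt0//.
rewrite [leRHS](_ : _ = (1 - q) * (J * (1 + q)) + 2 * s ^+ 2 * q ^+ 3); last first.
  by field; rewrite !gt_eqF.
rewrite [leLHS](_ : _ = (1 - q) * (2 * s ^+ 2 * q ^+ 2) + 2 * s ^+ 2 * q ^+ 3); last by ring.
rewrite lerD2r ler_pM2l ?subr_gt0// => h.
have : J * (1 + q) <= J * 2 by rewrite ler_wpM2l//; lra.
by lra.
Qed.

Let mXE i : measurable_fun setT (fun w => (X w i ord0)%:E).
Proof. by apply/measurable_EFinP; exact: mX. Qed.

Lemma integrable_coord_sq i : P.-integrable setT (fun w => (X w i ord0 ^+ 2)%:E).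
Proof.
apply/integrableP; split.
  by apply/measurable_EFinP; apply: measurable_funX; exact: mX.
under eq_integral do rewrite gee0_abs ?lee_fin ?sqr_ge0//.
by rewrite integral_coord_sq ltry.
Qed.

Lemma integrable_coordM i j :
  P.-integrable setT (fun w => (X w i ord0 * X w j ord0)%:E).
Proof.
have h := integrableD measurableT (integrable_coord_sq i) (integrable_coord_sq j).
apply: le_integrable h => //.
  by apply/measurable_EFinP; apply: measurable_funM; exact: mX.
move=> w _ /=; rewrite lee_fin [leRHS]ger0_norm ?addr_ge0 ?sqr_ge0//.
set x := X w i 0; set y := X w j 0.
by rewrite ler_norml; apply/andP; split; nra.
Qed.

Lemma integrable_coord i : P.-integrable setT (fun w => (X w i ord0)%:E).
Proof.
have h1 : P.-integrable setT (cst 1%E) by exact: finite_measure_integrable_cst.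
have h := integrableD measurableT h1 (integrable_coord_sq i).
apply: le_integrable h => // w _ /=; rewrite lee_fin [leRHS]ger0_norm ?addr_ge0 ?sqr_ge0//.
set x := X w i 0; by rewrite ler_norml; apply/andP; split; nra.
Qed.

Lemma integral_coord0 i : (\int[P]_w (X w i ord0)%:E = 0)%E.
Proof.
have mmax : measurable_fun setT (fun x : R => (Num.max x 0)%:E).
  by apply/measurable_EFinP; exact: measurable_maxr.
have max0 (x : R) : (0 <= (Num.max x 0)%:E)%E by rewrite lee_fin le_max lexx orbT.
apply: integral_balanced; first exact: integrable_coord.
rewrite (integral_coord gX i mmax max0).
rewrite (integral_coord gX i (f := fun x => (Num.max (- x) 0)%:E))//; last first.
  by apply/measurable_EFinP; apply: measurable_maxr => //; exact: oppr_measurable.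
by rewrite (normal_law_sym _ mmax max0)// gt_eqF.
Qed.

Lemma integral_coordM0 i j : i != j ->
  (\int[P]_w (X w i ord0 * X w j ord0)%:E = 0)%E.
Proof.
move=> ij; apply: integral_balanced; first exact: integrable_coordM.
have oZ : other_measurable X i (fun w => X w j 0).
  have ji : j != i by rewrite eq_sym.
  exact: (other_measurable_coord (X := X) ji (@measurable_id _ R setT)).
have mmul : measurable_fun setT (fun z : R * R => z.1 * z.2).
  by apply: measurable_funM; [exact: measurable_fst|exact: measurable_snd].
have max0 (x : R) : (0 <= (Num.max x 0)%:E)%E by rewrite lee_fin le_max lexx orbT.
have mpos (z : R) : measurable_fun setT (fun x : R => (Num.max (x * z) 0)%:E).
  by apply/measurable_EFinP; apply: measurable_maxr => //; exact: measurable_funM.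
pose f1 (z : R * R) := (Num.max (z.1 * z.2) 0)%:E.
pose f2 (z : R * R) := (Num.max (- (z.1 * z.2)) 0)%:E.
have mf1 : measurable_fun setT f1 by apply/measurable_EFinP; exact: measurable_maxr.
have mf2 : measurable_fun setT f2.
  apply/measurable_EFinP; apply: measurable_maxr => //.
  by apply: measurableT_comp => //; exact: oppr_measurable.
apply: eq_trans (integral_indep mX box oZ mf1 (fun=> max0 _)) _.
apply: eq_trans _ (esym (integral_indep mX box oZ mf2 (fun=> max0 _))).
apply: eq_integral => w _; rewrite -(normal_law_sym _ (mpos (X w j 0)))//; last first.
  by rewrite gt_eqF.
by apply: eq_integral => x _; rewrite /f2 mulNr.
Qed.

(** ** Tails *)

(** Chernoff bounds for the chi-square variables [|X| ^ 2 / s ^ 2]: the upper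
    tail uses the exponential moment of order [1 / 4], the lower tail that of order
    [- e / 2]. *)
Lemma enorm_sq_upper_tail (k : R) :
  (P [set w | (k * p%:R * s ^+ 2 <= enorm (X w) ^+ 2)%R] <=
   (expR (- ((k - 2) / 4 * p%:R)))%:E)%E.
Proof.
have sn0 : s != 0 by rewrite gt_eqF.
have s2 : 0 < s ^+ 2 by rewrite exprn_gt0.
pose c := (4 * s ^+ 2)^-1.
have c0 : 0 < c by rewrite invr_gt0 mulr_gt0.
have cs : 1 - 2 * c * s ^+ 2 = 2^-1 by rewrite /c; field.
have cs1 : 2 * c * s ^+ 2 < 1 by rewrite -subr_gt0 cs.
pose S w := \sum_(i | xpredT i) X w i ord0 ^+ 2.
have mS : measurable_fun setT S := measurable_sum_sq xpredT.
have -> : [set w | k * p%:R * s ^+ 2 <= enorm (X w) ^+ 2] = [set w | k * p%:R * s ^+ 2 <= S w].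
  by apply/seteqP; split => w /=; rewrite enorm_sqE.
apply: le_trans (_ : (\int[P]_w (expR (c * S w + - (k / 4 * p%:R)))%:E <= _)%E).
  apply: prob_le_integral_expR.
  - rewrite -[X in measurable X]setTI.
    exact: (@measurable_fun_ler _ _ _ setT (cst (k * p%:R * s ^+ 2)) S).
  - by apply: measurable_funD => //; exact: measurable_funM.
  - move=> w /=; rewrite subr_ge0 => h; rewrite -(ler_pM2l c0) in h.
    by apply: le_trans h; rewrite le_eqVlt; apply/orP; left; apply/eqP; rewrite /c; field.
under eq_integral do rewrite expRD mulrC EFinM.
rewrite ge0_integralZl//; last first.
  by apply/measurable_EFinP; apply: measurableT_comp => //; exact: measurable_funM.
rewrite (integral_expR_sq s_gt0 gX xpredT cs1) cs card_ord -EFinM lee_fin.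
rewrite (_ : - ((k - 2) / 4 * p%:R) = - (k / 4 * p%:R) + 2^-1 * p%:R); last by field.
rewrite expRD ler_pM2l ?expR_gt0// expRM_natr lerXn2r ?nnegrE ?expR_ge0 ?invr_ge0//.
rewrite -(@ler_pXn2r _ 2) ?nnegrE ?expR_ge0 ?invr_ge0 ?sqrtr_ge0//.
rewrite exprVn sqr_sqrtr ?invr_ge0// invrK -expRM_natr mulVf//.
by have := expR_ge1Dx (1 : R); lra.
Qed.

Lemma sum_sq_lower_tail (Q : pred 'I_p) (e : R) : 0 < e <= 1 ->
  (P [set w | (\sum_(i | Q i) X w i 0 ^+ 2 <= (1 - e) * #|Q|%:R * s ^+ 2)%R] <=
   (expR (- (e ^+ 3 / 4 * #|Q|%:R)))%:E)%E.
Proof.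
case/andP=> e0 e1; have sn0 : s != 0 by rewrite gt_eqF.
have s2 : 0 < s ^+ 2 by rewrite exprn_gt0.
have e10 : 0 < 1 + e by rewrite ltr_wpDl.
pose c := e / (2 * s ^+ 2).
have c0 : 0 < c by rewrite divr_gt0// mulr_gt0.
have cs : 1 - 2 * (- c) * s ^+ 2 = 1 + e by rewrite /c; field.
have cs1 : 2 * (- c) * s ^+ 2 < 1 by rewrite -subr_gt0 cs.
pose S w := \sum_(i | Q i) X w i ord0 ^+ 2.
have mS : measurable_fun setT S := measurable_sum_sq Q.
apply: le_trans (_ : (\int[P]_w (expR (- c * S w + e / 2 * (1 - e) * #|Q|%:R))%:E <= _)%E).
  apply: prob_le_integral_expR.
  - rewrite -[X in measurable X]setTI.
    exact: (@measurable_fun_ler _ _ _ setT S (cst ((1 - e) * #|Q|%:R * s ^+ 2))).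
  - by apply: measurable_funD => //; exact: measurable_funM.
  - move=> w /= h; rewrite mulNr [leRHS]addrC subr_ge0; rewrite -(ler_pM2l c0) in h.
    by apply: le_trans h _; rewrite le_eqVlt; apply/orP; left; apply/eqP; rewrite /c; field.
under eq_integral do rewrite expRD mulrC EFinM.
rewrite ge0_integralZl//; last first.
  by apply/measurable_EFinP; apply: measurableT_comp => //; exact: measurable_funM.
rewrite (integral_expR_sq s_gt0 gX Q cs1) cs -EFinM lee_fin.
have h : (Num.sqrt (1 + e))^-1 <= expR (- (e / (1 + e) / 2)).
  rewrite expRN lef_pV2 ?posrE ?expR_gt0 ?sqrtr_gt0//.
  rewrite -(@ler_pXn2r _ 2) ?nnegrE ?expR_ge0 ?sqrtr_ge0//.
  rewrite sqr_sqrtr ?(ltW e10)// -expRM_natr divfK//.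
  rewrite -lef_pV2 ?posrE ?expR_gt0// -expRN.
  apply: le_trans _ (expR_ge1Dx _); rewrite le_eqVlt; apply/orP; left; apply/eqP; field.
  by rewrite gt_eqF.
apply: le_trans (_ : expR (e / 2 * (1 - e) * #|Q|%:R) * expR (- (e / (1 + e) / 2)) ^+ #|Q| <= _).
  by rewrite ler_pM2l ?expR_gt0// lerXn2r ?nnegrE ?expR_ge0// invr_ge0 sqrtr_ge0.
rewrite -expRM_natr -expRD ler_expR -mulrDl -[leRHS]mulNr ler_wpM2r//.
rewrite (_ : _ + _ = - (e ^+ 3 / (2 * (1 + e)))); last by field; rewrite gt_eqF.
rewrite lerN2 ler_wpM2l ?exprn_ge0 ?(ltW e0)// lef_pV2 ?posrE ?mulr_gt0//; lra.
Qed.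

(** ** Anti-concentration *)

(** Freezing all the coordinates but one, the squared norm falls in a short
    interval only if the remaining coordinate falls in one of two intervals of
    length [Num.sqrt e]. *)
Lemma enorm_sq_shell (k : 'I_p) (a e : R) : 0 <= e ->
  (P [set w | (a < enorm (X w) ^+ 2 <= a + e)%R] <=
   (2 * (normal_peak s * Num.sqrt e))%:E)%E.
Proof.
move=> e0.
pose Z w := \sum_(i | i != k) X w i ord0 ^+ 2.
have oZ : other_measurable X k Z.
  rewrite /Z /other_measurable; under eq_fun do rewrite big_mkcond.
  apply: measurable_sum => i; case ik : (i != k); last exact: measurable_cst.
  have mf : measurable_fun setT (fun x : R => x ^+ 2) by exact: measurable_funX.
  exact: (other_measurable_coord (X := X) ik mf).
pose E := [set z : R * R | a < z.1 ^+ 2 + z.2 <= a + e].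
have mq : measurable_fun setT (fun z : R * R => z.1 ^+ 2 + z.2).
  by apply: measurable_funD; [apply: measurable_funX; exact: measurable_fst|exact: measurable_snd].
have mE : measurable E.
  rewrite (_ : E = (fun z : R * R => z.1 ^+ 2 + z.2) @^-1` `]a, a + e]).
    by rewrite -[X in measurable X]setTI; exact: mq.
  by apply/seteqP; split=> z; rewrite /E /= in_itv.
have mEw : measurable [set w | E (X w k 0, Z w)].
  have mY : measurable_fun setT (fun w => (X w k 0, Z w)).
    by apply: measurable_fun_pair => //; exact: (other_measurableW mX oZ).
  by rewrite -[X in measurable X]setTI; exact: mY.
have -> : [set w | (a < enorm (X w) ^+ 2 <= a + e)%R] = [set w | E (X w k 0, Z w)].
  by apply/seteqP; split=> w /=; rewrite enorm_sqE (bigD1 k).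
pose g (z : R * R) : \bar R := (\1_E z : R)%:E.
have -> : P [set w | E (X w k 0, Z w)] =
    (\int[P]_w g (X w k ord0, Z w))%E.
  rewrite -[X in P X](setIT [set w | E (X w k 0, Z w)]) -(integral_indic P measurableT mEw).
  by apply: eq_integral => w _; rewrite !indicE.
have mi : measurable_fun setT g by apply/measurable_EFinP; exact: measurable_indic.
rewrite (integral_indep mX box oZ mi); last by move=> z; rewrite lee_fin.
rewrite -[leRHS](integral_probability_cst P).
apply: ge0_le_integral => //.
- by move=> w _; apply: integral_ge0 => x _; rewrite lee_fin.
- apply: (measurableT_comp (f := fun z => \int[normal_law s]_x g (x, z)))%E; last first.
    exact: (other_measurableW mX oZ).
  have h z : (0 <= g z)%E by rewrite lee_fin.
  exact: (@measurable_fun_fubini_tonelli_G _ _ _ _ _ (normal_law s) g mi h).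
move=> w _; set z := Z w.
pose r := Num.sqrt (Num.max (a - z) 0).
have r0 : 0 <= r by exact: sqrtr_ge0.
have re : 0 <= Num.sqrt e by exact: sqrtr_ge0.
have slice : measurable [set x | E (x, z)].
  rewrite (_ : [set x | E (x, z)] = (fun x : R => x ^+ 2 + z) @^-1` `]a, a + e]).
    rewrite -[X in measurable X]setTI; apply: measurable_funD => //; exact: measurable_funX.
  by apply/seteqP; split=> x; rewrite /E /= in_itv.
apply: le_trans (_ : (normal_law s [set x | E (x, z)] <= _)%E).
  rewrite -(setIT [set x | E (x, z)]) -(integral_indic (normal_law s) measurableT slice).
  by rewrite le_eqVlt; apply/orP; left; apply/eqP/eq_integral => x _; rewrite !indicE.
have sub : [set x | E (x, z)] `<=` `[r, r + Num.sqrt e] `|` `[- r - Num.sqrt e, - r].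
  move=> x; rewrite /E /= => /andP[h1 h2].
  have b0 : 0 <= Num.max (a - z) 0 by rewrite le_max lexx orbT.
  have ab : a - z <= Num.max (a - z) 0 by rewrite le_max lexx.
  have r2 : r ^+ 2 = Num.max (a - z) 0 by rewrite sqr_sqrtr.
  have rx : r <= `|x|.
    rewrite -(@ler_pXn2r _ 2) ?nnegrE// r2 real_normK ?num_real// ge_max sqr_ge0 andbT.
    by rewrite lerBlDr ltW.
  have xr : `|x| <= r + Num.sqrt e.
    rewrite -(@ler_pXn2r _ 2) ?nnegrE ?addr_ge0// real_normK ?num_real//.
    rewrite sqrrD r2 sqr_sqrtr//; have : 0 <= r * Num.sqrt e by exact: mulr_ge0.
    by lra.
  rewrite !in_itv /=; case: (leP 0 x) => x0.
    by left; move: rx xr; rewrite ger0_norm// => -> ->.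
  by right; move: rx xr; rewrite ltr0_norm//; lra.
apply: le_trans (le_measure _ _ _ sub) _; rewrite ?inE//; first exact: measurableU.
apply: le_trans (measureU2 _ _ _) _ => //.
rewrite mulrDl mul1r EFinD; apply: leeD.
  have -> : normal_peak s * Num.sqrt e = normal_peak s * (r + Num.sqrt e - r).
    by congr (_ * _); ring.
  by apply: normal_prob_itv_le; [rewrite gt_eqF|lra].
have -> : normal_peak s * Num.sqrt e = normal_peak s * (- r - (- r - Num.sqrt e)).
  by congr (_ * _); ring.
by apply: normal_prob_itv_le; [rewrite gt_eqF|lra].
Qed.

End gaussian_bounds.

(** * The conditions at a fixed sample size *)

Section blocks.
Context {R : realType} {m : nat}.
Variables (B : 'M[R]_(m + m)) (c : R).
Hypotheses (c_ge0 : 0 <= c) (B_le : forall u, enorm (B *m u) <= c * enorm u).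

Lemma opnorm_ulsubmx_le : opnorm (ulsubmx B) <= c.
Proof.
apply: opnorm_le => // u; have := B_le (col_mx u 0); rewrite enorm_col_mx0.
apply: le_trans; have -> : ulsubmx B *m u = usubmx (B *m col_mx u 0).
  by rewrite -{2}[B]submxK mul_block_col !mulmx0 !addr0 col_mxKu.
exact: enorm_usubmx_le.
Qed.

Lemma opnorm_ursubmx_le : opnorm (ursubmx B) <= c.
Proof.
apply: opnorm_le => // u; have := B_le (col_mx 0 u); rewrite enorm_0col_mx.
apply: le_trans; have -> : ursubmx B *m u = usubmx (B *m col_mx 0 u).
  by rewrite -{2}[B]submxK mul_block_col !mulmx0 !add0r col_mxKu.
exact: enorm_usubmx_le.
Qed.

End blocks.

Section scalar_blocks.
Context {R : realType} (m : nat).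

Lemma ulsubmx_scalar (a : R) : ulsubmx (a%:M : 'M[R]_(m + m)) = a%:M.
Proof. by rewrite scalar_mx_block block_mxKul. Qed.

Lemma ursubmx_scalar (a : R) : ursubmx (a%:M : 'M[R]_(m + m)) = 0.
Proof. by rewrite scalar_mx_block block_mxKur. Qed.

Lemma drsubmx_scalar (a : R) : drsubmx (a%:M : 'M[R]_(m + m)) = a%:M.
Proof. by rewrite scalar_mx_block block_mxKdr. Qed.

Lemma ulsubmx_standardize (a : R) (A : 'M[R]_(m + m)) : a != 0 ->
  ulsubmx (a^-1 *: (A - a%:M)) = a^-1 *: ulsubmx A - 1%:M.
Proof.
move=> a0; apply/matrixP => i j; rewrite !mxE mulrBr (inj_eq (@lshift_inj _ _)).
by rewrite mulrnAr mulVf.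
Qed.

Lemma ursubmx_standardize (a : R) (A : 'M[R]_(m + m)) :
  ursubmx (a^-1 *: (A - a%:M)) = a^-1 *: ursubmx A.
Proof. by apply/matrixP => i j; rewrite !mxE eq_lrshift mulr0n subr0. Qed.

End scalar_blocks.

Section fixed_n.
Context {R : realType} {d : measure_display} {T : measurableType d}.
Context (P : probability T R).
Variables (K : R -> R) (L M : R) (n m : nat) (X : T -> 'cV[R]_(m + m)).
Hypotheses (hK : smooth_kernel K) (L_gt0 : 0 < L) (M_ge1 : 1 <= M).
Hypotheses (n_gt0 : (0 < n)%N) (m_gt0 : (0 < m)%N).
Hypotheses (K_le : forall x, `|K x| <= M) (dK_le : forall x, `|derive1 K x| <= M).
Hypothesis K_flat : forall x, -1 <= x -> K x <= M * (x + 1) ^+ 2.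
Hypothesis gX : gaussian_vector P (Num.sqrt n%:R)^-1 X.
Implicit Types u v g : 'cV[R]_(m + m).

Local Notation s := (scale R n m).
Local Notation N := (n%:R : R).
Local Notation lik := (fun w => loglik K L n (X w)).
Local Notation DD := ((Num.sqrt N)%:M : 'M[R]_(m + m)).
Local Notation D := ((Num.sqrt N)%:M : 'M[R]_m).

Let s_gt0 : 0 < s := scale_gt0 n_gt0 m_gt0.
Let N_gt0 : 0 < N. Proof. by rewrite ltr0n. Qed.
Let q_gt0 : 0 < Num.sqrt N. Proof. by rewrite sqrtr_gt0. Qed.
Let qq : Num.sqrt N * Num.sqrt N = N.
Proof. by rewrite -expr2 sqr_sqrtr// ltW. Qed.
Let sd_gt0 : 0 < (Num.sqrt N)^-1. Proof. by rewrite invr_gt0. Qed.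
Let mX i : measurable_fun setT (fun w => X w i 0). Proof. exact: gX.1. Qed.

Lemma integrable_dotp u : P.-integrable setT (fun w => (dotp (X w) u)%:E).
Proof.
have -> : (fun w => (dotp (X w) u)%:E) = (fun w => \sum_i ((u i 0)%:E * (X w i ord0)%:E))%E.
  apply/funext => w; rewrite dotpE -sumEFin; apply: eq_bigr => i _.
  by rewrite mulrC EFinM.
by apply: integrable_sum => // i _; apply: integrableZl => //; exact: (integrable_coord sd_gt0 gX).
Qed.

Lemma integral_dotp0 u : (\int[P]_w (dotp (X w) u)%:E = 0)%E.
Proof.
have iX i : P.-integrable setT (fun w => (X w i ord0)%:E) by exact: (integrable_coord sd_gt0 gX).
have -> : (fun w => (dotp (X w) u)%:E) = (fun w => \sum_i ((u i 0)%:E * (X w i ord0)%:E))%E.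
  apply/funext => w; rewrite dotpE -sumEFin; apply: eq_bigr => i _.
  by rewrite mulrC EFinM.
rewrite integral_sum//; last by move=> i; apply: integrableZl.
by rewrite big1// => i _; rewrite integralZl// (integral_coord0 sd_gt0 gX) mule0.
Qed.

Lemma expectation_affine u (c : R) : expectation P (fun w => N * dotp (X w) u + c) = c%:E.
Proof.
rewrite unlock.
have i1 := integrable_dotp u.
have i2 : P.-integrable setT (fun w => N%:E * (dotp (X w) u)%:E)%E by exact: integrableZl.
have i3 : P.-integrable setT (cst c%:E) by exact: finite_measure_integrable_cst.
under eq_integral do rewrite EFinD EFinM.
rewrite integralD//= integralZl// integral_dotp0 mule0 add0e.
exact: integral_probability_cst.
Qed.

Lemma Elik_mean : Elik P lik = mean_loglik K L n (m := m).
Proof.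
apply/funext => v; rewrite /Elik.
under [X in expectation P X]eq_fun do rewrite loglik_mean.
by rewrite expectation_affine.
Qed.

Lemma zeta_linear w v : zeta P lik w v = N * dotp (X w) v.
Proof. by rewrite /zeta Elik_mean loglik_mean addrK. Qed.

Lemma grad_zeta w v : grad (zeta P lik w) v = N *: X w.
Proof.
rewrite -(grad_linear n (X w) v); congr (grad _ v).
by apply/funext => u; exact: zeta_linear.
Qed.

Lemma expectation_increment v :
  expectation P (fun w => lik w v - lik w 0) = (mean_loglik K L n v)%:E.
Proof.
under [X in expectation P X]eq_fun do rewrite !loglik_mean mean0 dotp0 mulr0 addr0 subr0.
exact: expectation_affine.
Qed.

Lemma info0 : info P lik 0 = N%:M.
Proof.
by rewrite /info Elik_mean (hess_mean0 hK L_gt0 M_ge1 n_gt0 m_gt0 K_le dK_le K_flat) opprK.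
Qed.

Lemma cov_score0 : cov_score P lik 0 = N%:M.
Proof.
apply/matrixP => i j; rewrite !mxE.
have gE k : (fun w => grad (lik w) 0 k 0) = (fun w => N * X w k 0).
  by apply/funext => w; rewrite (grad_loglik0 hK L_gt0 M_ge1 n_gt0 m_gt0 K_flat) mxE.
have E0 k : expectation P (fun w => N * X w k 0) = 0%E.
  rewrite unlock; under eq_integral do rewrite EFinM.
  rewrite integralZl//; last exact: (integrable_coord sd_gt0 gX).
  by rewrite (integral_coord0 sd_gt0 gX) mule0.
rewrite !gE unlock !E0 /= unlock.
have e w : ((fun w => N * X w i 0) \- cst 0) w * ((fun w => N * X w j 0) \- cst 0) w
    = N ^+ 2 * (X w i 0 * X w j 0) :> R.
  by rewrite /= !subr0; ring.
rewrite (eq_integral (fun w => ((N ^+ 2)%:E * (X w i ord0 * X w j ord0)%:E)%E)); last first.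
  by move=> w _; rewrite -EFinM; congr EFin; exact: e.
rewrite integralZl//; last exact: (integrable_coordM sd_gt0 gX).
have [<-|ij] := eqVneq i j; last by rewrite (integral_coordM0 sd_gt0 gX ij) mule0 mulr0n.
under eq_integral do rewrite -expr2.
rewrite (integral_coord_sq sd_gt0 gX) /= mulr1n exprVn sqr_sqrtr ?ltW//.
by field; rewrite gt_eqF.
Qed.

Lemma DD_sq : DD *m DD = N%:M. Proof. by rewrite -scalar_mxM qq. Qed.
Lemma D_sq : D *m D = N%:M. Proof. by rewrite -scalar_mxM qq. Qed.

Lemma enorm_DD u : enorm (DD *m u) = Num.sqrt N * enorm u.
Proof. by rewrite mul_scalar_mx enormZ gtr0_norm. Qed.

Lemma local_setE (r : R) v : local_set DD 0 r v <-> Num.sqrt N * enorm v <= r.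
Proof. by rewrite /local_set /= subr0 enorm_DD. Qed.

Lemma mean_argmax : s < 3 / 4 -> is_unique_argmax (Elik P lik) 0.
Proof.
move=> s34 v /eqP v0; rewrite Elik_mean mean0.
apply: le_lt_trans (mean_le hK L_gt0 n_gt0 m_gt0 v) _.
rewrite -mulrA mulNr oppr_lt0; apply: mulr_gt0 => //; apply: mulr_gt0; first by lra.
by rewrite exprn_gt0// enorm_gt0.
Qed.

Lemma model_twice_differentiable v : enorm v < 2 * s ->
  twice_differentiable (Elik P lik) v.
Proof.
by rewrite Elik_mean; exact: (mean_twice_differentiable hK L_gt0 M_ge1 n_gt0 m_gt0 K_flat).
Qed.

Lemma model_cond_I : cond_I D (ursubmx (info P lik 0)) D 0.
Proof.
by rewrite /cond_I info0 ursubmx_scalar mulmx0 mul0mx lexx ltr01; split => //; exact: opnorm0_le.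
Qed.

(** The three blocks are blocks of the matrix [N^-1 *: (info v - N)], whose
    operator norm is bounded by [hess_mean_le]. *)
Lemma model_cond_L0 (r0 : R) : cond_L0 P lik DD 0 D (ursubmx (info P lik 0)) D r0
  [set v | twice_differentiable (Elik P lik) v] (fun=> curvature L M * s).
Proof.
move=> r v _ _ /= S; rewrite info0 ursubmx_scalar subr0 mulmx0 !mul0mx.
have c0 : 0 <= curvature L M * s by apply: mulr_ge0; [exact: curvature_ge0|exact: ltW].
have iD : invmx D = (Num.sqrt N)^-1%:M by rewrite invmx_scalar.
pose B := N^-1 *: (info P lik v - N%:M).
have B_le u : enorm (B *m u) <= curvature L M * s * enorm u.
  rewrite -scalemxAl enormZ gtr0_norm ?invr_gt0// ler_pdivrMl// mulrA.
  rewrite /info Elik_mean; rewrite Elik_mean in S.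
  exact: (hess_mean_le hK L_gt0 M_ge1 n_gt0 m_gt0 K_le dK_le K_flat).
have iDD (A : 'M[R]_m) : invmx D *m A *m invmx D = N^-1 *: A.
  by rewrite iD mul_scalar_mx -scalemxAl mul_mx_scalar scalerA -invfM qq.
split; last exact: opnorm0_le.
- rewrite iDD (_ : _ - _ = ulsubmx B); first exact: opnorm_ulsubmx_le.
  by rewrite ulsubmx_standardize// gt_eqF.
- rewrite iDD (_ : _ *: _ = ursubmx B); first exact: opnorm_ursubmx_le.
  by rewrite ursubmx_standardize.
Qed.

(** The score fluctuation is linear in the Gaussian vector, so its log-Laplace
    transform is exactly quadratic. *)
Lemma log_mgf_score v g (mu : R) : enorm (DD *m g) != 0 ->
  log_mgf P (fun w => dotp (grad (zeta P lik w) v) g / enorm (DD *m g)) mu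
  = (mu ^+ 2 / 2)%:E.
Proof.
rewrite enorm_DD => h; have g0 : 0 < enorm g.
  by rewrite lt_neqAle enorm_ge0 andbT eq_sym; apply: contra h => /eqP ->; rewrite mulr0.
rewrite /log_mgf /mmt_gen_fun unlock.
pose c := (mu * Num.sqrt N / enorm g) *: g.
have e w : (expR \o mu \o* (fun w => dotp (grad (zeta P lik w) v) g / (Num.sqrt N * enorm g))) w
    = expR (dotp c (X w)).
  rewrite /= grad_zeta dotpZl dotpZl (dotpC (X w)) -{1}qq; congr expR; field.
  by rewrite !gt_eqF.
under eq_integral do rewrite e.
rewrite (integral_expR_dotp sd_gt0 gX) (expeRK (_)%:E); congr EFin.
rewrite enormZ exprMn real_normK ?num_real// exprVn sqr_sqrtr ?ltW//.
have q2 : Num.sqrt N ^+ 2 = N by rewrite expr2.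
rewrite !exprMn exprVn q2; field.
by rewrite !gt_eqF.
Qed.

Lemma model_cond_ED0 : cond_ED0 P lik DD 0 1 1.
Proof.
by split => // mu g _ h; rewrite log_mgf_score// expr1n mul1r.
Qed.

Lemma model_cond_Er (r0 : R) : cond_Er P lik DD 0 r0.
Proof.
move=> r _; exists 1, 1; split => // mu v g _ _ h.
by rewrite log_mgf_score// expr1n mul1r.
Qed.

(** The gradient of [zeta] does not depend on the point, hence [omega] is free. *)
Lemma model_cond_ED1 (r0 omega : R) : 0 < omega <= 1 / 2 -> cond_ED1 P lik DD 0 r0 1 omega 1.
Proof.
move=> o; split => // mu r v v' g _ _ _ _ _ _.
rewrite /log_mgf /mmt_gen_fun unlock.
under eq_integral do rewrite /= !grad_zeta subrr mulmx0 dotp0 mul0r mul0r expR0.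
rewrite integral_probability_cst -expR0 (expeRK 0%:E) lee_fin.
by rewrite divr_ge0// mulr_ge0 ?sqr_ge0.
Qed.

Lemma model_cond_Lr (r0 : R) : s < 3 / 4 -> cond_Lr P lik DD 0 r0.
Proof.
move=> s34 r _; exists (1 / 2 - 2 / 3 * s); first by lra.
move=> v _ v0; rewrite expectation_increment /= subr0 enorm_DD exprMn expr2 qq.
rewrite ler_pdivlMr; last by apply: mulr_gt0 => //; rewrite exprn_gt0// enorm_gt0.
have := mean_le hK L_gt0 n_gt0 m_gt0 v; lra.
Qed.

End fixed_n.

(** * Measurability of the statistics *)

Section random_vectors.
Context {R : realType} {d : measure_display} {T : measurableType d}.

Lemma measurable_sqrt (f : T -> R) : measurable_fun setT f ->
  measurable_fun setT (fun w => Num.sqrt (f w)).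
Proof.
move=> mf; apply: measurableT_comp => //; apply: continuous_measurable_fun.
exact: sqrt_continuous.
Qed.

Context {p : nat}.
Implicit Types Y Z : T -> 'cV[R]_p.

Lemma measurable_enorm Y : random_vector Y ->
  measurable_fun setT (fun w => enorm (Y w)).
Proof.
move=> mY; apply: measurable_sqrt; apply: measurable_sum => i.
exact: measurable_funX.
Qed.

Lemma measurable_dotp Y Z : random_vector Y -> random_vector Z ->
  measurable_fun setT (fun w => dotp (Y w) (Z w)).
Proof.
move=> mY mZ; under eq_fun do rewrite dotpE; apply: measurable_sum => i.
exact: measurable_funM.
Qed.

Lemma random_vectorB Y Z : random_vector Y -> random_vector Z ->
  random_vector (fun w => Y w - Z w).
Proof.
move=> mY mZ i; under eq_fun do rewrite !mxE; exact: measurable_funB.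
Qed.

End random_vectors.

Section statistics.
Context {R : realType} {d : measure_display} {T : measurableType d} {m : nat}.
Implicit Types Y Z : T -> 'cV[R]_(m + m).

Lemma random_vector_usubmx Y : random_vector Y ->
  random_vector (fun w => usubmx (Y w)).
Proof. by move=> mY i; under eq_fun do rewrite mxE; exact: mY. Qed.

Lemma random_vector_dsubmx Y : random_vector Y ->
  random_vector (fun w => dsubmx (Y w)).
Proof. by move=> mY i; under eq_fun do rewrite mxE; exact: mY. Qed.

Lemma measurable_loglik (K : R -> R) (L : R) (n : nat) Y Z :
  smooth_kernel K -> 0 < L -> (0 < n)%N -> (0 < m)%N ->
  random_vector Y -> random_vector Z ->
  measurable_fun setT (fun w => loglik K L n (Y w) (Z w)).
Proof.
move=> hK L0 n0 m0 mY mZ.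
have h0 : 0 < L^-1 * scale R n m by apply: mulr_gt0; [rewrite invr_gt0|exact: scale_gt0].
have mball : measurable [set w | enorm (Z w) <= 2 * scale R n m].
  rewrite -[X in measurable X]setTI.
  exact: (measurable_fun_ler (measurable_enorm mZ) (measurable_cst _)).
have mcut : measurable_fun setT (fun w => cutoff K L n (Z w)).
  have -> : (fun w => cutoff K L n (Z w)) = (fun w =>
      kernel_cdf K (enorm (usubmx (Z w)) / (L^-1 * scale R n m) - 1)
      * \1_[set w | enorm (Z w) <= 2 * scale R n m] w).
    by apply/funext => w; rewrite /cutoff phiE ?enorm_ge0// !indicE.
  apply: measurable_funM; last exact: measurable_indic.
  apply: measurableT_comp.
    apply: continuous_measurable_fun; exact: kernel_cdf_continuous.
  apply: measurable_funB => //; apply: measurable_funM => //.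
  exact: measurable_enorm (random_vector_usubmx mZ).
have me := measurable_enorm mZ.
apply: measurable_funD; last first.
  apply: measurable_funM; last exact: measurable_funX.
  exact: measurable_funM.
apply: measurable_funB; apply: measurable_funM => //; last exact: measurable_funX.
exact: measurable_dotp.
Qed.

End statistics.

(** * Localization of the maximizers *)

Section localization.
Context {R : realType} {d : measure_display} {T : measurableType d}.
Context (P : probability T R).
Variables (K : R -> R) (L : R) (n m : nat) (X tv tv0 : T -> 'cV[R]_(m + m)).
Hypotheses (hK : smooth_kernel K) (L_gt0 : 0 < L).
Hypotheses (n_gt0 : (0 < n)%N) (m_gt0 : (0 < m)%N).
Hypothesis gX : gaussian_vector P (Num.sqrt n%:R)^-1 X.
Hypotheses (mtv : random_vector tv)
  (tv_max : forall w, is_argmax setT (loglik K L n (X w)) (tv w)).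
Hypotheses (mtv0 : random_vector tv0)
  (tv0_max : forall w, is_argmax [set v | usubmx v = 0] (loglik K L n (X w)) (tv0 w)).

Local Notation s := (scale R n m).
Local Notation N := (n%:R : R).
Local Notation DD := ((Num.sqrt N)%:M : 'M[R]_(m + m)).

Let s_gt0 : 0 < s := scale_gt0 n_gt0 m_gt0.
Let sd_gt0 : 0 < (Num.sqrt N)^-1.
Proof. by rewrite invr_gt0 sqrtr_gt0 ltr0n. Qed.

Lemma enorm_sq_upper_tail_scale (k : R) :
  (P [set w | (k * s ^+ 2 <= enorm (X w) ^+ 2)%R] <=
   (expR (- ((k - 2) / 4 * (m + m)%:R)))%:E)%E.
Proof.
have := enorm_sq_upper_tail sd_gt0 gX k.
by rewrite exprVn sqr_sqrtr// -mulrA -scale_sq.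
Qed.

Lemma measurable_enorm_ge (c : R) : measurable [set w | c <= enorm (X w) ^+ 2].
Proof.
rewrite -[X in measurable X]setTI.
apply: measurable_fun_ler => //; apply: measurable_funX.
exact: measurable_enorm gX.1.
Qed.

Lemma local_radius_ge0 (x : R) : 0 <= local_radius P DD 0 tv tv0 x.
Proof.
rewrite /local_radius; set A := [set r | _].
have [->|/set0P A0] := eqVneq A set0; first by rewrite inf0.
by apply: lb_le_inf => // r [/ltW].
Qed.

Lemma argmax_enorm_le w : enorm (tv w) <= enorm (X w) + 3 * (s * Num.sqrt s).
Proof.
have h := argmax_dist hK L_gt0 n_gt0 m_gt0 (tv_max w).
have ss : 0 <= s * Num.sqrt s by rewrite mulr_ge0 ?sqrtr_ge0 ?(ltW s_gt0).
have dist : enorm (tv w - X w) <= 3 * (s * Num.sqrt s).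
  rewrite -(@ler_pXn2r _ 2) ?nnegrE ?enorm_ge0//; last by lra.
  apply: le_trans h _; rewrite !exprMn (sqr_sqrtr (ltW s_gt0)).
  have : 0 < s ^+ 3 by rewrite exprn_gt0.
  lra.
have := ler_enormD (tv w - X w) (X w); rewrite subrK => /le_trans; apply.
by rewrite addrC lerD2l.
Qed.

(** On the event [enorm X <= sqrt k * s] the constrained maximizer is shorter than
    [X] and the global one is within [3 * s ^ (3 / 2)] of [X]. *)
Lemma local_radius_le (k r x : R) : 0 <= k ->
  (Num.sqrt k + 3 * Num.sqrt s) * Num.sqrt (m + m)%:R <= r ->
  x <= (k - 2) / 4 * (m + m)%:R ->
  local_radius P DD 0 tv tv0 x <= r.
Proof.
move=> k0 hr hx.
have q0 : 0 < Num.sqrt N by rewrite sqrtr_gt0 ltr0n.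
have qs : Num.sqrt N * s = Num.sqrt (m + m)%:R.
  rewrite /scale -sqrtrM// mulrC divfK// pnatr_eq0 -lt0n//.
have r0 : 0 < r.
  apply: lt_le_trans hr; apply: mulr_gt0; last by rewrite sqrtr_gt0 ltr0n addn_gt0 m_gt0.
  by apply: ltr_wpDl; [exact: sqrtr_ge0|apply: mulr_gt0 => //; rewrite sqrtr_gt0].
apply: ge_inf; first by exists 0 => y [/ltW].
split => //.
pose B := [set w | k * s ^+ 2 <= enorm (X w) ^+ 2].
have mB : measurable B := measurable_enorm_ge _.
have mloc (Y : T -> 'cV[R]_(m + m)) : random_vector Y ->
    measurable [set w | local_set DD 0 r (Y w)].
  move=> mY; rewrite (_ : [set w | _] = [set w | Num.sqrt N * enorm (Y w) <= r]).
    rewrite -[X in measurable X]setTI; apply: measurable_fun_ler => //.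
    apply: measurable_funM => //; exact: measurable_enorm.
  by apply/seteqP; split => w /= h; apply/(local_setE (m := m) n_gt0).
apply: le_trans (_ : (P (~` B) <= _)%E); last first.
  apply: le_measure; rewrite ?inE//; first exact: measurableC.
    by apply: measurableI; exact: mloc.
  move=> w /negP; rewrite -ltNge => Bw.
  have sk : 0 <= Num.sqrt k by exact: sqrtr_ge0.
  have ss : 0 <= Num.sqrt s by exact: sqrtr_ge0.
  have Xw : enorm (X w) <= Num.sqrt k * s.
    rewrite -(@ler_pXn2r _ 2) ?nnegrE ?enorm_ge0//; last by rewrite mulr_ge0// ltW.
    by rewrite exprMn (sqr_sqrtr k0); exact: ltW.
  have h1 := argmax_enorm_le w.
  have h2 := constrained_argmax_norm hK L_gt0 n_gt0 m_gt0 (tv0_max w).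
  have bound y : y <= (Num.sqrt k + 3 * Num.sqrt s) * s -> Num.sqrt N * y <= r.
    move=> hy; apply: le_trans hr; rewrite -qs mulrCA ler_pM2l//.
  split; apply/(local_setE (m := m) n_gt0)/bound.
    by apply: le_trans h1 _; lra.
  have : 0 <= 3 * Num.sqrt s * s by rewrite !mulr_ge0// ltW.
  lra.
rewrite probability_setC// EFinB leeB// ?lee_fin//.
apply: le_trans (enorm_sq_upper_tail_scale k) _.
by rewrite lee_fin ler_expR lerN2.
Qed.

End localization.

(** * The Fisher and Wilks errors at a fixed sample size *)

Lemma normal_peak_le {R : realType} (s : R) : 0 < s -> normal_peak s <= s^-1.
Proof.
move=> s0; rewrite /normal_peak lef_pV2 ?posrE ?sqrtr_gt0//; last first.
  by rewrite pmulrn_lgt0// mulr_gt0 ?exprn_gt0 ?pi_gt0.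
have h : s ^+ 2 <= s ^+ 2 * pi *+ 2.
  rewrite -mulrnAr ler_peMr ?sqr_ge0// mulr2n; have := pi_ge2 R; lra.
by rewrite -[leLHS]gtr0_norm// -sqrtr_sqr ler_wsqrtr.
Qed.

Section statistics.
Context {R : realType} {d : measure_display} {T : measurableType d}.
Context (P : probability T R).
Variables (K : R -> R) (L : R) (n m : nat) (X tv : T -> 'cV[R]_(m + m)).
Variable (ttheta : T -> 'cV[R]_m).
Hypotheses (hK : smooth_kernel K) (L_gt0 : 0 < L).
Hypotheses (n_gt0 : (0 < n)%N) (m_gt0 : (0 < m)%N).
Hypothesis gX : gaussian_vector P (Num.sqrt n%:R)^-1 X.
Hypotheses (mtv : random_vector tv)
  (tv_max : forall w, is_argmax setT (loglik K L n (X w)) (tv w)).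
Hypotheses (mtheta : random_vector ttheta)
  (theta_max : forall w, is_argmax setT (profile (loglik K L n (X w))) (ttheta w)).

Local Notation s := (scale R n m).
Local Notation N := (n%:R : R).
Local Notation p := ((m + m)%:R : R).

Let s_gt0 : 0 < s := scale_gt0 n_gt0 m_gt0.
Let N_gt0 : 0 < N. Proof. by rewrite ltr0n. Qed.
Let q_gt0 : 0 < Num.sqrt N. Proof. by rewrite sqrtr_gt0. Qed.
Let qq : Num.sqrt N ^+ 2 = N. Proof. by rewrite sqr_sqrtr// ltW. Qed.
Let sd_gt0 : 0 < (Num.sqrt N)^-1. Proof. by rewrite invr_gt0. Qed.

(** ** Fisher error *)

Definition fisher_error w : R :=
  enorm ((Num.sqrt N)%:M *m (ttheta w - 0) - Num.sqrt N *: usubmx (X w)).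

Lemma fisher_errorE w :
  fisher_error w = Num.sqrt N * enorm (ttheta w - usubmx (X w)).
Proof.
by rewrite /fisher_error subr0 mul_scalar_mx -scalerBr enormZ gtr0_norm.
Qed.

Lemma measurable_fisher_error (e : R) : measurable [set w | e < `|fisher_error w - 0|].
Proof.
rewrite -[X in measurable X]setTI; apply: measurable_fun_ltr => //.
apply: measurableT_comp => //; under eq_fun do rewrite subr0 fisher_errorE.
apply: measurable_funM => //; apply: measurable_enorm.
apply: random_vectorB => //; exact: random_vector_usubmx gX.1.
Qed.

Let shell := [set w | (4 * s ^+ 2 < enorm (X w) ^+ 2
                       <= 4 * s ^+ 2 + 32 * (s ^+ 2 * Num.sqrt s))%R].

Let measurable_shell : measurable shell.
Proof.
have mX2 : measurable_fun setT (fun w => enorm (X w) ^+ 2).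
  by apply: measurable_funX; exact: measurable_enorm gX.1.
rewrite (_ : shell = (fun w => enorm (X w) ^+ 2) @^-1`
    `]4 * s ^+ 2, 4 * s ^+ 2 + 32 * (s ^+ 2 * Num.sqrt s)]).
  by rewrite -[X in measurable X]setTI; exact: mX2.
by apply/seteqP; split=> w; rewrite /= in_itv.
Qed.

(** The shell contains the annulus [2 s < enorm X <= 2 s + 4 s ^ (3 / 2)] left out
    by [profile_argmax_dist]. *)
Lemma fisher_error_shell (M e : R) : 1 <= M -> (forall y, `|K y| <= M) -> s <= 1 ->
  (8 * M * L + 14) * (p / Num.sqrt N) <= e ->
  [set w | e < `|fisher_error w - 0|] `<=` shell.
Proof.
move=> M1 KM s1 he w /=; rewrite subr0 fisher_errorE ger0_norm; last first.
  by rewrite mulr_ge0 ?enorm_ge0// ltW.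
have rs0 : 0 < Num.sqrt s by rewrite sqrtr_gt0.
have rs2 : Num.sqrt s ^+ 2 = s by rewrite (sqr_sqrtr (ltW s_gt0)).
apply: contraPP => hs; apply/negP; rewrite -leNgt.
have cases : enorm (X w) <= 2 * s \/ 2 * s + 4 * (s * Num.sqrt s) < enorm (X w).
  case: (leP (enorm (X w)) (2 * s)) => h1; first by left.
  right; rewrite ltNge; apply/negP => h2; apply: hs.
  have s2 : 0 < 2 * s by rewrite mulr_gt0.
  apply/andP; split.
    rewrite (_ : 4 * s ^+ 2 = (2 * s) ^+ 2); last by ring.
    by rewrite ltr_pXn2r ?nnegrE ?enorm_ge0// ltW.
  apply: le_trans (_ : (2 * s + 4 * (s * Num.sqrt s)) ^+ 2 <= _).
    rewrite ler_pXn2r ?nnegrE ?enorm_ge0//.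
    by apply: addr_ge0; [exact: ltW|apply: mulr_ge0 => //; apply: mulr_ge0; exact: ltW].
  rewrite (_ : (2 * s + _) ^+ 2 = 4 * s ^+ 2 + 16 * (s ^+ 2 * Num.sqrt s)
     + 16 * (s ^+ 2 * Num.sqrt s ^+ 2)); last by ring.
  have r1 : Num.sqrt s <= 1 by rewrite -sqrtr1 ler_wsqrtr.
  have : s ^+ 2 * Num.sqrt s ^+ 2 <= s ^+ 2 * Num.sqrt s.
    rewrite ler_wpM2l ?sqr_ge0// expr2 ler_piMl//; exact: ltW.
  lra.
have h := profile_argmax_dist hK L_gt0 n_gt0 m_gt0 (theta_max w) M1 KM s1 cases.
apply: le_trans he; rewrite -(ler_pM2l q_gt0) in h; apply: le_trans h _.
rewrite scale_sq le_eqVlt; apply/orP; left; apply/eqP.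
by rewrite -{2}qq; field; rewrite gt_eqF.
Qed.

(** Two bounds for the probability of the exceptional shell: the first one is
    useful in high dimension, the second one in bounded dimension. *)
Lemma shell_prob_le_expR : (P shell <= (expR (- (p / 2)))%:E)%E.
Proof.
have h := enorm_sq_upper_tail_scale n_gt0 gX 4.
have e : - ((4 - 2) / 4 * p) = - (p / 2) by field.
rewrite e in h; apply: le_trans h; apply: le_measure; rewrite ?inE.
- exact: measurable_shell.
- exact: (measurable_enorm_ge gX).
by move=> w /andP[/ltW].
Qed.

Lemma shell_prob_le_sqrt : (P shell <= (12 * (Num.sqrt p * Num.sqrt (Num.sqrt s)))%:E)%E.
Proof.
have k : 'I_(m + m) by exists 0%N; rewrite addn_gt0 m_gt0.
have rs0 : 0 < Num.sqrt s by rewrite sqrtr_gt0.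
have e0 : 0 <= 32 * (s ^+ 2 * Num.sqrt s).
  by apply: mulr_ge0 => //; apply: mulr_ge0; [exact: sqr_ge0|exact: ltW].
apply: le_trans (enorm_sq_shell sd_gt0 gX k (4 * s ^+ 2) e0) _.
rewrite lee_fin; have := normal_peak_le sd_gt0; rewrite invrK => pk.
have rb : Num.sqrt (32 * (s ^+ 2 * Num.sqrt s)) <= 6 * (s * Num.sqrt (Num.sqrt s)).
  rewrite -(@ler_pXn2r _ 2) ?nnegrE ?sqrtr_ge0//; last first.
    by apply: mulr_ge0 => //; apply: mulr_ge0; [exact: ltW|exact: sqrtr_ge0].
  rewrite (sqr_sqrtr e0) !exprMn (sqr_sqrtr (ltW rs0)).
  have : 0 <= s ^+ 2 * Num.sqrt s by apply: mulr_ge0; [exact: sqr_ge0|exact: ltW].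
  lra.
have qs : Num.sqrt N * s = Num.sqrt p.
  by rewrite /scale -sqrtrM ?ler0n// mulrC divfK// gt_eqF.
rewrite -qs; apply: le_trans (_ : 2 * (Num.sqrt N * (6 * (s * Num.sqrt (Num.sqrt s)))) <= _).
  by rewrite ler_pM2l//; apply: ler_pM => //; exact: normal_peak_ge0.
by rewrite le_eqVlt; apply/orP; left; apply/eqP; ring.
Qed.

Lemma fisher_error_prob_le (M e b : R) : 1 <= M -> (forall y, `|K y| <= M) -> s <= 1 ->
  (8 * M * L + 14) * (p / Num.sqrt N) <= e ->
  expR (- (p / 2)) <= b \/ 12 * (Num.sqrt p * Num.sqrt (Num.sqrt s)) <= b ->
  (P [set w | (e < `|fisher_error w - 0|)%R] <= b%:E)%E.
Proof.
move=> M1 KM s1 he hb.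
apply: le_trans (_ : (P shell <= _)%E).
  apply: le_measure; rewrite ?inE//; first exact: measurable_fisher_error.
  exact: fisher_error_shell KM s1 he.
case: hb => hb; [apply: le_trans shell_prob_le_expR _|apply: le_trans shell_prob_le_sqrt _];
  by rewrite lee_fin.
Qed.

(** ** Wilks error *)

Definition wilks_error w : R :=
  2 * (profile (loglik K L n (X w)) (ttheta w) - profile (loglik K L n (X w)) 0)
  - enorm (Num.sqrt N *: usubmx (X w)) ^+ 2.

Lemma wilks_errorE w : wilks_error w =
  2 * (profile (loglik K L n (X w)) (ttheta w) - profile (loglik K L n (X w)) 0)
  - N * enorm (usubmx (X w)) ^+ 2.
Proof. by rewrite /wilks_error enormZ exprMn real_normK ?num_real// qq. Qed.

Lemma measurable_wilks_error : measurable_fun setT wilks_error.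
Proof.
have -> : wilks_error = fun w => 2 * (loglik K L n (X w) (tv w)
    - N / 2 * enorm (dsubmx (X w)) ^+ 2) - N * enorm (usubmx (X w)) ^+ 2.
  apply/funext => w; rewrite wilks_errorE profile0//.
  by rewrite (profile_max hK L_gt0 n_gt0 m_gt0 (theta_max w) (tv_max w)).
have mX := gX.1.
apply: measurable_funB; apply: measurable_funM => //.
  apply: measurable_funB; first exact: measurable_loglik.
  apply: measurable_funM => //; apply: measurable_funX; apply: measurable_enorm.
  exact: random_vector_dsubmx.
apply: measurable_funX; apply: measurable_enorm; exact: random_vector_usubmx.
Qed.

Lemma scale_cube : N * s ^+ 3 = Num.sqrt (p ^+ 3 / N).
Proof.
have h : 0 <= N * s ^+ 3 by apply: mulr_ge0; [exact: ltW|rewrite exprn_ge0// ltW].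
rewrite -[LHS](ger0_norm h) -sqrtr_sqr; congr Num.sqrt.
rewrite exprMn -exprM mulnC exprM scale_sq; field.
by rewrite gt_eqF.
Qed.

Lemma wilks_error_ge0 w : 0 <= wilks_error w.
Proof.
rewrite wilks_errorE; apply: le_trans (wilks_ge hK L_gt0 n_gt0 m_gt0 (theta_max w)).
apply: mulr_ge0; last exact: cubic_ge0.
by apply: divr_ge0 => //; apply: mulr_ge0 => //; exact: ltW.
Qed.

Lemma wilks_error_le w : wilks_error w <= 16 / 3 * Num.sqrt (p ^+ 3 / N).
Proof. by rewrite wilks_errorE -scale_cube; exact: wilks_le. Qed.

(** When the target component of the Gaussian vector is not too small and the
    cutoff is active there, the cubic term shifts the maximum by its own
    order of magnitude. *)
Lemma wilks_error_ge (a : R) w : 1 / 2 <= a -> a * s <= enorm (usubmx (X w)) ->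
  enorm (X w) <= 2 * s ->
  kernel_cdf K (L * a - 1) / 12 * Num.sqrt (p ^+ 3 / N) <= wilks_error w.
Proof.
move=> a2 h1 h2; rewrite wilks_errorE -scale_cube.
apply: le_trans (wilks_ge hK L_gt0 n_gt0 m_gt0 (theta_max w)).
have hX : s / 2 <= enorm (X w).
  apply: le_trans (enorm_usubmx_le _); apply: le_trans h1.
  rewrite mulrC ler_wpM2r//; [exact: ltW|lra].
have X3 : (s / 2) ^+ 3 <= enorm (X w) ^+ 3.
  rewrite lerXn2r ?nnegrE ?enorm_ge0//; apply: divr_ge0 => //; exact: ltW.
have c : kernel_cdf K (L * a - 1) <= cutoff K L n (X w).
  rewrite cutoff_in//; apply: kernel_cdf_nondecreasing => //.
  rewrite lerB// ler_pdivlMr; last by apply: mulr_gt0 => //; rewrite invr_gt0.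
  by rewrite (_ : L * a * (L^-1 * s) = a * s)//; field; rewrite gt_eqF.
have c0 := kernel_cdf_ge0 hK (L * a - 1).
have : kernel_cdf K (L * a - 1) * (s / 2) ^+ 3 <= cutoff K L n (X w) * enorm (X w) ^+ 3.
  by apply: ler_pM => //; apply: exprn_ge0; apply: divr_ge0 => //; exact: ltW.
rewrite -(ler_pM2l (_ : 0 < 2 * N / 3)); last by apply: divr_gt0 => //; apply: mulr_gt0.
by apply: le_trans; rewrite le_eqVlt; apply/orP; left; apply/eqP; field.
Qed.

Lemma enorm_usubmx_sq (x : 'cV[R]_(m + m)) :
  enorm (usubmx x) ^+ 2 = \sum_(i < m + m | (i < m)%N) x i 0 ^+ 2.
Proof.
rewrite enorm_sqE big_split_ord /= [X in _ + X]big1 ?addr0; last first.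
  by move=> i; rewrite ltnNge leq_addr.
by apply: eq_big => [i|i _]; rewrite /= ?ltn_ord// mxE.
Qed.

Lemma target_lower_tail (e : R) : 0 < e <= 1 ->
  (P [set w | (enorm (usubmx (X w)) ^+ 2 <= (1 - e) / 2 * s ^+ 2)%R] <=
   (expR (- (e ^+ 3 / 8 * p)))%:E)%E.
Proof.
move=> e01; pose Q := [pred i : 'I_(m + m) | (i < m)%N].
have cQ : #|Q| = m.
  rewrite -sum1_card big_split_ord /= [X in (_ + X)%N]big1 ?addn0; last first.
    by move=> i; rewrite inE /= ltnNge leq_addr.
  rewrite (eq_bigl xpredT); first by rewrite sum1_card card_ord.
  by move=> i; rewrite inE /= ltn_ord.
have := sum_sq_lower_tail sd_gt0 gX Q e01; rewrite cQ.
rewrite (_ : e ^+ 3 / 8 * p = e ^+ 3 / 4 * m%:R); last by rewrite natrD; field.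
rewrite (_ : (1 - e) / 2 * s ^+ 2 = (1 - e) * m%:R * (Num.sqrt N)^-1 ^+ 2); last first.
  by rewrite scale_sq exprVn qq natrD; field; rewrite gt_eqF.
apply: le_trans; rewrite le_eqVlt; apply/orP; left; apply/eqP.
by congr (P _); apply/seteqP; split => w /=; rewrite enorm_usubmx_sq.
Qed.

Lemma wilks_error_prob_ge (a e eta : R) : 1 / 2 <= a -> 0 < e <= 1 ->
  a ^+ 2 = (1 - e) / 2 ->
  eta < kernel_cdf K (L * a - 1) / 12 * Num.sqrt (p ^+ 3 / N) ->
  ((1 - 2 * expR (- (e ^+ 3 / 8 * p)))%:E <=
   P [set w | (eta < `| `|wilks_error w| - 0|)%R])%E.
Proof.
move=> a2 e01 ae heta; set E := expR _.
pose B1 := [set w | (enorm (usubmx (X w)) ^+ 2 <= (1 - e) / 2 * s ^+ 2)%R].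
pose B2 := [set w | (4 * s ^+ 2 <= enorm (X w) ^+ 2)%R].
have mX := gX.1.
have mB1 : measurable B1.
  rewrite -[X in measurable X]setTI; apply: measurable_fun_ler => //.
  apply: measurable_funX; apply: measurable_enorm; exact: random_vector_usubmx.
have mB2 : measurable B2 by exact: (measurable_enorm_ge gX).
have PB : (P (B1 `|` B2) <= (2 * E)%:E)%E.
  apply: le_trans (measureU2 _ mB1 mB2) _.
  rewrite mulrDl mul1r EFinD leeD//; first exact: target_lower_tail.
  apply: le_trans (enorm_sq_upper_tail_scale n_gt0 gX 4) _.
  case/andP: e01 => e0 e1.
  rewrite lee_fin ler_expR lerN2 ler_wpM2r//.
  have : e ^+ 3 <= 1 by rewrite exprn_ile1// ltW.
  lra.
apply: le_trans (_ : (P (~` (B1 `|` B2)) <= _)%E).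
  rewrite probability_setC; last exact: measurableU.
  by rewrite EFinB leeB// lee_fin.
apply: le_measure; rewrite ?inE.
- by apply: measurableC; exact: measurableU.
- rewrite -[X in measurable X]setTI; apply: measurable_fun_ltr => //.
  apply: measurableT_comp => //; apply: measurable_funB => //.
  by apply: measurableT_comp => //; exact: measurable_wilks_error.
move=> w; rewrite setCU => -[/negP h1 /negP h2].
rewrite /= subr0 !ger0_norm ?wilks_error_ge0//.
apply: lt_le_trans heta _; apply: wilks_error_ge => //.
  rewrite -(@ler_pXn2r _ 2) ?nnegrE ?enorm_ge0//; last first.
    by apply: mulr_ge0; [lra|exact: ltW].
  by rewrite exprMn ae; move: h1; rewrite -ltNge => /ltW.
rewrite -(@ler_pXn2r _ 2) ?nnegrE ?enorm_ge0//; last by apply: mulr_ge0 => //; exact: ltW.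
by rewrite exprMn -natrX; move: h2; rewrite -ltNge => /ltW.
Qed.

End statistics.

(** * Asymptotics *)

Section asymptotics.
Context {R : realType}.

Lemma expRN_le (b y : R) : 0 < b -> b^-1 <= y -> expR (- y) <= b.
Proof.
move=> b0 by_; have y0 : 0 < y by apply: lt_le_trans by_; rewrite invr_gt0.
rewrite expRN -[leRHS]invrK lef_pV2 ?posrE ?expR_gt0 ?invr_gt0//.
apply: le_trans by_ _; apply: le_trans (expR_ge1Dx y); lra.
Qed.

Lemma zfun_bounds (x Q : R) : 0 <= x -> 0 <= Q -> 0 <= zfun 1 x Q <= x + Q + 1.
Proof.
move=> x0 Q0; rewrite /zfun invr1 mul1r; case: ifP => [h|_]; last lra.
by rewrite sqrtr_ge0 (le_trans h)//; lra.
Qed.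

Lemma spread_le (p' m' : nat) (omega delta r x : R) (b c : R) :
  0 <= x -> 0 <= r <= b -> 0 <= omega -> 0 <= delta ->
  2 * p'%:R + 2 * m'%:R + x + 1 <= c ->
  `|spread p' m' 0 1 omega 1 (fun=> delta) r x| <= (8 * delta + 6 * (omega * c)) * b.
Proof.
move=> x0 /andP[r0 rb] o0 d0 hc.
have Q0 : 0 <= 2 * p'%:R + 2 * m'%:R :> R by apply: addr_ge0; apply: mulr_ge0.
have /andP[z0 z1] := zfun_bounds x0 Q0.
set z := zfun 1 x _ in z0 z1 *.
have oz0 : 0 <= omega * z by apply: mulr_ge0.
have oz : omega * z <= omega * c by apply: ler_wpM2l => //; lra.
rewrite /spread -/z expr0n /= subr0 expr1n divr1 mulr1 -mulrA ger0_norm; last first.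
  by apply: mulr_ge0 => //; lra.
apply: ler_pM => //; lra.
Qed.

Lemma cvg_prob0 (d : nat -> measure_display) (T : forall n, measurableType (d n))
    (P : forall n, probability (T n) R) (A : forall n, set (T n)) :
  (forall b : R, 0 < b -> \forall n \near \oo, (P n (A n) <= b%:E)%E) ->
  (fun n => P n (A n)) @ \oo --> 0%E.
Proof.
move=> h; have fin n (b : R) : (P n (A n) <= b%:E)%E -> P n (A n) \is a fin_num.
  by move=> Pb; rewrite ge0_fin_numE// (le_lt_trans Pb)// ltry.
apply/fine_cvgP; split.
  by apply: filterS (h 1 ltr01) => n; exact: fin.
apply/cvgrPdist_le => b b0; apply: filterS (h b b0) => n Pb.
by rewrite sub0r normrN /= ger0_norm ?fine_ge0// -lee_fin fineK//; exact: fin Pb.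
Qed.

End asymptotics.

(** Continuity leaves room below the typical value [s / sqrt 2] of the norm of the
    target component, so that concentration of this norm can be used. *)
Lemma active_cutoff_margin {R : realType} (K : R -> R) (L : R) :
  smooth_kernel K -> 0 < L -> active_cutoff K L ->
  exists a e : R, [/\ 1 / 2 <= a, 0 < e <= 1, a ^+ 2 = (1 - e) / 2 &
    0 < kernel_cdf K (L * a - 1)].
Proof.
move=> hK L0; rewrite /active_cutoff kernel_cdf_itv// => h.
pose a0 : R := (Num.sqrt 2)^-1.
have r20 : 0 < Num.sqrt 2 :> R by rewrite sqrtr_gt0.
have r22 : Num.sqrt 2 ^+ 2 = 2 :> R by rewrite sqr_sqrtr.
have a02 : a0 ^+ 2 = 1 / 2 by rewrite /a0 exprVn r22 mul1r.
have a0_gt0 : 0 < a0 by rewrite invr_gt0.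
have a0_gt : 1 / 2 < a0.
  rewrite -(@ltr_pXn2r _ 2) ?nnegrE ?(ltW a0_gt0)//; lra.
have cg : (fun a => kernel_cdf K (L * a - 1)) a @[a --> a0] --> kernel_cdf K (L * a0 - 1).
  apply: (@continuous_comp _ _ _ (fun a => L * a - 1) (kernel_cdf K)); last exact: kernel_cdf_continuous.
  apply: cvgB; last exact: cvg_cst.
  by apply: cvgM; [exact: cvg_cst|exact: cvg_id].
have cl := cvg_at_left_filter cg.
have : \forall a \near a0^'-, [/\ 0 < kernel_cdf K (L * a - 1), a < a0 & 1 / 2 < a].
  near=> a; split; near: a.
  - exact: (cvgr_gt _ cl).
  - exact: nbhs_left_lt.
  - exact: nbhs_left_gt.
move=> /filter_ex[a [ha al ag]].
have a2 : a ^+ 2 < 1 / 2 by rewrite -a02 ltr_pXn2r// nnegrE; lra.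
have a20 : 0 <= a ^+ 2 by exact: sqr_ge0.
exists a, (1 - 2 * a ^+ 2); split => //; try lra.
Unshelve. all: by end_near. Qed.

Section limits.
Context {R : realType} (d : nat -> measure_display) (T : forall n, measurableType (d n)).
Context (P : forall n, probability (T n) R).
Variables (m : nat -> nat) (L : R) (K : R -> R).
Variables (X tv tv0 : forall n, T n -> 'cV[R]_(m n + m n)).
Variable (ttheta : forall n, T n -> 'cV[R]_(m n)).
Arguments X : clear implicits.
Arguments tv : clear implicits.
Arguments tv0 : clear implicits.
Arguments ttheta : clear implicits.
Local Notation p n := ((m n + m n)%:R : R).
Local Notation s n := (scale R n (m n)).
Local Notation lik n := (fun w => loglik K L n (X n w)).
Hypotheses (L_gt0 : 0 < L) (hK : smooth_kernel K) (m_gt0 : forall n, (0 < m n)%N).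
Hypothesis p_small : (fun n => p n ^+ 2 / n%:R : R) @ \oo --> (0 : R).
Hypothesis gX : forall n, (0 < n)%N -> gaussian_vector (P n) (Num.sqrt n%:R)^-1 (X n).
Hypothesis tvP : forall n, (0 < n)%N -> random_vector (tv n) /\
     forall w, is_argmax setT (lik n w) (tv n w).
Hypothesis tv0P : forall n, (0 < n)%N -> random_vector (tv0 n) /\
     forall w, is_argmax [set v | usubmx v = 0] (lik n w) (tv0 n w).
Hypothesis thetaP : forall n, (0 < n)%N -> random_vector (ttheta n) /\
     forall w, is_argmax setT (profile (lik n w)) (ttheta n w).

Lemma p_ge2 n : 2 <= p n.
Proof. by rewrite ler_nat addnn (leq_double 1). Qed.

Lemma ratio_small (e : R) : 0 < e -> \forall n \near \oo, p n / Num.sqrt n%:R < e.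
Proof.
move=> e0; have e2 : 0 < e ^+ 2 by rewrite exprn_gt0.
apply: filterS (cvgr_lt _ p_small _ e2) => n h.
have r0 : 0 <= p n / Num.sqrt n%:R by rewrite divr_ge0// sqrtr_ge0.
rewrite -(@ltr_pXn2r _ 2) ?nnegrE//; last exact: ltW.
by rewrite expr_div_n sqr_sqrtr.
Qed.

Lemma scale_le_ratio n : s n <= p n / Num.sqrt n%:R.
Proof.
have p2 := p_ge2 n.
have r0 : 0 <= p n / Num.sqrt n%:R by rewrite divr_ge0// sqrtr_ge0.
rewrite -(@ler_pXn2r _ 2) ?nnegrE ?sqrtr_ge0//.
rewrite expr_div_n (sqr_sqrtr (ler0n R n)) scale_sq ler_wpM2r ?invr_ge0//.
rewrite expr2 ler_peMr//; lra.
Qed.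

Lemma scale_small (e : R) : 0 < e -> \forall n \near \oo, s n < e.
Proof.
move=> /ratio_small; apply: filterS => n; exact: le_lt_trans (scale_le_ratio n).
Qed.

Lemma sqrt_small (e : R) : 0 < e -> \forall n \near \oo, Num.sqrt (s n) < e.
Proof.
move=> e0; have e2 : 0 < e ^+ 2 by rewrite exprn_gt0.
apply: filterS (scale_small e2) => n h.
by rewrite -[ltRHS]gtr0_norm// -sqrtr_sqr ltr_sqrt.
Qed.

Local Notation r0 x := (fun n => local_radius (P n) (Num.sqrt n%:R)%:M 0 (tv n) (tv0 n) x).

Lemma r0_le n (k r x : R) : (0 < n)%N -> 0 <= k ->
  (Num.sqrt k + 3 * Num.sqrt (s n)) * Num.sqrt (p n) <= r ->
  x <= (k - 2) / 4 * p n -> r0 x n <= r.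
Proof.
move=> n0; have [h1 h2] := tvP n0; have [h3 h4] := tv0P n0.
exact: (local_radius_le hK L_gt0 n0 (m_gt0 n) (gX n0) h1 h2 h3 h4).
Qed.

(** In high dimension the squared norm of the Gaussian vector concentrates, so
    that the local set stays inside the ball where the expected likelihood is
    smooth. *)
Lemma local_set_smooth (x : R) : (fun n => (m n)%:R : R) @ \oo --> +oo ->
  \forall n \near \oo, local_set (Num.sqrt n%:R)%:M 0 (r0 x n) `<=`
    [set v | twice_differentiable (Elik (P n) (lik n)) v].
Proof.
move=> /cvgryPge moo; have [M [M1 _ _ K_flat]] := kernel_bounds hK.
have e6 : 0 < 1 / 6 :> R by [].
near=> n; have n0 : (0 < n)%N by near: n; exact: nbhs_infty_gt.
have s0 := scale_gt0 (R := R) n0 (m_gt0 n).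
move=> v /(local_setE (m := m n) n0) hv /=.
apply: (model_twice_differentiable hK L_gt0 M1 n0 (m_gt0 n) K_flat (gX n0)).
have q0 : 0 < Num.sqrt n%:R :> R by rewrite sqrtr_gt0 ltr0n.
have p0 : 0 < Num.sqrt (p n) by rewrite sqrtr_gt0 (lt_le_trans _ (p_ge2 n)).
have qs : Num.sqrt n%:R * s n = Num.sqrt (p n).
  by rewrite /scale -sqrtrM ?ler0n// mulrC divfK// pnatr_eq0 -lt0n.
have ss : Num.sqrt (s n) < 1 / 6 by near: n; exact: sqrt_small.
have px : 16 * x <= p n.
  have : 16 * x <= (m n)%:R by near: n; exact: moo.
  rewrite natrD; have : 0 <= (m n)%:R :> R by []. lra.
have k32 : Num.sqrt (9 / 4) = 3 / 2 :> R.
  by rewrite (_ : 9 / 4 = (3 / 2) ^+ 2) ?sqrtr_sqr ?ger0_norm//; field.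
rewrite -(ltr_pM2l q0) mulrCA qs; apply: le_lt_trans hv _.
apply: (@le_lt_trans _ _ ((Num.sqrt (9 / 4) + 3 * Num.sqrt (s n)) * Num.sqrt (p n))).
  by apply: (@r0_le n (9 / 4)) => //; lra.
by rewrite ltr_pM2r// k32; lra.
Unshelve. all: by end_near. Qed.

(** With [omega = 1 / n] the second term of the spread, of order
    [p ^ (3 / 2) / n], stays below [p / sqrt n] because [p <= n] eventually. *)
Lemma spread_bigO (x curv : R) : 0 < x -> 0 <= curv ->
  (fun n => spread (m n + m n)%N (m n) 0 1 n%:R^-1 1 (fun=> curv * s n) (r0 x n) x)
  =O_\oo (fun n => p n / Num.sqrt n%:R).
Proof.
move=> x0 c0; pose C := Num.sqrt (2 + 4 * x) + 3.
have C0 : 0 < C by rewrite ltr_wpDl// sqrtr_ge0.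
apply/eqO_exP; exists (C * (8 * curv + 6 * (x + 4))).
  by apply: mulr_gt0 => //; lra.
near=> n; have n0 : (0 < n)%N by near: n; exact: nbhs_infty_gt.
have s0 := scale_gt0 (R := R) n0 (m_gt0 n).
have s1 : s n < 1 by near: n; exact: scale_small.
have p2 := p_ge2 n.
have q0 : 0 < Num.sqrt n%:R :> R by rewrite sqrtr_gt0 ltr0n.
have qq : Num.sqrt n%:R ^+ 2 = n%:R :> R by rewrite sqr_sqrtr.
have rp0 : 0 < Num.sqrt (p n) by rewrite sqrtr_gt0 (lt_le_trans _ p2).
have rp2 : Num.sqrt (p n) ^+ 2 = p n by rewrite sqr_sqrtr.
have sE : s n = Num.sqrt (p n) / Num.sqrt n%:R.
  apply: (mulIf (lt0r_neq0 q0)); rewrite divfK ?lt0r_neq0//.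
  by rewrite /scale -sqrtrM ?ler0n// divfK// pnatr_eq0 -lt0n.
have rad : 0 <= r0 x n <= C * Num.sqrt (p n).
  rewrite local_radius_ge0 /=; apply: (@r0_le n (2 + 4 * x)) => //; first lra.
    rewrite ler_pM2r// lerD2l; have : Num.sqrt (s n) <= 1; last lra.
    by rewrite -sqrtr1 ler_wsqrtr// ltW.
  rewrite (_ : (_ - 2) / 4 = x); last by field.
  by rewrite ler_peMr//; lra.
have hc : 2 * p n + 2 * (m n)%:R + x + 1 <= (x + 4) * p n.
  have : 2 * (m n)%:R = p n by rewrite natrD; ring.
  have : 2 * x <= p n * x by rewrite ler_pM2r.
  lra.
apply: le_trans (spread_le (ltW x0) rad _ _ hc) _.
- by rewrite invr_ge0.
- by apply: mulr_ge0 => //; exact: ltW.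
rewrite [X in _ <= _ * X]ger0_norm; last by rewrite divr_ge0// ltW.
rewrite [leLHS](_ : _ = C * (8 * curv + 6 * (x + 4) * s n) * (p n / Num.sqrt n%:R)); last first.
  have split_sq (u v : R) : v != 0 ->
      (8 * (curv * (u / v)) + 6 * ((v ^+ 2)^-1 * ((x + 4) * u ^+ 2))) * (C * u) =
      C * (8 * curv + 6 * (x + 4) * (u / v)) * (u ^+ 2 / v) by move=> v0; field.
  by have := split_sq (Num.sqrt (p n)) (Num.sqrt n%:R) (lt0r_neq0 q0); rewrite qq rp2 -sE.
rewrite ler_wpM2r//.
rewrite ler_pM2l// lerD2l ler_piMr//; [lra|exact: ltW].
Unshelve. all: by end_near. Qed.

(** The dimension may grow or stay bounded: indices with [p n] above a threshold
    depending on the target probability use concentration, the others use that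
    [s n] tends to [0] while [p n] is bounded. *)
Lemma fisher_cvg : cvg_in_prob P (fun n => fisher_error n (X n) (ttheta n)) 0.
Proof.
have [M [M1 KM _ _]] := kernel_bounds hK.
move=> e e0; apply: cvg_prob0 => b b0.
pose C := 8 * M * L + 14.
have C0 : 0 < C.
  have : 0 < 8 * M * L by rewrite mulr_gt0// mulr_gt0// (lt_le_trans ltr01).
  rewrite /C; lra.
pose B := 2 * b^-1; have B0 : 0 < B by rewrite mulr_gt0// invr_gt0.
pose f := b / (12 * Num.sqrt B).
have rB : 0 < Num.sqrt B by rewrite sqrtr_gt0.
have f0 : 0 < f by rewrite divr_gt0// mulr_gt0.
have f2 : 0 < f ^+ 2 by rewrite exprn_gt0.
have eC : 0 < e / C by rewrite divr_gt0.
near=> n; have n0 : (0 < n)%N by near: n; exact: nbhs_infty_gt.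
have [h1 h2] := thetaP n0.
apply: (fisher_error_prob_le hK L_gt0 n0 (m_gt0 n) (gX n0) h1 h2 M1 KM).
- by apply: ltW; near: n; exact: scale_small.
- rewrite mulrC -ler_pdivlMr//; apply: ltW; near: n; exact: ratio_small.
case: (leP B (p n)) => pB; [left|right].
  by apply: expRN_le => //; rewrite ler_pdivlMr// mulrC.
have q4 : Num.sqrt (Num.sqrt (s n)) <= f.
  rewrite -[leRHS]gtr0_norm// -sqrtr_sqr ler_wsqrtr//; apply: ltW.
  by near: n; exact: sqrt_small.
have qB : Num.sqrt (p n) <= Num.sqrt B by rewrite ler_wsqrtr// ltW.
apply: le_trans (_ : 12 * (Num.sqrt B * f) <= _).
  by rewrite ler_pM2l//; apply: ler_pM => //; exact: sqrtr_ge0.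
by rewrite /f le_eqVlt; apply/orP; left; apply/eqP; field; rewrite gt_eqF.
Unshelve. all: by end_near. Qed.

Let wilks n w := wilks_error K L n (X n) (ttheta n) w.

Lemma wilks_cvg : (fun n => p n ^+ 3 / n%:R : R) @ \oo --> (0 : R) ->
  cvg_in_prob P (fun n w => `|wilks w|) 0.
Proof.
move=> p3 e e0; apply: cvg_prob0 => b b0.
have e2 : 0 < (3 / 16 * e) ^+ 2 by rewrite exprn_gt0// mulr_gt0.
near=> n; have n0 : (0 < n)%N by near: n; exact: nbhs_infty_gt.
have [h1 h2] := thetaP n0.
rewrite (_ : [set w | _] = set0) ?measure0 ?lee_fin ?ltW//.
apply/seteqP; split => // w /=; rewrite subr0 normr_id ger0_norm; last first.
  exact: (wilks_error_ge0 hK L_gt0 n0 (m_gt0 n) h2).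
apply/negP; rewrite -leNgt; apply: le_trans (wilks_error_le _ _ hK L_gt0 n0 (m_gt0 n) _) _.
rewrite -ler_pdivlMl// (_ : (16 / 3)^-1 * e = 3 / 16 * e); last by field.
rewrite -[leRHS]gtr0_norm ?mulr_gt0// -sqrtr_sqr ler_wsqrtr//; apply: ltW.
by near: n; exact: (cvgr_lt _ p3).
Unshelve. all: by end_near. Qed.

(** An index with [p ^ 3 / n] bounded away from [0] and [n] large has [p] large, so
    that the Wilks error is bounded below with probability at least [1 / 2]. *)
Lemma wilks_cvg_dim : active_cutoff K L -> cvg_in_prob P (fun n w => `|wilks w|) 0 ->
  (fun n => p n ^+ 3 / n%:R : R) @ \oo --> (0 : R).
Proof.
move=> /(active_cutoff_margin hK L_gt0)[a [e [a2 e01 ae c0]]] hw.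
set c := kernel_cdf K _ in c0.
apply/cvgrPdist_le => b b0; case/andP: (e01) => e0 e1.
pose eta := c / 24 * Num.sqrt b.
have rb : 0 < Num.sqrt b by rewrite sqrtr_gt0.
have eta0 : 0 < eta by rewrite /eta mulr_gt0// divr_gt0.
have /fine_cvgP[fin /(cvgr_lt _) lim] := hw _ eta0.
pose P0 := 32 / e ^+ 3.
have e3 : 0 < e ^+ 3 by rewrite exprn_gt0.
have P00 : 0 < P0 by rewrite divr_gt0.
near=> n; have n0 : (0 < n)%N by near: n; exact: nbhs_infty_gt.
have N0 : 0 < n%:R :> R by rewrite ltr0n.
have [h1 h2] := thetaP n0; have [h3 h4] := tvP n0.
rewrite sub0r normrN ger0_norm ?divr_ge0 ?exprn_ge0//.
rewrite leNgt; apply/negP => hb.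
have pP : P0 < p n.
  rewrite -(@ltr_pXn2r _ 3) ?nnegrE//; last exact: ltW.
  move: hb; rewrite ltr_pdivlMr//; apply: le_lt_trans.
  rewrite -ler_pdivrMl//; near: n; exact: nbhs_infty_ger.
have heta : eta < c / 12 * Num.sqrt (p n ^+ 3 / n%:R).
  apply: lt_le_trans (_ : c / 12 * Num.sqrt b <= _).
    rewrite /eta ltr_pM2r// ltr_pM2l//; lra.
  by rewrite ler_pM2l ?divr_gt0// ler_wsqrtr// ltW.
have := wilks_error_prob_ge hK L_gt0 n0 (m_gt0 n) (gX n0) h3 h4 h2 a2 e01 ae heta.
have fn : P n [set w | eta < `| `|wilks w| - 0|] \is a fin_num by near: n; exact: fin.
have half : 0 < 1 / 2 :> R by [].
have ln : fine (P n [set w | eta < `| `|wilks w| - 0|]) < 1 / 2 by near: n; exact: lim.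
have E4 : expR (- (e ^+ 3 / 8 * p n)) <= 1 / 4.
  apply: expRN_le => //; rewrite (_ : (1 / 4)^-1 = e ^+ 3 / 8 * P0); last first.
    by rewrite /P0; field; rewrite gt_eqF.
  by rewrite ler_pM2l ?divr_gt0// ltW.
by rewrite -(fineK fn) lee_fin; lra.
Unshelve. all: by end_near. Qed.

End limits.

Theorem theorem2p4 (R : realType)
  (d : nat -> measure_display) (T : forall n, measurableType (d n))
  (P : forall n, probability (T n) R)
  (m : nat -> nat) (L : R) (K : R -> R)
  (X : forall n, T n -> 'cV[R]_(m n + m n))
  (tv tv0 : forall n, T n -> 'cV[R]_(m n + m n))
  (ttheta : forall n, T n -> 'cV[R]_(m n)) :
  let p n : nat := (m n + m n)%N in
  let lik n (w : T n) : 'cV[R]_(m n + m n) -> R := loglik K L n (X n w) in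
  let breveL n (w : T n) : 'cV[R]_(m n) -> R := profile (lik n w) in
  let brevexi n (w : T n) : 'cV[R]_(m n) :=
    Num.sqrt n%:R *: usubmx (X n w) in
  let fisher n (w : T n) : R :=
    enorm ((Num.sqrt n%:R)%:M *m (ttheta n w - 0) - brevexi n w) in
  let wilks n (w : T n) : R :=
    2 * (breveL n w (ttheta n w) - breveL n w 0) - enorm (brevexi n w) ^+ 2 in
  0 < L -> smooth_kernel K ->
  (forall n, (0 < m n)%N) ->
  (fun n => (p n)%:R ^+ 2 / n%:R : R) @ \oo --> (0 : R) ->
  (forall n, (0 < n)%N -> gaussian_vector (P n) (Num.sqrt n%:R)^-1 (X n)) ->
  (forall n, (0 < n)%N -> random_vector (tv n) /\
     forall w, is_argmax setT (lik n w) (tv n w)) ->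
  (forall n, (0 < n)%N -> random_vector (tv0 n) /\
     forall w, is_argmax [set v | usubmx v = 0] (lik n w) (tv0 n w)) ->
  (forall n, (0 < n)%N -> random_vector (ttheta n) /\
     forall w, is_argmax setT (breveL n w) (ttheta n w)) ->
  [/\ forall x : R, 0 < x ->
        let DD n : 'M[R]_(m n + m n) := (Num.sqrt n%:R)%:M in
        let D n : 'M[R]_(m n) := (Num.sqrt n%:R)%:M in
        let A n := ursubmx (info (P n) (lik n) 0) in
        let r0 n := local_radius (P n) (DD n) 0 (tv n) (tv0 n) x in
        let smooth n := [set v | twice_differentiable (Elik (P n) (lik n)) v] in
        exists (rho nu0 nu1 g : R) (omega : nat -> R) (delta : nat -> R -> R),
        [/\ \forall n \near \oo,
              [/\ is_unique_argmax (Elik (P n) (lik n)) 0,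
                  twice_differentiable (Elik (P n) (lik n)) 0,
                  info (P n) (lik n) 0 = n%:R%:M /\
                    cov_score (P n) (lik n) 0 = n%:R%:M &
                  [/\ DD n *m DD n = info (P n) (lik n) 0,
                      D n *m D n = ulsubmx (info (P n) (lik n) 0) &
                      D n *m D n = drsubmx (info (P n) (lik n) 0)]],
            \forall n \near \oo,
              [/\ cond_I (D n) (A n) (D n) rho,
                  cond_L0 (P n) (lik n) (DD n) 0 (D n) (A n) (D n) (r0 n)
                    (smooth n) (delta n) &
                  [/\ cond_ED0 (P n) (lik n) (DD n) 0 nu0 g,
                      cond_ED1 (P n) (lik n) (DD n) 0 (r0 n) nu1 (omega n) g,
                      cond_Lr (P n) (lik n) (DD n) 0 (r0 n) &
                      cond_Er (P n) (lik n) (DD n) 0 (r0 n)]],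
            (fun n => (m n)%:R : R) @ \oo --> +oo ->
              \forall n \near \oo, local_set (DD n) 0 (r0 n) `<=` smooth n &
            (fun n => spread (p n) (m n) rho nu1 (omega n) g (delta n) (r0 n) x)
              =O_\oo (fun n => (p n)%:R / Num.sqrt n%:R)],
      cvg_in_prob P fisher 0 &
      ((fun n => (p n)%:R ^+ 3 / n%:R : R) @ \oo --> (0 : R) ->
         cvg_in_prob P (fun n w => `|wilks n w|) 0) /\
      (active_cutoff K L -> cvg_in_prob P (fun n w => `|wilks n w|) 0 ->
         (fun n => (p n)%:R ^+ 3 / n%:R : R) @ \oo --> (0 : R))].
Proof.
move=> p lik breveL brevexi fisher wilks L0 hK m0 p_small gX tvP tv0P thetaP.
have [M [M1 KM dKM K_flat]] := kernel_bounds hK.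
have c34 : 0 < 3 / 4 :> R by [].
split.
- move=> x x0 DD D A r0 smooth.
  exists 0, 1, 1, 1, (fun n => n%:R^-1), (fun n _ => curvature L M * scale R n (m n)).
  split.
  + near=> n; have n0 : (0 < n)%N by near: n; exact: nbhs_infty_gt.
    have s34 : scale R n (m n) < 3 / 4 by near: n; exact: scale_small.
    have i0 := info0 hK L0 M1 n0 (m0 n) KM dKM K_flat (gX n n0).
    split.
    * exact: (mean_argmax hK L0 n0 (m0 n) (gX n n0) s34).
    * apply: (model_twice_differentiable hK L0 M1 n0 (m0 n) K_flat (gX n n0)).
      by rewrite enorm0 mulr_gt0// scale_gt0.
    * split => //; exact: (cov_score0 hK L0 M1 n0 (m0 n) K_flat (gX n n0)).
    * rewrite i0 ulsubmx_scalar drsubmx_scalar.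
      by split; [exact: DD_sq|exact: D_sq|exact: D_sq].
  + near=> n; have n0 : (0 < n)%N by near: n; exact: nbhs_infty_gt.
    have n2 : 2 <= n%:R :> R by near: n; exact: nbhs_infty_ger.
    have s34 : scale R n (m n) < 3 / 4 by near: n; exact: scale_small.
    split.
    * exact: (model_cond_I hK L0 M1 n0 (m0 n) KM dKM K_flat (gX n n0)).
    * exact: (model_cond_L0 hK L0 M1 n0 (m0 n) KM dKM K_flat (gX n n0)).
    * split.
      - exact: (model_cond_ED0 K L n0 (gX n n0)).
      - apply: (model_cond_ED1 K L n0 (gX n n0)).
        by rewrite invr_gt0 ltr0n n0 mul1r lef_pV2 ?posrE ?ltr0n.
      - exact: (model_cond_Lr hK L0 n0 (m0 n) (gX n n0) s34).
      - exact: (model_cond_Er K L n0 (gX n n0)).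
  + exact: (local_set_smooth L0 hK m0 p_small gX tvP tv0P).
  + apply: (spread_bigO L0 hK m0 p_small gX tvP tv0P x0).
    exact: curvature_ge0.
- exact: (fisher_cvg L0 hK m0 p_small gX thetaP).
split.
- exact: (wilks_cvg _ L0 hK m0 thetaP).
- exact: (wilks_cvg_dim L0 hK m0 gX tvP thetaP).
Unshelve. all: by end_near. Qed.
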